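(* Let $\alpha$ be a continuous $\|\cdot\|_1$-dominating normalized gauge norm. Let $W$ be an $\alpha$-closed linear subspace of $L^\alpha$, and let $M$ be a weak*-closed linear subspace of $L^\infty$ such that $zM\subseteq M$ and $zW\subseteq W$. Then: (1) $M=[M]^{-\alpha}\cap L^\infty$; (2) $W\cap M$ is weak*-closed in $L^\infty$; (3) $W=[W\cap L^\infty]^{-\alpha}$.
   Context: $m$ is normalized arc length (Haar) measure on the unit circle $\mathbb{T}=\{\lambda\in\mathbb{C}:|\lambda|=1\}$; $L^p=L^p(\mathbb{T},m)$ consists of complex-valued functions, and functions equal a.e. $(m)$ are identified. $z$ denotes the coordinate function on $\mathbb{T}$. The weak* topology on $L^\infty$ is that of $L^\infty$ as the dual of $L^1$. A norm $\alpha$ on $L^\infty$ is a $\|\cdot\|_1$-dominating normalized gauge norm if (1) $\alpha(1)=1$; (2) $\alpha(|f|)=\alpha(f)$ for all $f\in L^\infty$; (3) $\alpha(f)\ge\|f\|_1$ for all $f\in L^\infty$. It is continuous if $\lim_{m(E)\to0^+}\alpha(\chi_E)=0$. It is extended to all measurable $f:\mathbb{T}\to\mathbb{C}$ by $\alpha(f)=\sup\{\alpha(s): s \text{ a simple function},\ 0\le s\le|f|\}$. Put $\mathcal{L}^\alpha=\{f:\alpha(f)<\infty\}$; $L^\alpha$ is the $\alpha$-closure of $L^\infty$ in $\mathcal{L}^\alpha$. For $S\subset L^\alpha$, $[S]^{-\alpha}$ denotes the closure of $S$ in $L^\alpha$ with respect to the norm $\alpha$. *)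

(* Defs.v *)
From HB Require Import structures.
From mathcomp Require Import all_boot all_order all_algebra.
From mathcomp Require Import complex.
From mathcomp Require Import all_classical all_reals all_analysis.
From mathcomp Require Import measurable_realfun.
Set Implicit Arguments.
Unset Strict Implicit.
Unset Printing Implicit Defensive.
Import Order.TTheory GRing.Theory Num.Theory.
Import numFieldNormedType.Exports.
Import ComplexField.Normc.
Import HBSimple HBNNSimple.

Local Open Scope classical_set_scope.
Local Open Scope ring_scope.
Local Open Scope complex_scope.

(* C carries the Borel sigma-algebra of R x R, and the circle its trace. *)
HB.instance Definition _ (R : realType) := isPointed.Build R[i] 0.

Section complex_measurable.
Variable R : realType.

Definition complex_pair (w : R[i]) : R * R := (complex.Re w, complex.Im w).

Local Notation G := (g_sigma_algebra_preimageType complex_pair).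

HB.instance Definition _ := @isMeasurable.Build default_measure_display R[i]
  (g_sigma_algebra_preimage complex_pair) (@measurable0 _ G)
  (@measurableC _ G) (@bigcupT_measurable _ G).

End complex_measurable.

Definition circle (R : realType) : Type := {w : R[i] | normc w == 1}.

Section circle.
Variable R : realType.

HB.instance Definition _ := Choice.on (circle R).

Lemma expi_subproof (t : R) :
  normc (cos (2 * pi * t) +i* sin (2 * pi * t)) == 1.
Proof. by rewrite /= cos2Dsin2 sqrtr1. Qed.

(* t |-> exp (2 pi i t) *)
Definition expi (t : measurableTypeR R) : circle R :=
  exist (fun w : R[i] => normc w == 1) _ (expi_subproof t).

HB.instance Definition _ := isPointed.Build (circle R) (expi 0).

Definition coord (w : circle R) : R[i] := sval w.

Local Notation G := (g_sigma_algebra_preimageType coord).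

HB.instance Definition _ :=
  @isMeasurable.Build default_measure_display (circle R)
    (g_sigma_algebra_preimage coord) (@measurable0 _ G)
    (@measurableC _ G) (@bigcupT_measurable _ G).

Lemma measurable_expi : measurable_fun [set: measurableTypeR R] expi.
Proof.
have mlin : measurable_fun [set: R] (fun t : R => 2 * pi * t).
  exact: mulrl_measurable.
have mcs : measurable_fun [set: R]
    (fun t : R => (cos (2 * pi * t), sin (2 * pi * t))).
  apply: measurable_fun_pair; apply: measurableT_comp mlin => //.
    by apply: continuous_measurable_fun; exact: continuous_cos.
  by apply: continuous_measurable_fun; exact: continuous_sin.
move=> _ _ [_ [B mB <-] <-].
have := mcs measurableT B mB; rewrite !setTI.
by congr measurable.
Qed.

HB.instance Definition _ :=
  isMeasurableFun.Build _ _ _ _ expi measurable_expi.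

End circle.

(* Normalized arc length: the law of exp (2 pi i t) for t uniform on [0, 1]. *)
Definition haar (R : realType) : probability (circle R) R :=
  distribution (uniform_prob (@ltr01 R)) (@expi R).

Section spaces.
Variable R : realType.
Local Notation T := (circle R).
Local Notation C := R[i].
Local Notation m := (haar R).
Implicit Types (f g : T -> C) (S X : set (T -> C)).

(* Functions are not quotiented by a.e. equality.  A set of functions that is
   closed in the sense of weakstar_closed or gauge_closed is automatically
   saturated for a.e. equality of measurable functions, so that it amounts to
   a set of classes. *)
Definition Lp (p : \bar R) : set (T -> C) :=
  [set f | measurable_fun setT f /\ finite_norm m p (@normc R \o f)].

Definition complex_integral f : C :=
  (\int[m]_w complex.Re (f w)) +i* (\int[m]_w complex.Im (f w)).

(* The topology of L^oo as the dual of L^1: pointwise convergence on L^1. *)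
Definition pairing (f : Lp +oo) : prod_topology (fun _ : Lp 1 => C^o) :=
  fun g : Lp 1 => complex_integral (fun w => set_val f w * set_val g w).

Definition weakstar_Linfty := initial_topology pairing.

Definition weakstar_closed S :=
  S `<=` Lp +oo /\ closed ((@set_val _ (Lp +oo)) @^-1` S : set weakstar_Linfty).

Definition linear_subspace S := S (cst 0) /\
  forall (a : C) f g, S f -> S g -> S (fun w => a * f w + g w).

Definition mulz f : T -> C := fun w => coord w * f w.

Definition z_invariant S := forall f, S f -> S (mulz f).

(* alpha is a norm on classes of bounded functions: it is only constrained on
   L^oo, where it is compatible with a.e. equality. *)
Record dominating_normalized_gauge_norm (alpha : (T -> C) -> R) : Prop := {
  gauge_ae : forall f g, Lp +oo f -> Lp +oo g ->
    ae_eq m setT f g -> alpha f = alpha g;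
  gauge_triangle : forall f g, Lp +oo f -> Lp +oo g ->
    alpha (fun w => f w + g w) <= alpha f + alpha g;
  gauge_scale : forall (a : C) f, Lp +oo f ->
    alpha (fun w => a * f w) = normc a * alpha f;
  gauge_definite : forall f, Lp +oo f ->
    alpha f = 0 -> ae_eq m setT f (cst 0);
  gauge_one : alpha (cst 1) = 1;
  gauge_abs : forall f, Lp +oo f -> alpha (fun w => (normc (f w))%:C) = alpha f;
  gauge_dominating : forall f, Lp +oo f ->
    ('N[m]_1[EFin \o (@normc R \o f)] <= (alpha f)%:E)%E
}.

Definition continuous_gauge (alpha : (T -> C) -> R) :=
  forall e : R, 0 < e -> exists2 d : R, 0 < d &
    forall E : set T, measurable E -> (0 < m E)%E -> (m E < d%:E)%E ->
      alpha (fun w => (\1_E w)%:C) < e.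

Section extension.
Variable alpha : (T -> C) -> R.

(* The order 0 <= s <= |f| is that of classes, hence a.e. *)
Definition gauge_ext f : \bar R :=
  ereal_sup [set (alpha (fun w => (s w)%:C))%:E |
    s in [set s : {nnsfun T >-> R} | {ae m, forall w, s w <= normc (f w)}]].

Definition calL_gauge : set (T -> C) :=
  [set f | measurable_fun setT f /\ (gauge_ext f < +oo)%E].

Definition gauge_closure_in X S : set (T -> C) :=
  [set f | X f /\ forall e : R, 0 < e ->
    exists2 g, S g & (gauge_ext (fun w => f w - g w)%R < e%:E)%E].

Definition L_gauge : set (T -> C) := gauge_closure_in calL_gauge (Lp +oo).

Definition gauge_closure S := gauge_closure_in L_gauge S.

Definition gauge_closed S := S `<=` L_gauge /\ gauge_closure S `<=` S.

End extension.

End spaces.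

(* Main.v *)
Require Import Defs.
From mathcomp Require Import all_boot all_order all_algebra.
From mathcomp Require Import complex.
From mathcomp Require Import all_classical all_reals all_analysis.
From mathcomp Require Import measurable_realfun ess_sup_inf.
From mathcomp Require Import ring lra.
Set Implicit Arguments.
Unset Strict Implicit.
Unset Printing Implicit Defensive.
Import Order.TTheory GRing.Theory Num.Theory.
Import numFieldNormedType.Exports.
Import ComplexField.Normc.
Import HBSimple HBNNSimple.
Import Defs.

Local Open Scope classical_set_scope.
Local Open Scope ring_scope.
Local Open Scope complex_scope.

Local Notation Re := complex.Re.
Local Notation Im := complex.Im.

(** The three statements rest on one device, the outer multiplier.  For an
    integrable h >= 0 there is a bounded analytic function phi such that both
    |phi| and |phi| h are at most 1 + int h, and such that phi tends to 1 in
    mean when int h tends to 0 (outer_multiplier).  Multiplication by phi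
    makes a function of size h bounded, it moves functions only a little, and
    it preserves closed z-invariant subspaces, because phi is a limit in mean
    of uniformly bounded polynomials in z.

    Bounded convergence in mean is stronger than weak* convergence
    (weakstar_bounded_limit) and, alpha being continuous, stronger than
    alpha-convergence (ext_small_of_mean).  Hence a subspace S of L^oo that is
    z-invariant and closed in either sense contains every bounded f which is
    a limit in mean of elements v of S, even without a uniform bound on these
    (mean_closure): if phi is attached to h = |v - f| then
    phi v = phi (v - f) + phi f lies in S, differs boundedly from f, and is
    close to f in mean.

    (1) An alpha-limit of elements of M is a limit in mean, since alpha
    dominates the norm of L^1, so that mean_closure applies to M.

    (2) Let f be in the weak* closure of W & M.  If r is the component of f
    orthogonal to W & M in L^2, then the conjugate of r is an L^1 function
    annihilating W & M, hence f, and therefore r = 0: f is a limit in L^2, a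
    fortiori in mean, of elements of W & M (weakstar_closure_mean), and
    mean_closure applies again.

    (3) For f in W and h = t |f|, the product phi f is bounded, lies in W, and
    tends to f in gauge when t tends to 0, by dominated convergence in gauge
    (ext_mul_small).

    The multiplier is phi = u^2, where u solves the extremal problem of Szego,
    in the manner of Helson and Lowdenslager.  Let w = 1 + h and let u be the
    component of 1 orthogonal, in L^2(w dm), to the polynomials vanishing at
    the origin.  Then u is orthogonal to z^n u for all n > 0, so the Fourier
    coefficients of |u|^2 w other than the mean vanish, and |u|^2 w is
    constant (fourier_uniqueness, szego).  Polynomials that approximate u
    boundedly are its Fejer means (fejer_approximation). *)

(** * Complex-valued measurable functions *)

Section complex_numbers.
Variable R : realType.
Implicit Types (z : R[i]).

(** The squared modulus and the real inner product of the plane: integrals of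
    real functions suffice for most of the development. *)
Definition sq z : R := Re z ^+ 2 + Im z ^+ 2.
Definition dot (z1 z2 : R[i]) : R := Re z1 * Re z2 + Im z1 * Im z2.

Lemma ReD (z1 z2 : R[i]) : Re (z1 + z2) = Re z1 + Re z2.
Proof. by case: z1 z2 => [a b] [c d]. Qed.
Lemma ImD (z1 z2 : R[i]) : Im (z1 + z2) = Im z1 + Im z2.
Proof. by case: z1 z2 => [a b] [c d]. Qed.
Lemma ReN z : Re (- z) = - Re z.
Proof. by case: z. Qed.
Lemma ImN z : Im (- z) = - Im z.
Proof. by case: z. Qed.
Lemma ReM (z1 z2 : R[i]) : Re (z1 * z2) = Re z1 * Re z2 - Im z1 * Im z2.
Proof. by case: z1 z2 => [a b] [c d]. Qed.
Lemma ImM (z1 z2 : R[i]) : Im (z1 * z2) = Re z1 * Im z2 + Im z1 * Re z2.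
Proof. by case: z1 z2 => [a b] [c d]. Qed.
Lemma Re0 : Re (0 : R[i]) = 0. Proof. by []. Qed.
Lemma Im0 : Im (0 : R[i]) = 0. Proof. by []. Qed.
Lemma Re1 : Re (1 : R[i]) = 1. Proof. by []. Qed.
Lemma Im1 : Im (1 : R[i]) = 0. Proof. by []. Qed.
Lemma ReJ z : Re (conjc z) = Re z. Proof. by case: z. Qed.
Lemma ImJ z : Im (conjc z) = - Im z. Proof. by case: z. Qed.

Definition reim := (ReD, ImD, ReN, ImN, ReM, ImM, Re0, Im0, Re1, Im1, ReJ, ImJ).

Lemma sq_ge0 z : 0 <= sq z.
Proof. by rewrite addr_ge0 ?sqr_ge0. Qed.

Lemma normcE z : normc z = Num.sqrt (sq z).
Proof. by case: z. Qed.

Lemma normc_ge0 z : 0 <= normc z.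
Proof. by rewrite normcE sqrtr_ge0. Qed.

Lemma sqr_normc z : normc z ^+ 2 = sq z.
Proof. by rewrite normcE sqr_sqrtr// sq_ge0. Qed.

Lemma normcN z : normc (- z) = normc z.
Proof. by rewrite !normcE /sq !reim !sqrrN. Qed.

Lemma normcB (z1 z2 : R[i]) : normc (z1 - z2) = normc (z2 - z1).
Proof. by rewrite -normcN opprB. Qed.

Lemma normcD (z1 z2 : R[i]) : normc (z1 + z2) <= normc z1 + normc z2.
Proof. by rewrite -lecR rmorphD/=; exact: (ComplexField.lec_normD z1 z2). Qed.

Lemma normc_conj z : normc (conjc z) = normc z.
Proof. by rewrite !normcE /sq !reim sqrrN. Qed.

Lemma normc_real (x : R) : normc x%:C = `|x|.
Proof. by rewrite /= expr0n addr0 sqrtr_sqr. Qed.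

Lemma Re_le_normc z : `|Re z| <= normc z.
Proof.
rewrite normcE -sqrtr_sqr ler_sqrt ?sq_ge0// /sq.
by rewrite lerDl sqr_ge0.
Qed.

Lemma Im_le_normc z : `|Im z| <= normc z.
Proof.
rewrite normcE -sqrtr_sqr ler_sqrt ?sq_ge0// /sq.
by rewrite lerDr sqr_ge0.
Qed.

Lemma normc_le_ReIm z : normc z <= `|Re z| + `|Im z|.
Proof.
case: z => a b; rewrite -(ler_pXn2r (n := 2)) ?nnegrE ?addr_ge0 ?normc_ge0//.
rewrite sqr_normc /sq/= sqrrD -!normrX (ger0_norm (sqr_ge0 a)) (ger0_norm (sqr_ge0 b)).
by rewrite addrAC lerDl mulrn_wge0 ?mulr_ge0.
Qed.

Lemma sqM (z1 z2 : R[i]) : sq (z1 * z2) = sq z1 * sq z2.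
Proof. by rewrite /sq !reim; ring. Qed.

End complex_numbers.

Section measurability.
Context {d : measure_display} {T : measurableType d} {R : realType}.
Implicit Types f g : T -> R[i].

Lemma measurable_Re : measurable_fun [set: R[i]] (@Re R).
Proof.
move=> _ B mB; rewrite setTI.
exists (B `*` setT); first exact: measurableX.
by rewrite setTI; apply/seteqP; split => [x []|x Bx] //=.
Qed.

Lemma measurable_Im : measurable_fun [set: R[i]] (@Im R).
Proof.
move=> _ B mB; rewrite setTI.
exists (setT `*` B); first exact: measurableX.
by rewrite setTI; apply/seteqP; split => [x []|x Bx] //=.
Qed.

Lemma measurable_ReIm f : measurable_fun setT (fun x => Re (f x)) ->
  measurable_fun setT (fun x => Im (f x)) -> measurable_fun setT f.
Proof.
move=> mr mi _ _ [B mB <-]; rewrite !setTI.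
have mri := measurable_fun_pair mr mi.
by have := mri measurableT B mB; rewrite setTI.
Qed.

Lemma measurable_RE f : measurable_fun setT f ->
  measurable_fun setT (fun x => Re (f x)).
Proof. by move=> mf; apply: measurableT_comp measurable_Re mf. Qed.

Lemma measurable_IM f : measurable_fun setT f ->
  measurable_fun setT (fun x => Im (f x)).
Proof. by move=> mf; apply: measurableT_comp measurable_Im mf. Qed.

Lemma measurable_cD f g : measurable_fun setT f -> measurable_fun setT g ->
  measurable_fun setT (fun x => f x + g x).
Proof.
move=> mf mg; apply: measurable_ReIm.
  under eq_fun do rewrite ReD.
  by apply: measurable_funD; exact: measurable_RE.
under eq_fun do rewrite ImD.
by apply: measurable_funD; exact: measurable_IM.
Qed.

Lemma measurable_cN f : measurable_fun setT f ->
  measurable_fun setT (fun x => - f x).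
Proof.
move=> mf; apply: measurable_ReIm.
  under eq_fun do rewrite ReN.
  by apply: measurableT_comp => //; exact: measurable_RE.
under eq_fun do rewrite ImN.
by apply: measurableT_comp => //; exact: measurable_IM.
Qed.

Lemma measurable_cB f g : measurable_fun setT f -> measurable_fun setT g ->
  measurable_fun setT (fun x => f x - g x).
Proof. by move=> mf mg; apply: measurable_cD => //; exact: measurable_cN. Qed.

Lemma measurable_cM f g : measurable_fun setT f -> measurable_fun setT g ->
  measurable_fun setT (fun x => f x * g x).
Proof.
move=> mf mg; apply: measurable_ReIm.
  under eq_fun do rewrite ReM.
  by apply: measurable_funB; apply: measurable_funM;
    (exact: measurable_RE || exact: measurable_IM).
under eq_fun do rewrite ImM.
by apply: measurable_funD; apply: measurable_funM;
  (exact: measurable_RE || exact: measurable_IM).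
Qed.

Lemma measurable_conj f : measurable_fun setT f ->
  measurable_fun setT (fun x => conjc (f x)).
Proof.
move=> mf; apply: measurable_ReIm.
  by under eq_fun do rewrite ReJ; exact: measurable_RE.
under eq_fun do rewrite ImJ.
by apply: measurableT_comp => //; exact: measurable_IM.
Qed.

Lemma measurable_sq f : measurable_fun setT f ->
  measurable_fun setT (fun x => sq (f x)).
Proof.
move=> mf; apply: measurable_funD; apply: measurable_funX;
  (exact: measurable_RE || exact: measurable_IM).
Qed.

Lemma measurable_dot f g : measurable_fun setT f -> measurable_fun setT g ->
  measurable_fun setT (fun x => dot (f x) (g x)).
Proof.
move=> mf mg; apply: measurable_funD; apply: measurable_funM;
  (exact: measurable_RE || exact: measurable_IM).
Qed.

Lemma measurable_normc f : measurable_fun setT f ->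
  measurable_fun setT (fun x => normc (f x)).
Proof.
move=> mf; under eq_fun do rewrite normcE.
have ms : measurable_fun [set: R] (@Num.sqrt R).
  by apply: continuous_measurable_fun; exact: sqrt_continuous.
exact: measurableT_comp ms (measurable_sq mf).
Qed.

Lemma measurable_real_complex (f : T -> R) : measurable_fun setT f ->
  measurable_fun setT (fun x => (f x)%:C).
Proof. by move=> mf; apply: measurable_ReIm => //=. Qed.

End measurability.

(** * Integrals against a probability measure *)

Section real_integrals.
Context {d : measure_display} {T : measurableType d} {R : realType}.
Variable P : probability T R.
Implicit Types f g : T -> R.
Local Notation Int f := (P.-integrable [set: T] (EFin \o f)).

Lemma Int_meas f : Int f -> measurable_fun setT f.
Proof. by move=> /measurable_int/measurable_EFinP. Qed.

Lemma Int_le f g : measurable_fun setT f -> (forall x, `|f x| <= g x) ->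
  Int g -> Int f.
Proof.
move=> mf fg; apply: le_integrable => //; first exact/measurable_EFinP.
by move=> x _ /=; rewrite lee_fin (le_trans (fg x))// ler_norm.
Qed.

Lemma Int_cst c : Int (fun _ : T => c : R).
Proof. exact: finite_measure_integrable_cst. Qed.

Lemma Int_bounded f c : measurable_fun setT f -> (forall x, `|f x| <= c) ->
  Int f.
Proof. by move=> mf fc; apply: Int_le mf fc (Int_cst c). Qed.

Lemma IntD f g : Int f -> Int g -> Int (fun x => f x + g x).
Proof. by move=> If Ig; apply: eq_integrable (integrableD _ If Ig). Qed.

Lemma IntB f g : Int f -> Int g -> Int (fun x => f x - g x).
Proof. by move=> If Ig; apply: eq_integrable (integrableB _ If Ig). Qed.

Lemma IntZ c f : Int f -> Int (fun x => c * f x).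
Proof. by move=> If; apply: eq_integrable (integrableZl _ c If). Qed.

Lemma Int_abs f : Int f -> Int (fun x => `|f x|).
Proof. exact: integrable_norm. Qed.

Lemma RID f g : Int f -> Int g ->
  \int[P]_x (f x + g x) = \int[P]_x f x + \int[P]_x g x.
Proof. exact: RintegralD. Qed.

Lemma RIB f g : Int f -> Int g ->
  \int[P]_x (f x - g x) = \int[P]_x f x - \int[P]_x g x.
Proof. exact: RintegralB. Qed.

Lemma RIZ c f : Int f -> \int[P]_x (c * f x) = c * \int[P]_x f x.
Proof. exact: RintegralZl. Qed.

Lemma RI_cst c : \int[P]_(x in setT) (c : R) = c.
Proof.
rewrite Rintegral_cst// -[RHS]mulr1; congr (_ * _).
have PT := probability_setT P.
exact: (congr1 fine PT).
Qed.

Lemma RI_le f g : Int f -> Int g -> (forall x, f x <= g x) ->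
  \int[P]_x f x <= \int[P]_x g x.
Proof. by move=> If Ig fg; apply: le_Rintegral. Qed.

Lemma RI_ge0 f : (forall x, 0 <= f x) -> 0 <= \int[P]_x f x.
Proof. by move=> f0; apply: Rintegral_ge0. Qed.

Lemma EFin_RI f : Int f -> (\int[P]_x (f x)%:E)%E = (\int[P]_x f x)%:E.
Proof. by move=> If; rewrite fineK// integrable_fin_num. Qed.

Lemma RI_eq_ae f g : measurable_fun setT f -> measurable_fun setT g ->
  {ae P, forall x, f x = g x} -> \int[P]_x f x = \int[P]_x g x.
Proof.
move=> mf mg fg; rewrite /Rintegral (ae_eq_integral (EFin \o g))//.
- exact/measurable_EFinP.
- exact/measurable_EFinP.
- by apply: filterS fg => x fgx _ /=; rewrite fgx.
Qed.

(** Reduced to the pointwise inequality with max (f, g), which is g almost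
    everywhere. *)
Lemma RI_le_ae f g : Int f -> Int g -> {ae P, forall x, f x <= g x} ->
  \int[P]_x f x <= \int[P]_x g x.
Proof.
move=> If Ig fg.
have mM : measurable_fun setT (fun x => Num.max (f x) (g x)).
  by apply: measurable_maxr; exact: Int_meas.
have IM : Int (fun x => Num.max (f x) (g x)).
  apply: Int_le mM _ (IntD (Int_abs If) (Int_abs Ig)) => x.
  by rewrite /Num.max; case: ifP => _; rewrite ?lerDl ?lerDr.
rewrite (@RI_eq_ae g (fun x => Num.max (f x) (g x)))//; last 2 first.
- exact: Int_meas.
- by apply: filterS fg => x /max_idPr.
by apply: RI_le => // x; rewrite le_max lexx.
Qed.

Lemma ge0_Int f c : measurable_fun setT f -> (forall x, 0 <= f x) ->
  (\int[P]_x (f x)%:E <= c%:E)%E -> Int f /\ \int[P]_x f x <= c.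
Proof.
move=> mf f0 fc; have If : Int f.
  apply/integrableP; split; first exact/measurable_EFinP.
  rewrite (eq_integral (EFin \o f)).
    by rewrite (le_lt_trans fc)// ltry.
  by move=> x _ /=; rewrite ger0_norm.
by split => //; rewrite -lee_fin -EFin_RI.
Qed.

Lemma Int_le_ae f g : measurable_fun setT f -> Int g ->
  {ae P, forall x, `|f x| <= g x} -> Int f.
Proof.
move=> mf Ig fg; apply/integrableP; split; first exact/measurable_EFinP.
move/integrableP : (Ig) => [_]; apply: le_lt_trans.
apply: ae_ge0_le_integral => //=.
- by apply/measurable_EFinP; exact: measurableT_comp.
- by apply/measurable_EFinP; apply: measurableT_comp => //; exact: Int_meas.
- by apply: filterS fg => x fgx _; rewrite lee_fin (le_trans fgx)// ler_norm.
Qed.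

Lemma ae_eq0_of_RI f : Int f -> (forall x, 0 <= f x) -> \int[P]_x f x = 0 ->
  {ae P, forall x, f x = 0}.
Proof.
move=> If f0 If0; have := measurable_int _ If.
move=> /(ae_eq_integral_abs P measurableT)[h _].
have {}h : ae_eq P setT (EFin \o f) (cst 0%E).
  apply: h; rewrite (eq_integral (EFin \o f)).
    by rewrite EFin_RI// If0.
  by move=> x _ /=; rewrite ger0_norm.
by apply: filterS h => x /(_ I) [].
Qed.

(** Fatou, along a pointwise convergent sequence. *)
Lemma fatou_bound (f : (T -> R)^nat) (g : T -> R) (c : R) :
  (forall n, measurable_fun setT (f n)) -> (forall n x, 0 <= f n x) ->
  (forall x, f ^~ x @ \oo --> g x) ->
  (forall n, \int[P]_x (f n x)%:E <= c%:E)%E ->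
  (\int[P]_x (g x)%:E <= c%:E)%E.
Proof.
move=> mf f0 fg fc.
have mEf n : measurable_fun setT (fun x => (f n x)%:E).
  exact/measurable_EFinP.
have Ef0 n x : setT x -> (0 <= (f n x)%:E)%E by rewrite lee_fin.
have := fatou P measurableT mEf Ef0.
rewrite (eq_integral (fun x => (g x)%:E)); last first.
  move=> x _; have h : (fun n => (f n x)%:E) @ \oo --> (g x)%:E.
    by apply: cvg_EFin; [exact: nearW|exact: fg].
  by rewrite is_cvg_limn_einfE; [exact/cvg_lim|apply/cvg_ex; exists (g x)%:E].
move=> /le_trans; apply; rewrite limn_einf_lim.
apply: lime_le; first exact: is_cvg_einfs.
apply: nearW => n; apply: le_trans (fc n).
by apply: ereal_inf_lbound; exists n => /=.
Qed.

End real_integrals.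

(** * Orthogonal projection in weighted L^2 spaces *)

Section L2_complete.
Context {d : measure_display} {T : measurableType d} {R : realType}.
Variables (P : probability T R) (w : T -> R).
Hypotheses (mw : measurable_fun setT w) (w1 : forall x, 1 <= w x).

Let w0 x : 0 <= w x. Proof. exact: le_trans (w1 x). Qed.

Lemma sum_half (n : nat) : \sum_(0 <= i < n) (2^-1 : R) ^+ i <= 2.
Proof.
suff -> : \sum_(0 <= i < n) (2^-1 : R) ^+ i = 2 - 2 * 2^-1 ^+ n.
  by rewrite gerBl mulr_ge0// exprn_ge0.
elim: n => [|n ih]; first by rewrite big_nil expr0 mulr1 subrr.
by rewrite big_nat_recr//= ih exprS; field.
Qed.

Let mdiff (f : (T -> R)^nat) : (forall n, measurable_fun setT (f n)) ->
  forall n m, measurable_fun setT (fun x => (f m x - f n x) ^+ 2 * w x).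
Proof.
move=> mf n m; apply: measurable_funM => //; apply: measurable_funX.
exact: measurable_funB.
Qed.

(** By the arithmetic-geometric inequality, 2^-n bounds the mean of the n-th
    increment; hence the sum of the increments has a finite mean, and is finite
    almost everywhere. *)
Lemma L2_fast_cvg_ae (f : (T -> R)^nat) :
  (forall n, measurable_fun setT (f n)) ->
  (forall n m, (n <= m)%N ->
    \int[P]_x ((f m x - f n x) ^+ 2 * w x)%:E <= (4^-1 ^+ n)%:E)%E ->
  exists A, [/\ measurable A, P (~` A) = 0 & forall x, A x -> cvgn (f ^~ x)].
Proof.
move=> mf cf.
pose a n x : R := `|f n.+1 x - f n x|.
have ma n : measurable_fun setT (fun x => (a n x)%:E).
  apply/measurable_EFinP; apply: measurableT_comp => //.
  exact: measurable_funB.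
have Ia n : (\int[P]_x (a n x)%:E <= (2^-1 ^+ n)%:E)%E.
  have h0 : 0 <= (2^+n / 2 : R) by rewrite divr_ge0// exprn_ge0.
  have h1 : 0 <= (2^-1 ^+n / 2 : R) by rewrite divr_ge0// exprn_ge0// invr_ge0.
  (* v <= (p v^2 + 1 / p) / 2 with p = 2^n *)
  apply: (@le_trans _ _ (\int[P]_x ((2^+n / 2)%:E *
      ((f n.+1 x - f n x) ^+ 2 * w x)%:E + (2^-1 ^+ n / 2)%:E))%E).
    apply: ge0_le_integral => //=.
    - by move=> x _; rewrite lee_fin normr_ge0.
    - apply: emeasurable_funD => //; apply: measurable_funeM.
      by apply/measurable_EFinP; exact: mdiff.
    - move=> x _; rewrite lee_fin.
      set u := f n.+1 x - f n x.
      rewrite /a -/u.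
      have -> : u ^+ 2 = `|u| ^+ 2 by rewrite real_normK// num_real.
      have u0 : 0 <= `|u| by [].
      set v := `|u| in u0 *.
      have e0 : (2^-1 ^+ n : R) = (2 ^+ n)^-1 by rewrite exprVn.
      have p0 : (0 : R) < 2 ^+ n by rewrite exprn_gt0.
      rewrite e0; set p := 2 ^+ n in p0 *.
      apply: (@le_trans _ _ (p / 2 * v ^+ 2 + p^-1 / 2)).
        rewrite -subr_ge0.
        have -> : p / 2 * v ^+ 2 + p^-1 / 2 - v = (p * v - 1) ^+ 2 / (2 * p).
          by field; rewrite gt_eqF.
        by rewrite divr_ge0 ?sqr_ge0// mulr_ge0// ltW.
      rewrite lerD2r ler_wpM2l ?divr_ge0 ?(ltW p0)//.
      by rewrite -[leLHS]mulr1 ler_wpM2l ?sqr_ge0.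
  rewrite ge0_integralD//=; last 2 first.
  - by move=> x _; rewrite -EFinM lee_fin mulr_ge0// mulr_ge0// sqr_ge0.
  - apply: measurable_funeM; apply/measurable_EFinP; exact: mdiff.
  rewrite ge0_integralZl//=; last 2 first.
  - by apply/measurable_EFinP; exact: mdiff.
  - by move=> x _; rewrite lee_fin mulr_ge0// sqr_ge0.
  rewrite (EFin_RI (Int_cst P _)) RI_cst.
  apply: (@le_trans _ _ ((2 ^+ n / 2)%:E * (4^-1 ^+ n)%:E +
    (2^-1 ^+ n / 2)%:E)%E).
    by rewrite leeD2r// lee_wpmul2l// cf.
  rewrite -EFinM -EFinD lee_fin.
  have -> : (4^-1 : R) ^+ n = 2^-1 ^+ n * 2^-1 ^+ n.
    by rewrite -exprMn; congr (_ ^+ _); field.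
  rewrite [leLHS](_ : _ = 2^-1 ^+ n)// !exprVn.
  by field; rewrite expf_eq0 andbC pnatr_eq0.
pose S x := (\sum_(0 <= n <oo) (a n x)%:E)%E.
have mS : measurable_fun setT S.
  by apply: ge0_emeasurable_sum => // k x _ _; rewrite lee_fin normr_ge0.
have S0 x : (0 <= S x)%E.
  by apply: nneseries_ge0 => n _ _; rewrite lee_fin normr_ge0.
have IS : (\int[P]_x S x <= 2%:E)%E.
  rewrite integral_nneseries//; last by move=> n x _; rewrite lee_fin normr_ge0.
  apply: lime_le.
    apply: is_cvg_nneseries => n _ _.
    by apply: integral_ge0 => x _; rewrite lee_fin normr_ge0.
  apply: nearW => n; apply: (@le_trans _ _ (\sum_(0 <= i < n) (2^-1 ^+ i)%:E)%E).
    exact: lee_sum.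
  by rewrite sumEFin lee_fin sum_half.
have iS : P.-integrable setT S.
  apply/integrableP; split => //.
  rewrite (eq_integral S); last by move=> x _; rewrite gee0_abs.
  by rewrite (le_lt_trans IS)// ltry.
have [N [mN N0 SN]] := integrable_ae measurableT iS.
exists (~` N); split; [exact: measurableC|by rewrite setCK|].
move=> x /= Nx; have {Nx SN}Sx : S x \is a fin_num.
  by apply: contrapT => Sx; apply: Nx; apply: SN => /= /(_ I).
have : cvgn [normed series (telescope (f ^~ x))].
  apply: nondecreasing_is_cvgn; first by apply: nondecreasing_series => n _ _;
    exact: normr_ge0.
  exists (fine (S x)) => _ [n _ <-].
  rewrite -lee_fin fineK// /= /series/= -sumEFin.
  by apply: nneseries_lim_ge => k _ _; rewrite lee_fin normr_ge0.
move=> /normed_cvg; rewrite telescopeK => /cvg_ex[l fl].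
apply/cvg_ex; exists (l + f 0%N x).
have : (fun n => [sequence f n x - f 0%N x]_n n + f 0%N x) @ \oo --> l +
  f 0%N x.
  by apply: cvgD fl _; exact: cvg_cst.
by apply: cvg_trans; apply: near_eq_cvg; apply: nearW => n /=; rewrite subrK.
Qed.

(** Riesz-Fischer for L^2 of the measure with density w. *)
Lemma L2_complete (f : (T -> R)^nat) :
  (forall n, measurable_fun setT (f n)) ->
  (forall n m, (n <= m)%N ->
    \int[P]_x ((f m x - f n x) ^+ 2 * w x)%:E <= (4^-1 ^+ n)%:E)%E ->
  exists2 g : T -> R, measurable_fun setT g &
    forall n, (\int[P]_x ((g x - f n x) ^+ 2 * w x)%:E <= (4^-1 ^+ n)%:E)%E.
Proof.
move=> mf cf; have [A [mA A0 cA]] := L2_fast_cvg_ae mf cf.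
pose F n x := f n x * \1_A x.
have mF n : measurable_fun setT (F n) by apply: measurable_funM.
pose g x := limn (F ^~ x).
have Fg x : F ^~ x @ \oo --> g x.
  rewrite /g /F; have [Ax|Ax] := pselect (A x); rewrite indicE.
    by rewrite mem_set//=; under eq_fun do rewrite mulr1; exact: cA.
  by rewrite memNset//=; under eq_fun do rewrite mulr0; exact: is_cvg_cst.
have mg : measurable_fun setT g by apply: measurable_fun_cvg mF _ => x _.
exists g => // n.
rewrite (@ae_eq_integral _ _ _ P setT (fun x => ((g x - F n x) ^+ 2 * w x)%:E))//; first last.
- exists (~` A); split => //; first exact: measurableC.
  move=> x /= h Ax; apply: h => _.
  by rewrite /F indicE mem_set// mulr1.
- apply/measurable_EFinP; apply: measurable_funM => //; apply: measurable_funX.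
  exact: measurable_funB.
- apply/measurable_EFinP; apply: measurable_funM => //; apply: measurable_funX.
  exact: measurable_funB.
apply: (@fatou_bound _ _ _ P (fun m x => (F (n + m)%N x - F n x) ^+ 2 * w x)).
- by move=> m; exact: mdiff.
- by move=> m x; rewrite mulr_ge0 ?sqr_ge0.
- move=> x; apply: cvgM; last exact: cvg_cst.
  have h : (fun m => F (n + m)%N x - F n x) @ \oo --> g x - F n x.
    apply: cvgB; last exact: cvg_cst.
    under eq_fun do rewrite addnC.
    by have := Fg x; rewrite -(cvg_shiftn n).
  by rewrite expr2; under eq_fun do rewrite expr2; exact: (cvgM h h).
move=> m; apply: le_trans (cf n (n + m)%N (leq_addr _ _)).
apply: ge0_le_integral => //=.
- by move=> x _; rewrite lee_fin mulr_ge0 ?sqr_ge0.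
- by apply/measurable_EFinP; exact: mdiff.
- by apply/measurable_EFinP; exact: mdiff.
move=> x _; rewrite lee_fin ler_wpM2r// /F indicE.
by case: (x \in A); rewrite ?mulr1 ?mulr0 ?subr0 ?expr0n ?sqr_ge0.
Qed.

End L2_complete.

Section projection.
Context {d : measure_display} {T : measurableType d} {R : realType}.
Variables (P : probability T R) (w : T -> R).
Hypotheses (mw : measurable_fun setT w) (w1 : forall x, 1 <= w x).
Implicit Types f g v : T -> R[i].
Local Notation Int f := (P.-integrable [set: T] (EFin \o f)).

(** The space L^2(w dP), its squared norm, and its inner product as a real
    vector space; orthogonality to a complex subspace does not depend on the
    choice between the real and the complex inner product. *)
Definition L2w f := measurable_fun setT f /\ Int (fun x => sq (f x) * w x).
Definition nsq f := \int[P]_x (sq (f x) * w x).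
Definition ip f g := \int[P]_x (dot (f x) (g x) * w x).

Let w0 x : 0 <= w x. Proof. exact: le_trans (w1 x). Qed.

Lemma L2w_lin a f g : L2w f -> L2w g -> L2w (fun x => a * f x + g x).
Proof.
move=> [mf If] [mg Ig].
have mag : measurable_fun setT (fun x => a * f x + g x).
  by apply: measurable_cD => //; apply: measurable_cM.
split => //; apply: Int_le (IntD (IntZ (2 * sq a) If) (IntZ 2 Ig)).
  by apply: measurable_funM => //; exact: measurable_sq.
move=> x; rewrite ger0_norm ?mulr_ge0 ?sq_ge0//.
rewrite !mulrA -mulrDl ler_wpM2r// -[2 * sq a * _]mulrA -sqM.
rewrite -subr_ge0 /sq !reim.
set p := Re a * _ - _; set q := Re a * _ + _.
have -> : 2 * (p ^+ 2 + q ^+ 2) + 2 * (Re (g x) ^+ 2 + Im (g x) ^+ 2) -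
  ((p + Re (g x)) ^+ 2 + (q + Im (g x)) ^+ 2) =
  (p - Re (g x)) ^+ 2 + (q - Im (g x)) ^+ 2 by ring.
by rewrite addr_ge0// sqr_ge0.
Qed.

Lemma L2w_sub f g : L2w f -> L2w g -> L2w (fun x => f x - g x).
Proof.
move=> Lf Lg; have := L2w_lin (-1) Lg Lf.
by under eq_fun do rewrite mulN1r addrC.
Qed.

Lemma Int_dot f g : L2w f -> L2w g -> Int (fun x => dot (f x) (g x) * w x).
Proof.
move=> [mf If] [mg Ig]; apply: Int_le (IntD If Ig).
  by apply: measurable_funM => //; exact: measurable_dot.
move=> x; rewrite normrM (ger0_norm (w0 x)) -mulrDl ler_wpM2r//.
rewrite /dot /sq; move: (Re _) (Im _) (Re _) (Im _) => a b c e.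
have := (sqr_ge0 (a + c), sqr_ge0 (a - c), sqr_ge0 (b + e), sqr_ge0 (b - e)).
have := (sqr_ge0 a, sqr_ge0 b, sqr_ge0 c, sqr_ge0 e).
move=> [[[? ?] ?] ?] [[[? ?] ?] ?].
by rewrite ler_norml; apply/andP; split; nra.
Qed.

Lemma nsq_ge0 f : 0 <= nsq f.
Proof. by apply: RI_ge0 => x; rewrite mulr_ge0 ?sq_ge0. Qed.

Lemma nsqD (t : R) f g : L2w f -> L2w g ->
  nsq (fun x => t%:C * g x + f x) = nsq f + 2 * t * ip f g + t ^+ 2 * nsq g.
Proof.
move=> Lf Lg; have If := Lf.2; have Ig := Lg.2; have Ifg := Int_dot Lf Lg.
have I2 := IntZ (2 * t) Ifg; have I3 := IntZ (t ^+ 2) Ig.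
have I4 := IntD If I2; rewrite /nsq /ip -!RIZ// -!RID//.
by apply: eq_Rintegral => x _; rewrite /sq /dot !reim/=; ring.
Qed.

Lemma ipD f g v : L2w f -> L2w g -> L2w v ->
  ip (fun x => f x + g x) v = ip f v + ip g v.
Proof.
move=> Lf Lg Lv; rewrite /ip -RID; [|exact: Int_dot|exact: Int_dot].
by apply: eq_Rintegral => x _; rewrite /dot !reim/=; ring.
Qed.

(** b^2 - a c is a quarter of the discriminant, in t, of this polynomial. *)
Lemma quad_ge0 (a b c : R) : (forall t, 0 <= a + 2 * t * b + t ^+ 2 * c) ->
  0 <= c -> b ^+ 2 <= a * c.
Proof.
move=> h; rewrite le_eqVlt => /predU1P[c0|c0].
  have [->|b0] := eqVneq b 0; first by rewrite -c0 mulr0 expr0n.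
  have := h (- (a + 1) / (2 * b)); rewrite -c0.
  have -> : a + 2 * (- (a + 1) / (2 * b)) * b +
    (- (a + 1) / (2 * b)) ^+ 2 * 0 = -1 by field.
  by rewrite oppr_ge0 ler10.
have := h (- b / c).
have -> : a + 2 * (- b / c) * b + (- b / c) ^+ 2 * c = (a * c - b ^+ 2) / c.
  by field; rewrite gt_eqF.
by rewrite pmulr_lge0 ?invr_gt0// subr_ge0.
Qed.

Lemma cauchy_schwarz f g : L2w f -> L2w g -> ip f g ^+ 2 <= nsq f * nsq g.
Proof.
move=> Lf Lg; apply: quad_ge0 (nsq_ge0 g) => t.
by rewrite -nsqD// nsq_ge0.
Qed.

Lemma geo4_small (e : R) : 0 < e -> exists n, 4^-1 ^+ n < e.
Proof.
move=> e0; have : (fun n => 4^-1 ^+ n : R) @ \oo --> 0.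
  by apply: cvg_expr; rewrite ger0_norm// invf_lt1// ltr1n.
move=> /cvgrPdist_lt/(_ e e0)[n _ /(_ n (leqnn n))].
rewrite sub0r normrN ger0_norm ?exprn_ge0// => h.
by exists n.
Qed.

Lemma geo4_le_eq0 (x K : R) : 0 <= x -> 0 <= K ->
  (forall n, x <= K * 4^-1 ^+ n) -> x = 0.
Proof.
move=> x0 K0 h; apply/eqP; rewrite eq_le x0 andbT leNgt; apply/negP => xp.
have K1 : 0 < K + 1 by rewrite ltr_wpDl.
have [n] := geo4_small (divr_gt0 xp K1).
rewrite ltr_pdivlMr//; apply/negP; rewrite -leNgt (le_trans (h n))//.
by rewrite mulrC ler_wpM2l ?exprn_ge0// lerDl.
Qed.

Section orthogonal_projection.
Variables (V : set (T -> R[i])) (f : T -> R[i]).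
Hypotheses (VL2 : V `<=` L2w) (V0 : V (cst 0)) (Lf : L2w f).
Hypothesis Vlin : forall a g h, V g -> V h -> V (fun x => a * g x + h x).

Let dist := inf [set nsq (fun x => f x - v x) | v in V].

Let Lsub v : V v -> L2w (fun x => f x - v x).
Proof. by move=> Vv; apply: L2w_sub => //; exact: VL2. Qed.

Let dist_le v : V v -> dist <= nsq (fun x => f x - v x).
Proof.
move=> Vv; apply: ge_inf; last by exists v.
by exists 0 => _ [u _ <-]; exact: nsq_ge0.
Qed.

Let minimizing : exists v_ : nat -> T -> R[i], forall n,
  V (v_ n) /\ nsq (fun x => f x - v_ n x) < dist + 4^-1 ^+ n / 8.
Proof.
suff /choice[v_ vP] : forall n : nat, exists v,
    V v /\ nsq (fun x => f x - v x) < dist + 4^-1 ^+ n / 8 by exists v_.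
move=> n.
have h : has_inf [set nsq (fun x => f x - v x) | v in V].
  split; first by exists (nsq (fun x => f x - cst 0 x)), (cst 0).
  by exists 0 => _ [u _ <-]; exact: nsq_ge0.
have e0 : 0 < (4^-1 : R) ^+ n / 8 by rewrite divr_gt0// exprn_gt0.
have [_ [v Vv <-] hv] := inf_adherent e0 h.
by exists v.
Qed.

(** The parallelogram law at the midpoint of u and v. *)
Let midpoint u v : V u -> V v ->
  nsq (fun x => v x - u x) <=
  2 * nsq (fun x => f x - u x) + 2 * nsq (fun x => f x - v x) - 4 * dist.
Proof.
move=> Vu Vv; pose c : R[i] := (2^-1 : R)%:C.
pose h x := c * u x + (c * v x + cst 0 x).
have Vh : V h by apply: (Vlin c) => //; apply: (Vlin c).
have hd := dist_le Vh.
have IA := (Lsub Vu).2; have IB := (Lsub Vv).2; have IC := (Lsub Vh).2.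
have I2A := IntZ 2 IA; have I2B := IntZ 2 IB; have I4C := IntZ 4 IC.
have IAB := IntD I2A I2B.
apply: (@le_trans _ _ (2 * nsq (fun x => f x - u x) +
  2 * nsq (fun x => f x - v x) - 4 * nsq (fun x => f x - h x))).
  rewrite /nsq -!RIZ// -RID// -RIB// le_eqVlt; apply/orP; left; apply/eqP.
  by apply: eq_Rintegral => x _; rewrite /sq /h /c !reim/=; field.
by rewrite lerD2l lerN2 ler_pM2l.
Qed.

(** First-order optimality, in the quantitative form that approximate
    minimizers satisfy. *)
Let almost_orthogonal u v e : V u -> V v ->
  nsq (fun x => f x - u x) < dist + e ->
  ip (fun x => f x - u x) v ^+ 2 <= e * nsq v.
Proof.
move=> Vu Vv ue; apply: quad_ge0 (nsq_ge0 v) => t.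
have V2 : V (fun x => (- t%:C) * v x + u x) by apply: Vlin.
have := dist_le V2; have := nsqD t (Lsub Vu) (VL2 Vv).
have -> : (fun x => t%:C * v x + (f x - u x)) =
          (fun x => f x - (- t%:C * v x + u x)).
  by apply/funext => x; rewrite opprD mulNr opprK addrCA.
by move: ue; set a := nsq _; set b := nsq _; set c := nsq _ => ? ->; lra.
Qed.

(** The residual r of the projection of f onto the closure of V.  A minimizing
    sequence is Cauchy by the parallelogram law; the projection itself is
    only described by its approximants in V, as V need not be closed. *)
Lemma orthogonal_projection : exists r, [/\ L2w r,
  forall v, V v -> ip r v = 0 &
  forall e, 0 < e -> exists2 v, V v & nsq (fun x => (f x - v x) - r x) < e].
Proof.
have [v_ vP] := minimizing.
have Vv n : V (v_ n) := (vP n).1.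
pose g n x := f x - v_ n x.
have Lg n : L2w (g n) := Lsub (Vv n).
have mg n := (Lg n).1.
have cauchy n m : (n <= m)%N ->
    \int[P]_x (sq (g m x - g n x) * w x) <= 4^-1 ^+ n.
  move=> nm; have := midpoint (Vv m) (Vv n).
  have -> : (fun x => v_ n x - v_ m x) = (fun x => g m x - g n x).
    by apply/funext => x; rewrite /g; ring.
  rewrite -[X in X <= _]/(nsq (fun x => g m x - g n x)).
  rewrite -/(nsq _) => h.
  have le4 : (4^-1 : R) ^+ m <= 4^-1 ^+ n.
    by rewrite ler_wiXn2l// invf_le1// ler1n.
  move: h (vP n).2 (vP m).2 le4; rewrite -/(g n) -/(g m).
  set a := nsq _; set b := nsq _; set c := nsq _.
  set p := _ ^+ m; set q := _ ^+ n.
  have : 0 <= q by rewrite exprn_ge0.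
  by lra.
have Lgg n m : L2w (fun x => g m x - g n x) by exact: L2w_sub.
have ecauchy (c : R[i] -> R) : (forall x y, c (x - y) = c x - c y) ->
    (forall x, c x ^+ 2 <= sq x) -> measurable_fun setT c ->
    exists2 l : T -> R, measurable_fun setT l & forall n,
      (\int[P]_x ((l x - c (g n x)) ^+ 2 * w x)%:E <= (4^-1 ^+ n)%:E)%E.
  move=> cB csq mc; apply: (@L2_complete _ _ _ P w mw w1 (fun n x => c (g n x))) => //.
    by move=> n; exact: measurableT_comp mc (mg n).
  move=> n m nm; apply: (@le_trans _ _
      (\int[P]_x (sq (g m x - g n x) * w x)%:E)%E); last first.
    by rewrite EFin_RI ?lee_fin; [exact: cauchy|exact: (Lgg n m).2].
  apply: ge0_le_integral => //=.
  - by move=> x _; rewrite lee_fin mulr_ge0 ?sqr_ge0.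
  - apply/measurable_EFinP; apply: measurable_funM => //.
    apply: measurable_funX; apply: measurable_funB;
      exact: measurableT_comp mc (mg _).
  - by apply/measurable_EFinP; exact: Int_meas (Lgg n m).2.
  - by move=> x _; rewrite lee_fin ler_wpM2r// -cB.
have [a ma ga] : exists2 l : T -> R, measurable_fun setT l & forall n,
    (\int[P]_x ((l x - Re (g n x)) ^+ 2 * w x)%:E <= (4^-1 ^+ n)%:E)%E.
  apply: ecauchy; [by move=> x y; rewrite !reim| |exact: measurable_Re].
  by move=> x; rewrite /sq lerDl sqr_ge0.
have [b mb gb] : exists2 l : T -> R, measurable_fun setT l & forall n,
    (\int[P]_x ((l x - Im (g n x)) ^+ 2 * w x)%:E <= (4^-1 ^+ n)%:E)%E.
  apply: ecauchy; [by move=> x y; rewrite !reim| |exact: measurable_Im].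
  by move=> x; rewrite /sq lerDr sqr_ge0.
pose r x := a x +i* b x.
have mr : measurable_fun setT r by exact: measurable_ReIm.
have rg n : L2w (fun x => r x - g n x) /\
    nsq (fun x => r x - g n x) <= 2 * 4^-1 ^+ n.
  have m1 : measurable_fun setT (fun x => (a x - Re (g n x)) ^+ 2 * w x).
    apply: measurable_funM => //; apply: measurable_funX.
    by apply: measurable_funB => //; exact: measurable_RE.
  have m2 : measurable_fun setT (fun x => (b x - Im (g n x)) ^+ 2 * w x).
    apply: measurable_funM => //; apply: measurable_funX.
    by apply: measurable_funB => //; exact: measurable_IM.
  have [I1 l1] := ge0_Int m1 (fun x => mulr_ge0 (sqr_ge0 _) (w0 x)) (ga n).
  have [I2 l2] := ge0_Int m2 (fun x => mulr_ge0 (sqr_ge0 _) (w0 x)) (gb n).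
  have E : (fun x => sq (r x - g n x) * w x) =
    (fun x => (a x - Re (g n x)) ^+ 2 * w x + (b x - Im (g n x)) ^+ 2 * w x).
    by apply/funext => x; rewrite /sq !reim/= mulrDl.
  split; first by split; [exact: measurable_cB|rewrite E; exact: IntD].
  by rewrite /nsq E RID// mulrDl mul1r lerD.
exists r; split.
- have := L2w_lin 1 (rg 0%N).1 (Lg 0%N).
  by under eq_fun do rewrite mul1r subrK.
- move=> v Vv'; have Lv := VL2 Vv'.
  apply/eqP; rewrite -sqrf_eq0; apply/eqP.
  apply: (@geo4_le_eq0 _ (5 * nsq v)); [exact: sqr_ge0| |].
    by rewrite mulr_ge0 ?nsq_ge0.
  move=> n; have [Lrg nrg] := rg n.
  have -> : ip r v = ip (fun x => r x - g n x) v + ip (g n) v.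
    by rewrite -ipD//; under [in RHS]eq_fun do rewrite subrK.
  have := cauchy_schwarz Lrg Lv.
  have := almost_orthogonal (Vv n) Vv' (vP n).2.
  rewrite -/(g n); move: (ip _ _) (ip _ _) nrg (nsq_ge0 v) => y x.
  move: (nsq v) (nsq _) => N M.
  have : 0 <= (4^-1 : R) ^+ n by rewrite exprn_ge0.
  move: (_ ^+ n) => q q0 hM N0 hy hx.
  have h1 : M * N <= 2 * q * N by rewrite ler_wpM2r.
  have := sqr_ge0 (x - y); nra.
- move=> e e0; have e20 : 0 < e / 2 by rewrite divr_gt0.
  have [n hn] := geo4_small e20; exists (v_ n) => //.
  have -> : nsq (fun x => f x - v_ n x - r x) = nsq (fun x => r x - g n x).
    by apply: eq_Rintegral => x _; rewrite /g /sq !reim; ring.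
  by rewrite (le_lt_trans (rg n).2)// mulrC -ltr_pdivlMr.
Qed.

End orthogonal_projection.

End projection.

(** * Analytic polynomials on the circle *)

Section haar_moments.
Variable R : realType.
Local Notation T := (circle R).
Local Notation m := (haar R).

Definition pz (p : {poly R[i]}) : T -> R[i] := fun x => p.[coord x].

Lemma measurable_coord : measurable_fun [set: T] (@coord R).
Proof. by move=> _ B mB; rewrite setTI; exists B => //; rewrite setTI. Qed.

Lemma normc_coord (x : T) : normc (coord x) = 1.
Proof. by apply/eqP; case: x. Qed.

Lemma measurable_pz p : measurable_fun [set: T] (pz p).
Proof.
elim/poly_ind: p => [|p c ih].
  by rewrite (_ : pz 0 = cst 0)//; apply/funext => x; rewrite /pz horner0.
rewrite (_ : pz _ = fun x => pz p x * coord x + c).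
  apply: measurable_cD => //; apply: measurable_cM => //.
  exact: measurable_coord.
by apply/funext => x; rewrite /pz hornerMXaddC.
Qed.

Lemma pz_bounded p : exists2 c, 0 <= c & forall x, normc (pz p x) <= c.
Proof.
elim/poly_ind: p => [|p a [c c0 ih]].
  by exists 0 => // x; rewrite /pz horner0 normc0.
exists (c + normc a); first by rewrite addr_ge0 ?normc_ge0.
move=> x; rewrite /pz hornerMXaddC (le_trans (normcD _ _))// lerD2r.
by rewrite normcM normc_coord mulr1; exact: ih.
Qed.

Lemma expiX (t : R) n : coord (expi t) ^+ n =
  cos (n%:R * (2 * pi * t)) +i* sin (n%:R * (2 * pi * t)).
Proof.
elim: n => [|n ih]; first by rewrite expr0 mul0r cos0 sin0.
have -> : n.+1%:R * (2 * pi * t) = 2 * pi * t + n%:R * (2 * pi * t).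
  by rewrite -natr1; ring.
rewrite exprS ih cosD sinD /=.
by apply/eqP; rewrite eq_complex; apply/andP; split; apply/eqP => /=; ring.
Qed.

Lemma haar_integral (f : T -> R) : measurable_fun setT f ->
  (forall x, 0 <= f x) ->
  (\int[m]_x (f x)%:E =
   \int[lebesgue_measure]_(t in `[0%R, 1%R]) (f (expi t))%:E)%E.
Proof.
move=> mf f0; have mEf : measurable_fun setT (fun x => (f x)%:E)
  by exact/measurable_EFinP.
rewrite ge0_integral_distribution//.
rewrite integral_uniform//=; last first.
- by move=> x; rewrite lee_fin.
- by apply: measurableT_comp mEf _; exact: measurable_expi.
by rewrite subr0 invr1 mul1e.
Qed.

Lemma integral01_primitive (f F : R -> R) : continuous f ->
  (forall t : R, is_derive t (1 : R) F (f t)) ->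
  (\int[lebesgue_measure]_(t in `[0%R, 1%R]) (f t)%:E = (F 1 - F 0)%R%:E)%E.
Proof.
move=> cf dF; rewrite (@continuous_FTC2 _ f F)//.
- exact: continuous_subspaceT.
- have dcF t : derivable F t 1 by case: (dF t).
  have cF t : {for t, continuous F}
    by apply/differentiable_continuous/derivable1_diffP.
  by split => //; [exact/cvg_at_right_filter/cF|exact/cvg_at_left_filter/cF].
- by move=> t _; rewrite derive1E; case: (dF t).
Qed.

(** The primitive of cos (2 pi n t) is periodic.  One adds 1 to the integrand
    to stay within the transfer formula for nonnegative functions. *)
Lemma haar_moments n : (0 < n)%N ->
  \int[m]_x Re (coord x ^+ n) = 0 /\ \int[m]_x Im (coord x ^+ n) = 0.
Proof.
move=> n0; have c0 : 2 * pi * n%:R != 0 :> R.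
  by rewrite !mulf_neq0 ?pnatr_eq0 ?gt_eqF ?pi_gt0 -?lt0n.
pose c : R := 2 * pi * n%:R.
have mz : measurable_fun setT (fun x : T => coord x ^+ n).
  have := measurable_pz 'X^n.
  by rewrite (_ : pz _ = fun x => coord x ^+ n)//; apply/funext => x;
    rewrite /pz hornerXn.
have nz (x : T) : normc (coord x ^+ n) = 1.
  by elim: n {n0 c0 c mz} => [|n ih];
    rewrite ?expr0 ?normc1// exprS normcM ih normc_coord mulr1.
have main (h : R[i] -> R) (F f : R -> R) : measurable_fun setT h ->
    (forall z, `|h z| <= normc z) -> continuous f ->
    (forall t : R, h (coord (expi t) ^+ n) = f t) ->
    (forall t : R, is_derive t (1 : R) F (1 + f t)) -> F 1 - F 0 = 1 ->
    \int[m]_x h (coord x ^+ n) = 0.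
  move=> mh hn cf hf dF FF.
  have mhz : measurable_fun setT (fun x : T => h (coord x ^+ n)).
    exact: measurableT_comp mh mz.
  have h1 x : `|h (coord x ^+ n)| <= 1 by rewrite (le_trans (hn _))// nz.
  have If := Int_bounded m mhz h1.
  have I1 := Int_cst m (1 : R).
  have : \int[m]_x (1 + h (coord x ^+ n)) = 1.
    rewrite /Rintegral haar_integral; last 2 first.
    - exact: measurable_funD.
    - move=> x; have := h1 x; rewrite ler_norml => /andP[+ _].
      by rewrite -subr_ge0 opprK addrC.
    under eq_integral do rewrite hf.
    rewrite (@integral01_primitive (fun t => 1 + f t) F)//= ?FF//.
    by move=> t; apply: cvgD; [exact: cvg_cst|exact: cf].
  by rewrite RID// RI_cst => /eqP; rewrite addrC -subr_eq0 addrK => /eqP.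
have ccos (g : R -> R) : continuous g -> continuous (fun t => g (c * t)).
  move=> cg t; apply: continuous_comp; last exact: cg.
  by apply: cvgM; [exact: cvg_cst|exact: cvg_id].
have ct (t : R) : n%:R * (2 * pi * t) = c * t by rewrite /c; ring.
have pi2 : 2 * pi = pi *+ 2 :> R by rewrite mulr_natl.
have cc : cos c = 1 /\ sin c = 0.
  rewrite /c pi2; elim: (n) => [|k [ihc ihs]]; first by rewrite mulr0 cos0 sin0.
  rewrite -natr1 mulrDr mulr1; split.
    by rewrite cosD ihc ihs cos2pi mul0r mulr1 subr0.
  rewrite sinD ihc ihs mul0r add0r mul1r. exact: sin2pi.
split.
  apply: (main _ (fun t => t + c^-1 * sin (c * t)) (fun t => cos (c * t))).
  - exact: measurable_Re.
  - exact: Re_le_normc.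
  - exact/ccos/continuous_cos.
  - by move=> t; rewrite expiX ct.
  - move=> t; apply: is_derive_eq.
    rewrite /GRing.scale/= !mulr1.
    by rewrite mulrCA mulVf// mulr1.
  - by rewrite !mulr1 !mulr0 cc.2 sin0 mulr0 !addr0 subr0.
apply: (main _ (fun t => t - c^-1 * cos (c * t)) (fun t => sin (c * t))).
- exact: measurable_Im.
- exact: Im_le_normc.
- exact/ccos/continuous_sin.
- by move=> t; rewrite expiX ct.
- move=> t; apply: is_derive_eq.
  rewrite /GRing.scale/= !mulr1.
  by rewrite mulNr mulrN opprK mulrCA mulVf// mulr1.
- by rewrite mulr1 mulr0 cc.1 cos0; ring.
Qed.

Lemma Int_pz (p : {poly R[i]}) (c : R[i] -> R) : measurable_fun setT c ->
  (forall z, `|c z| <= normc z) ->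
  m.-integrable [set: T] (EFin \o (fun x => c (pz p x))).
Proof.
move=> mc cn; have [b b0 hb] := pz_bounded p.
apply: (@Int_bounded _ _ _ m _ b).
  exact: measurableT_comp mc (measurable_pz p).
by move=> x; rewrite (le_trans (cn _)).
Qed.

Lemma Int_Re_pz p : m.-integrable [set: T] (EFin \o (fun x => Re (pz p x))).
Proof. by apply: Int_pz; [exact: measurable_Re|exact: Re_le_normc]. Qed.

Lemma Int_Im_pz p : m.-integrable [set: T] (EFin \o (fun x => Im (pz p x))).
Proof. by apply: Int_pz; [exact: measurable_Im|exact: Im_le_normc]. Qed.

(** The mean of an analytic polynomial is its value at the origin, which is 0
    when k > 0. *)
Lemma mean_pzMX p k : (0 < k)%N ->
  \int[m]_x Re (pz (p * 'X^k) x) = 0 /\ \int[m]_x Im (pz (p * 'X^k) x) = 0.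
Proof.
elim/poly_ind: p k => [|p c ih] k k0.
  rewrite mul0r /pz; under eq_Rintegral do rewrite horner0.
  rewrite RI_cst; split => //.
  by under eq_Rintegral do rewrite horner0; rewrite RI_cst.
have E x : pz ((p * 'X + c%:P) * 'X^k) x =
    pz (p * 'X^(k.+1)) x + c * coord x ^+ k.
  by rewrite /pz !hornerE exprS; ring.
have [rk ik] := haar_moments k0; have [rp ip] := ih k.+1 isT.
have Ixr : m.-integrable [set: T] (EFin \o (fun x => Re (coord x ^+ k))).
  by have := Int_Re_pz 'X^k; under [EFin \o _]eq_fun do rewrite /pz /= hornerXn.
have Ixi : m.-integrable [set: T] (EFin \o (fun x => Im (coord x ^+ k))).
  by have := Int_Im_pz 'X^k; under [EFin \o _]eq_fun do rewrite /pz /= hornerXn.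
have Ip := Int_Re_pz (p * 'X^(k.+1)); have Jp := Int_Im_pz (p * 'X^(k.+1)).
have I1 := IntZ (Re c) Ixr; have I2 := IntZ (Im c) Ixi; have I3 := IntB I1 I2.
have J1 := IntZ (Re c) Ixi; have J2 := IntZ (Im c) Ixr; have J3 := IntD J1 J2.
split.
  under eq_Rintegral do rewrite E ReD ReM.
  by rewrite RID// RIB// !RIZ// rp rk ik !mulr0 subr0 addr0.
under eq_Rintegral do rewrite E ImD ImM.
by rewrite RID// RID// !RIZ// ip rk ik !mulr0 !addr0.
Qed.

End haar_moments.

(** * Uniqueness of Fourier coefficients *)

Section dominated.
Context {d : measure_display} {T : measurableType d} {R : realType}.
Variable P : probability T R.

Lemma RI_dominated (f : (T -> R)^nat) (l g : T -> R) :
  (forall n, measurable_fun setT (f n)) ->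
  (forall x, f ^~ x @ \oo --> l x) ->
  P.-integrable setT (EFin \o g) -> (forall n x, `|f n x| <= g x) ->
  \int[P]_x f n x @[n --> \oo] --> \int[P]_x l x.
Proof.
move=> mf fl Ig fg.
have ml : measurable_fun setT l by apply: measurable_fun_cvg mf _ => x _.
have Efl : {ae P, forall x, setT x -> (fun n => (f n x)%:E) @ \oo --> (l x)%:E}.
  by apply: nearW => x _; apply: cvg_EFin; [exact: nearW|exact: fl].
have Efg : {ae P, forall x n, setT x -> (`|(f n x)%:E| <= (EFin \o g) x)%E}.
  by apply: nearW => x n _; rewrite lee_fin.
have mEf n : measurable_fun setT (fun x => (f n x)%:E)
  by exact/measurable_EFinP.
have mEl : measurable_fun setT (fun x => (l x)%:E) by exact/measurable_EFinP.
have [Il _ cl] := dominated_convergence measurableT mEf mEl Efl Ig Efg.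
apply: fine_cvg; rewrite fineK; last exact: integrable_fin_num.
exact: cl.
Qed.

End dominated.

Section fourier_uniqueness.
Variable R : realType.
Local Notation T := (circle R).
Local Notation m := (haar R).
Variable psi : T -> R.
Local Notation Int f := (m.-integrable [set: T] (EFin \o f)).
Hypotheses (Ipsi : Int psi).
Hypothesis psi0 : forall p, \int[m]_x (psi x * Re (pz p x)) = 0.
Implicit Types r s u : T -> R.

Definition bounded_rfun s := measurable_fun setT s /\ exists c, forall x,
  `|s x| <= c.

(** The functions r such that all Fourier coefficients of psi r vanish (psi and
    r are real, so that nonnegative frequencies suffice), and the bounded
    functions that preserve this property under multiplication.  The
    multipliers form an algebra, closed under bounded pointwise limits, which
    contains the coordinates; hence it contains the indicators of all Borel
    sets. *)
Definition orth_analytic r :=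
  bounded_rfun r /\ forall p, \int[m]_x (psi x * (r x * Re (pz p x))) = 0.

Definition multiplier s := bounded_rfun s /\ forall r, orth_analytic r ->
  orth_analytic (fun x => s x * r x).

Lemma bounded_rfunM s r : bounded_rfun s -> bounded_rfun r ->
  bounded_rfun (fun x => s x * r x).
Proof.
move=> [ms [a sa]] [mr [b rb]]; split; first exact: measurable_funM.
by exists (a * b) => x; rewrite normrM ler_pM.
Qed.

Lemma bounded_rfunD s r : bounded_rfun s -> bounded_rfun r ->
  bounded_rfun (fun x => s x + r x).
Proof.
move=> [ms [a sa]] [mr [b rb]]; split; first exact: measurable_funD.
by exists (a + b) => x; rewrite (le_trans (ler_normD _ _))// lerD.
Qed.

Lemma bounded_rfun_Re_pz p : bounded_rfun (fun x => Re (pz p x)).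
Proof.
split; first exact: measurable_RE (measurable_pz p).
have [b _ hb] := pz_bounded p; exists b => x.
exact: le_trans (Re_le_normc _) (hb x).
Qed.

Lemma Int_psiM s : bounded_rfun s -> Int (fun x => psi x * s x).
Proof.
move=> [ms [c sc]]; apply: Int_le (IntZ c (Int_abs Ipsi)).
  by apply: measurable_funM => //; exact: Int_meas Ipsi.
by move=> x; rewrite normrM mulrC ler_wpM2r.
Qed.

Lemma orth_analytic1 : orth_analytic (cst 1).
Proof.
split; first by split => //; exists 1 => x; rewrite normr1.
by move=> p; under eq_Rintegral do rewrite mul1r; exact: psi0.
Qed.

Lemma multiplierD s u : multiplier s -> multiplier u ->
  multiplier (fun x => s x + u x).
Proof.
move=> [bs hs] [bu hu]; split; first exact: bounded_rfunD.
move=> r ar; have [bsr hsr] := hs _ ar; have [bur hur] := hu _ ar.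
split; first by under eq_fun do rewrite mulrDl; exact: bounded_rfunD.
move=> p; have bp := bounded_rfun_Re_pz p.
have I1 := Int_psiM (bounded_rfunM bsr bp); have I2 :=
  Int_psiM (bounded_rfunM bur bp).
under eq_Rintegral do rewrite !mulrDl mulrDr.
by rewrite RID// hsr hur addr0.
Qed.

Lemma multiplierM s u : multiplier s -> multiplier u ->
  multiplier (fun x => s x * u x).
Proof.
move=> [bs hs] [bu hu]; split; first exact: bounded_rfunM.
by move=> r ar; under eq_fun do rewrite -mulrA; exact/hs/hu.
Qed.

Lemma multiplier_cst c : multiplier (cst c).
Proof.
split; first by split => //; exists `|c|.
move=> r [br hr]; split.
  by apply: bounded_rfunM => //; split => //; exists `|c|.
move=> p; have I1 := Int_psiM (bounded_rfunM br (bounded_rfun_Re_pz p)).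
transitivity (\int[m]_x (c * (psi x * (r x * Re (pz p x))))).
  by apply: eq_Rintegral => x _ /=; ring.
by rewrite RIZ// hr mulr0.
Qed.

Lemma multiplierB s u : multiplier s -> multiplier u ->
  multiplier (fun x => s x - u x).
Proof.
move=> hs hu; rewrite (_ : (fun x => _) = fun x => s x + cst (-1) x * u x).
  by apply: multiplierD => //; apply: multiplierM => //; exact: multiplier_cst.
by apply/funext => x /=; rewrite mulN1r.
Qed.

Lemma multiplierX s n : multiplier s -> multiplier (fun x => s x ^+ n).
Proof.
move=> hs; elim: n => [|n ih]; first exact: (multiplier_cst 1).
by under eq_fun do rewrite exprS; exact: multiplierM.
Qed.

Lemma multiplier_lim (s : (T -> R)^nat) (l : T -> R) c : (forall n,
  multiplier (s n)) ->
  (forall n x, `|s n x| <= c) -> (forall x, s ^~ x @ \oo --> l x) ->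
    multiplier l.
Proof.
move=> hs sc sl.
have ml : measurable_fun setT l.
  by apply: measurable_fun_cvg (fun n => (hs n).1.1) _ => x _.
have bl : bounded_rfun l.
  split => //; exists c => x.
  have h : (fun n => `|s n x|) @ \oo --> `|l x| by exact: cvg_norm (sl x).
  rewrite -(cvg_lim _ h)//; apply: limr_le; first by apply/cvg_ex;
    exists `|l x|.
  exact: nearW.
split => // r ar; have [br _] := ar; split; first exact: bounded_rfunM.
move=> p; have bp := bounded_rfun_Re_pz p.
have Ir := Int_psiM (bounded_rfunM br bp).
have mr := Int_meas Ir.
have : \int[m]_x (psi x * (s n x * r x * Re (pz p x))) @[n --> \oo] -->
    \int[m]_x (psi x * (l x * r x * Re (pz p x))).
  apply: RI_dominated (IntZ c (Int_abs Ir)) _.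
  - move=> n; have := bounded_rfunM (bounded_rfunM (hs n).1 br) bp.
    by move=> /Int_psiM/Int_meas.
  - move=> x; apply: cvgM; first exact: cvg_cst.
    by apply: cvgM; [apply: cvgM; [exact: sl|exact: cvg_cst]|exact: cvg_cst].
  - move=> n x; have -> : psi x * (s n x * r x * Re (pz p x)) =
      s n x * (psi x * (r x * Re (pz p x))) by ring.
    by rewrite normrM ler_wpM2r.
under eq_cvg do rewrite ((hs _).2 _ ar).2.
by move=> /cvg_lim <-//; rewrite lim_cst.
Qed.

Let polyX (p : {poly R[i]}) : exists q c, p = q * 'X + c%:P.
Proof.
by elim/poly_ind: p => [|q c _]; [exists 0, 0; rewrite mul0r add0r|exists q, c].
Qed.

Let circleE (x : T) : Re (coord x) ^+ 2 + Im (coord x) ^+ 2 = 1.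
Proof. by rewrite -[LHS]/(sq (coord x)) -sqr_normc normc_coord expr1n. Qed.

(** On the circle, conjugation is inversion; hence the product of a
    trigonometric polynomial with Re z or Im z is again one. *)
Lemma multiplier_Re : multiplier (fun x => Re (coord x)).
Proof.
have b1 : bounded_rfun (fun x => Re (coord x)).
  split; first exact: measurable_RE (@measurable_coord R).
  by exists 1 => x; rewrite -(normc_coord x) Re_le_normc.
split => // r [br hr]; split; first exact: bounded_rfunM.
move=> p; have [q [c pE]] := polyX p.
rewrite -(hr ((2^-1)%:C%:P * (p * 'X + q + (conjc c)%:P * 'X))).
apply: eq_Rintegral => x _; rewrite -!mulrA; congr (_ * _).
rewrite mulrCA; congr (_ * _).
rewrite pE /pz !hornerE !reim/=; have := circleE x.
move: (Re (coord x)) (Im (coord x)) (Re q.[_]) (Im q.[_]) (Re c) (Im c).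
move=> X Y a b e f h.
have -> : X * (a * X - b * Y + e) = X * (a * X - b * Y + e) +
   a / 2 * (1 - (X ^+ 2 + Y ^+ 2)) by rewrite h subrr mulr0 addr0.
by field.
Qed.

Lemma multiplier_Im : multiplier (fun x => Im (coord x)).
Proof.
have b1 : bounded_rfun (fun x => Im (coord x)).
  split; first exact: measurable_IM (@measurable_coord R).
  by exists 1 => x; rewrite -(normc_coord x) Im_le_normc.
split => // r [br hr]; split; first exact: bounded_rfunM.
move=> p; have [q [c pE]] := polyX p.
rewrite -(hr ((0 -i* 2^-1)%:P * (p * 'X - q + (conjc c)%:P * 'X))).
apply: eq_Rintegral => x _; rewrite -!mulrA; congr (_ * _).
rewrite mulrCA; congr (_ * _).
rewrite pE /pz !hornerE !reim/=; have := circleE x.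
move: (Re (coord x)) (Im (coord x)) (Re q.[_]) (Im q.[_]) (Re c) (Im c).
move=> X Y a b e f h.
have -> : Y * (a * X - b * Y + e) = Y * (a * X - b * Y + e) -
   b / 2 * (1 - (X ^+ 2 + Y ^+ 2)) by rewrite h subrr mulr0 subr0.
by field.
Qed.

(** The iteration p := p + (u^2 - p^2) / 2 increases from 0 to |u|. *)
Lemma multiplier_abs u : multiplier u -> (forall x, `|u x| <= 1) ->
  multiplier (fun x => `|u x|).
Proof.
move=> hu u1; pose p := fix p n x : R :=
  if n is k.+1 then p k x + 2^-1 * (u x ^+ 2 - p k x ^+ 2) else 0.
have pP n x : 0 <= p n x <= `|u x| /\
    `|u x| - p n x <= `|u x| * (1 - `|u x| / 2) ^+ n.
  elim: n => [|n [/andP[p0 pu] ih]] /=; first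
    by rewrite lexx normr_ge0 subr0 expr0 mulr1.
  have ux := u1 x; have u2 : u x ^+ 2 = `|u x| ^+ 2
    by rewrite real_normK// num_real.
  rewrite u2 [_ ^+ n.+1]exprSr mulrA.
  move: `|u x| (p n x) (_ ^+ n) ux p0 pu ih => v q e v1 q0 qv ih.
  have E : v - (q + 2^-1 * (v ^+ 2 - q ^+ 2)) = (v - q) * (1 - (v + q) / 2)
    by field.
  have vq0 : 0 <= v - q by rewrite subr_ge0.
  split.
    apply/andP; split.
      by rewrite addr_ge0// mulr_ge0// subr_ge0 ler_pXn2r// nnegrE (le_trans q0).
    by rewrite -subr_ge0 E mulr_ge0//; lra.
  rewrite E (le_trans (_ : _ <= (v - q) * (1 - v / 2)))//.
    by rewrite ler_wpM2l//; lra.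
  by rewrite ler_wpM2r//; lra.
apply: (@multiplier_lim p _ 1).
- elim=> [|n ih] /=; first exact: (multiplier_cst 0).
  apply: multiplierD => //; apply: (multiplierM (multiplier_cst _)).
  by apply: multiplierB; exact: multiplierX.
- by move=> n x; have [/andP[p0 pu] _] := pP n x;
  rewrite ger0_norm// (le_trans pu).
move=> x.
have geo : (fun n => `|u x| * (1 - `|u x| / 2) ^+ n) @ \oo --> 0.
  have [->|ux0] := eqVneq `|u x| 0.
    by under eq_fun do rewrite mul0r; exact: cvg_cst.
  rewrite -[X in _ --> X](mulr0 `|u x|); apply: cvgM; first exact: cvg_cst.
  have v0 : 0 < `|u x| by rewrite lt_neqAle eq_sym ux0 normr_ge0.
  by apply: cvg_expr; have := u1 x; rewrite ltr_norml; lra.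
apply: (@squeeze_cvgr _ _ _ _
    (fun n => `|u x| - `|u x| * (1 - `|u x| / 2) ^+ n) (fun=> `|u x|)).
- by apply: nearW => n; have [/andP[_ ->] h] := pP n x; rewrite andbT; lra.
- by rewrite -[X in _ --> X]subr0; apply: cvgB; [exact: cvg_cst|exact: geo].
- exact: cvg_cst.
Qed.

(** With v the positive part of u, the functions 1 - (1 - v)^n tend to the
    indicator of u > 0. *)
Lemma multiplier_pos u : multiplier u -> (forall x, `|u x| <= 1) ->
  multiplier (\1_[set x | 0 < u x]).
Proof.
move=> hu u1; pose v x := 2^-1 * (u x + `|u x|).
have hv : multiplier v.
  by apply: (multiplierM (multiplier_cst _)); apply: multiplierD => //;
    exact: multiplier_abs.
have v01 x : 0 <= v x <= 1.
  have := u1 x; have := ler_norm (u x); have := ler_norm (- u x).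
  by rewrite normrN /v; lra.
apply: (@multiplier_lim (fun n x => 1 - (1 - v x) ^+ n) _ 1).
- move=> n; apply: multiplierB; first exact: multiplier_cst.
  by apply: multiplierX; apply: multiplierB => //; exact: multiplier_cst.
- move=> n x; have /andP[v0 v1] := v01 x.
  have h0 : 0 <= (1 - v x) ^+ n by rewrite exprn_ge0// subr_ge0.
  have h1 : (1 - v x) ^+ n <= 1 by rewrite exprn_ile1 ?subr_ge0// gerBl.
  by rewrite ger0_norm; lra.
move=> x; rewrite indicE; have /andP[v0 v1] := v01 x.
have [ux|ux] := ltP 0 (u x).
  rewrite mem_set//= -[X in _ --> X]subr0; apply: cvgB; first exact: cvg_cst.
  have vE : v x = u x by rewrite /v gtr0_norm//; field.
  by apply: cvg_expr; move: v1; rewrite vE ltr_norml; lra.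
rewrite memNset/=; last by apply/negP; rewrite -leNgt.
have -> : v x = 0 by rewrite /v ler0_norm// subrr mulr0.
by rewrite subr0; under eq_fun do rewrite expr1n subrr; exact: cvg_cst.
Qed.

Definition multiplier_set (E : set T) := multiplier (\1_E).

Lemma multiplier_setC E : multiplier_set E -> multiplier_set (~` E).
Proof.
move=> hE; rewrite /multiplier_set (_ : \1_(~` E) = fun x => cst 1 x - \1_E x).
  by apply: multiplierB => //; exact: multiplier_cst.
by apply/funext => x; rewrite !indicE in_setC /=; case: (x \in E);
  rewrite ?subrr ?subr0.
Qed.

Lemma multiplier_set0 : multiplier_set set0.
Proof. by rewrite /multiplier_set indic0; exact: multiplier_cst. Qed.

Lemma multiplier_setI E F : multiplier_set E -> multiplier_set F ->
  multiplier_set (E `&` F).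
Proof.
move=> hE hF; rewrite /multiplier_set (_ : \1_(E `&` F) =
  fun x => \1_E x * \1_F x).
  exact: multiplierM.
by apply/funext => x; rewrite indicI.
Qed.

Lemma multiplier_set_bigcup (F : (set T)^nat) : (forall n,
  multiplier_set (F n)) ->
  multiplier_set (\bigcup_n F n).
Proof.
move=> hF; pose G n := ~` \bigcap_(k < n) ~` F k.
have hG n : multiplier_set (G n).
  apply: multiplier_setC; elim: n => [|n ih].
    rewrite (_ : bigcap _ _ = ~` set0);
      first exact/multiplier_setC/multiplier_set0.
    by rewrite setC0; apply/seteqP; split => // x _ k.
  rewrite (_ : bigcap _ _ = (\bigcap_(k < n) ~` F k) `&` ~` F n).
    by apply: multiplier_setI => //; exact: multiplier_setC.
  apply/seteqP; split => [x h|x [h1 h2] k /=].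
    by split => [k kn|]; apply: h => //=; exact: ltnW.
  by rewrite ltnS leq_eqVlt => /predU1P[->|]//; exact: h1.
apply: (@multiplier_lim (fun n => \1_(G n)) _ 1) => //.
  by move=> n x; rewrite indicE normr_nat; case: (_ \in _).
move=> x; rewrite indicE; have [[n _ Fx]|Fx] := pselect ((\bigcup_n F n) x).
  rewrite mem_set; last by exists n.
  apply: cvg_near_cst; exists n.+1 => // k /= nk.
  by rewrite indicE mem_set// => /(_ n nk).
rewrite memNset//; apply: cvg_near_cst; apply: nearW => k /=.
by rewrite indicE memNset// => h; apply: h => i ik Fi; apply: Fx; exists i.
Qed.

Lemma multiplier_set_halfline (f : T -> R) : (multiplier f) -> (forall x,
  `|f x| <= 1) ->
  forall a, multiplier_set (f @^-1` `]a, +oo[).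
Proof.
move=> hf f1 a; pose c : R := 1 + `|a|.
have c0 : 0 < c by rewrite ltr_pwDl.
rewrite /multiplier_set (_ : f @^-1` _ = [set x | 0 < c^-1 * (f x - a)]).
  apply: multiplier_pos.
    by apply: (multiplierM (multiplier_cst _)); apply: multiplierB => //;
      exact: multiplier_cst.
  move=> x; rewrite normrM gtr0_norm ?invr_gt0// mulrC ler_pdivrMr// mul1r.
  by rewrite (le_trans (ler_normB _ _))// lerD2r.
by apply/seteqP; split => x /=;
  rewrite in_itv/= andbT pmulr_rgt0 ?invr_gt0// subr_gt0.
Qed.

Lemma multiplier_set_preimage (f : T -> R) (A : set R) : (multiplier f) ->
  (forall x, `|f x| <= 1) -> measurable A -> multiplier_set (f @^-1` A).
Proof.
move=> hf f1 mA.
have {}mA : (@RGenOInfty.G R).-sigma.-measurable A.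
  by rewrite -RGenOInfty.measurableE.
move: A mA; apply: smallest_sub.
  split; rewrite /mkset.
  - by rewrite preimage_set0; exact: multiplier_set0.
  - by move=> A hA; rewrite setTD preimage_setC; exact: multiplier_setC.
  - by move=> F hF; rewrite preimage_bigcup; exact: multiplier_set_bigcup.
by move=> _ [a ->]; exact: multiplier_set_halfline.
Qed.

Lemma multiplier_set_measurable (E : set T) : measurable E -> multiplier_set E.
Proof.
move=> [B [D mD <-] <-]; rewrite !setTI.
pose g (x : T) := complex_pair (coord x).
suff : (fun D => multiplier_set (g @^-1` D)) D by [].
move: D mD; rewrite measurable_prod_measurableType; apply: smallest_sub.
  split.
  - by rewrite preimage_set0; exact: multiplier_set0.
  - by move=> A hA; rewrite setTD preimage_setC; exact: multiplier_setC.
  - by move=> F hF; rewrite preimage_bigcup; exact: multiplier_set_bigcup.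
move=> _ [A mA [B' mB] <-].
have -> : g @^-1` (A `*` B') = (fun x => Re (coord x)) @^-1` A `&`
  (fun x => Im (coord x)) @^-1` B' by [].
apply: multiplier_setI; apply: multiplier_set_preimage => //;
  [exact: multiplier_Re| |exact: multiplier_Im|].
- by move=> x; rewrite -(normc_coord x) Re_le_normc.
- by move=> x; rewrite -(normc_coord x) Im_le_normc.
Qed.

(** Indicators being multipliers, psi has mean 0 on every measurable set. *)
Lemma fourier_uniqueness : {ae m, forall x, psi x = 0}.
Proof.
pose E := [set x | 0 <= psi x].
have mpsi := Int_meas Ipsi.
have mE : measurable E.
  by rewrite -[E]setTI; apply: measurable_fun_le => //; exact: measurable_cst.
have I0 F : measurable F -> \int[m]_x (psi x * \1_F x) = 0.
  move=> mF; have [_ hF] := (multiplier_set_measurable mF).2 _ orth_analytic1.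
  rewrite -[RHS](hF 1); apply: eq_Rintegral => x _.
  by rewrite /pz hornerC !mulr1.
have bI F : measurable F -> bounded_rfun (\1_F).
  by move=> mF; exact: (multiplier_set_measurable mF).1.
have : \int[m]_x `|psi x| = 0.
  rewrite -(subrr 0) -{1}(I0 _ mE) -(I0 _ (measurableC mE)) -RIB; last 2 first.
  - exact/Int_psiM/bI.
  - by apply/Int_psiM/bI; exact: measurableC.
  apply: eq_Rintegral => x _; rewrite -mulrBr !indicE in_setC.
  have [h|h] := leP 0 (psi x).
    by rewrite mem_set//= subr0 mulr1 ger0_norm.
  rewrite memNset//= ?sub0r ?mulrN1 ?ltr0_norm//.
  by apply/negP; rewrite -ltNge.
move=> h; have := ae_eq0_of_RI (Int_abs Ipsi) (fun x => normr_ge0 _) h.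
by apply: filterS => x /normr0_eq0.
Qed.

End fourier_uniqueness.

(** * Outer functions from the Szego extremal problem *)

Section sqr_RI.
Context {d : measure_display} {T : measurableType d} {R : realType}.
Variable P : probability T R.
Local Notation Int f := (P.-integrable [set: T] (EFin \o f)).

(** The mean of (f + t)^2 is a nonnegative polynomial in t. *)
Lemma sqr_RI_le (f : T -> R) : Int f -> Int (fun x => f x ^+ 2) ->
  (\int[P]_x f x) ^+ 2 <= \int[P]_x (f x ^+ 2).
Proof.
move=> If If2; rewrite -[leRHS]mulr1; apply: quad_ge0 => // t.
have I1 := IntZ (2 * t) If; have I2 := Int_cst P (t ^+ 2).
have I3 := IntD If2 I1.
rewrite mulr1 -RIZ// -RID// -[t ^+ 2](RI_cst P) -RID//.
apply: RI_ge0 => x.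
by rewrite (_ : _ + _ = (f x + t) ^+ 2) ?sqr_ge0//; ring.
Qed.

Lemma Int_of_sqr (f : T -> R) : measurable_fun setT f ->
  Int (fun x => f x ^+ 2) -> Int f.
Proof.
move=> mf If2; apply: Int_le mf _ (IntD If2 (Int_cst P 1)) => x.
have := sqr_ge0 (f x - 1); have := sqr_ge0 (f x + 1).
by rewrite ler_norml => ? ?; apply/andP; split; nra.
Qed.

Lemma RI_normc_le (f : T -> R[i]) : measurable_fun setT f ->
  Int (fun x => sq (f x)) ->
  (\int[P]_x normc (f x)) ^+ 2 <= \int[P]_x sq (f x).
Proof.
move=> mf If; under [leRHS]eq_Rintegral do rewrite -sqr_normc.
have E : (fun x => normc (f x) ^+ 2) = (fun x => sq (f x)).
  by apply/funext => x; rewrite sqr_normc.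
apply: sqr_RI_le; last by rewrite E.
by apply: Int_of_sqr; [exact: measurable_normc|rewrite E].
Qed.

End sqr_RI.

Section szego.
Variable R : realType.
Local Notation T := (circle R).
Local Notation m := (haar R).
Local Notation Int f := (m.-integrable [set: T] (EFin \o f)).
Variable h : T -> R.
Hypotheses (mh : measurable_fun setT h) (h0 : forall x, 0 <= h x) (Ih : Int h).

Let w x := 1 + h x.
Let mw : measurable_fun setT w. Proof. exact: measurable_funD. Qed.
Let w1 x : 1 <= w x. Proof. by rewrite lerDl. Qed.
Let w0 x : 0 <= w x. Proof. exact: le_trans (w1 x). Qed.
Let Iw : Int w. Proof. exact: IntD (Int_cst m 1) Ih. Qed.

Let RIw : \int[m]_x w x = 1 + \int[m]_x h x.
Proof. by rewrite RID ?RI_cst//; exact: Int_cst. Qed.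

Let L2pz p : L2w m w (pz p).
Proof.
split; first exact: measurable_pz.
have [b b0 hb] := pz_bounded p; apply: Int_le (IntZ (b ^+ 2) Iw).
  by apply: measurable_funM => //; exact: measurable_sq (measurable_pz p).
move=> x; rewrite ger0_norm ?mulr_ge0 ?sq_ge0// ler_wpM2r// -sqr_normc.
by rewrite ler_pXn2r ?nnegrE ?normc_ge0.
Qed.

(** Multiplication by a polynomial is bounded on L^2(w dm). *)
Let L2M p : exists2 b, 0 <= b & forall f, L2w m w f ->
  L2w m w (fun x => pz p x * f x) /\
  nsq m w (fun x => pz p x * f x) <= b * nsq m w f.
Proof.
have [b b0 hb] := pz_bounded p.
exists (b ^+ 2) => [|f [mf If]]; first exact: sqr_ge0.
have mpf : measurable_fun setT (fun x => pz p x * f x).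
  by apply: measurable_cM => //; exact: measurable_pz.
have le x : sq (pz p x * f x) * w x <= b ^+ 2 * (sq (f x) * w x).
  rewrite mulrA ler_wpM2r// sqM ler_wpM2r ?sq_ge0// -sqr_normc.
  by rewrite ler_pXn2r ?nnegrE ?normc_ge0.
have Ibf := IntZ (b ^+ 2) If.
have L : L2w m w (fun x => pz p x * f x).
  split => //; apply: Int_le Ibf; last first.
    by move=> x; rewrite ger0_norm ?mulr_ge0 ?sq_ge0.
  by apply: measurable_funM => //; exact: measurable_sq.
split => //.
by rewrite /nsq -RIZ//; apply: RI_le => //; exact: L.2.
Qed.

Lemma le_eps_eq0 (x K : R) : 0 <= x -> 0 <= K ->
  (forall e, 0 < e -> x <= K * e) -> x = 0.
Proof.
move=> x0 K0 hx; apply: (geo4_le_eq0 x0 K0) => n.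
by apply: hx; rewrite exprn_gt0.
Qed.

Let ipBr f g v : L2w m w f -> L2w m w g -> L2w m w v ->
  ip m w v (fun x => f x - g x) = ip m w v f - ip m w v g.
Proof.
move=> Lf Lg Lv; have If := Int_dot mw w1 Lv Lf; have Ig := Int_dot mw w1 Lv Lg.
by rewrite /ip -RIB//; apply: eq_Rintegral => x _; rewrite /dot !reim; ring.
Qed.

Let ipDr f g v : L2w m w f -> L2w m w g -> L2w m w v ->
  ip m w v (fun x => f x + g x) = ip m w v f + ip m w v g.
Proof.
move=> Lf Lg Lv; have If := Int_dot mw w1 Lv Lf; have Ig := Int_dot mw w1 Lv Lg.
by rewrite /ip -RID//; apply: eq_Rintegral => x _; rewrite /dot !reim; ring.
Qed.

(** r is the component of 1 orthogonal to the polynomials divisible by z.  It is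
    a limit of polynomials 1 - z q, and z p (1 - z q) is divisible by z, so r is
    orthogonal to z p r for every polynomial p.  The bounds come from
    |r|^2 = <r, 1> and from the mean of r being 1. *)
Lemma szego_projection : exists r c, [/\ measurable_fun setT r,
  0 <= c <= 1 + \int[m]_x h x,
  {ae m, forall x, sq (r x) * (1 + h x) = c},
  Int (fun x => sq (r x)) /\ \int[m]_x sq (r x - 1) <= \int[m]_x h x &
  forall e, 0 < e -> exists2 p, Int (fun x => sq (r x - pz p x)) &
    \int[m]_x sq (r x - pz p x) < e].
Proof.
pose V := [set pz (p * 'X) | p in [set: {poly R[i]}]].
have L1 : L2w m w (cst 1).
  by have := L2pz 1; rewrite (_ : pz 1 = cst 1)//; apply/funext => x;
    rewrite /pz hornerC.
have [||||r [Lr ro ra]] := @orthogonal_projection _ _ _ m w mw w1 V (cst 1).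
- by move=> _ [p _ <-].
- by exists 0 => //; apply/funext => x; rewrite /pz mul0r horner0.
- exact: L1.
- move=> a _ _ [p _ <-] [q _ <-]; exists (a%:P * p + q) => //.
  by apply/funext => x; rewrite /pz !hornerE /=; ring.
have mr := Lr.1.
pose N := nsq m w r.
have N0 : 0 <= N by apply: nsq_ge0.
(* r is the limit of polynomials 1 - z q *)
have approx e : 0 < e -> exists q, let v := pz (1 - q * 'X) in
    nsq m w (fun x => v x - r x) < e.
  move=> /ra[_ [q _ <-] hq]; exists q => /=.
  by rewrite /nsq in hq *; under eq_Rintegral do rewrite /pz hornerD hornerN hornerC.
have Ldiff p : L2w m w (fun x => pz p x - r x) by exact: L2w_sub.
have iprM p q : ip m w r (pz (p * 'X * q)) = 0.
  by apply: ro; exists (p * q) => //; rewrite mulrAC.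
(* |r|^2 w has no Fourier coefficient of positive frequency *)
have orthM p : ip m w r (fun x => pz (p * 'X) x * r x) = 0.
  have [b b0 hb] := L2M (p * 'X); have [Lpr _] := hb _ Lr.
  apply/eqP; rewrite -sqrf_eq0; apply/eqP.
  apply: (@le_eps_eq0 _ (N * b)); [exact: sqr_ge0|by rewrite mulr_ge0|].
  move=> e /approx[q /= hq].
  have [Ld hd] := hb _ (Ldiff (1 - q * 'X)).
  have -> : ip m w r (fun x => pz (p * 'X) x * r x) =
      - ip m w r (fun x => pz (p * 'X) x * (pz (1 - q * 'X) x - r x)).
    rewrite -[RHS]add0r -(iprM p (1 - q * 'X)) -ipBr//.
    apply: eq_Rintegral => x _; congr (dot _ _ * _).
    by rewrite /pz !hornerE; ring.
  rewrite sqrrN (le_trans (cauchy_schwarz mw w1 Lr Ld))// -mulrA ler_wpM2l//.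
  by rewrite (le_trans hd)// ler_wpM2l// ltW.
have ipNr : N = ip m w r r.
  by apply: eq_Rintegral => x _; rewrite /dot /sq; congr (_ * _); ring.
have ip1 : ip m w r (cst 1) = N.
  apply/eqP; rewrite -subr_eq0 -sqrf_eq0; apply/eqP.
  apply: (@le_eps_eq0 _ N); [exact: sqr_ge0|by []|].
  move=> e /approx[q /= hq].
  have -> : ip m w r (cst 1) - N =
      ip m w r (fun x => pz (1 - q * 'X) x - r x).
    rewrite ipBr// -ipNr; congr (_ - _).
    rewrite -[RHS]addr0 -(iprM q 1) -ipDr//.
    apply: eq_Rintegral => x _; congr (dot _ _ * _).
    by rewrite /pz !hornerE; ring.
  by rewrite (le_trans (cauchy_schwarz mw w1 Lr (Ldiff _)))// ler_wpM2l// ltW.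
have Nw : N <= \int[m]_x w x.
  have := cauchy_schwarz mw w1 Lr L1; rewrite ip1 -/N.
  have -> : nsq m w (cst 1) = \int[m]_x w x.
    by apply: eq_Rintegral => x _; rewrite /sq /= expr1n expr0n addr0 mul1r.
  have [->|Nn0] := eqVneq N 0.
    by rewrite RI_ge0.
  by rewrite expr2 ler_pM2l// lt_neqAle eq_sym Nn0.
have Isr : Int (fun x => sq (r x)).
  apply: Int_le Lr.2; first exact: measurable_sq.
  by move=> x; rewrite ger0_norm ?sq_ge0// -[leLHS]mulr1 ler_wpM2l ?sq_ge0.
have approx' e : 0 < e -> exists q, let v := pz (1 - q * 'X) in
    Int (fun x => sq (r x - v x)) /\ \int[m]_x sq (r x - v x) < e.
  move=> /approx[q /= hq]; exists q => /=.
  have E x : sq (r x - pz (1 - q * 'X) x) = sq (pz (1 - q * 'X) x - r x).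
    by rewrite -!sqr_normc normcB.
  under eq_Rintegral do rewrite E.
  have -> : (fun x => sq (r x - pz (1 - q * 'X) x)) =
    (fun x => sq (pz (1 - q * 'X) x - r x)) by apply/funext.
  have le x : sq (pz (1 - q * 'X) x - r x) <=
      sq (pz (1 - q * 'X) x - r x) * w x.
    by rewrite -[leLHS]mulr1 ler_wpM2l ?sq_ge0.
  have I1 : Int (fun x => sq (pz (1 - q * 'X) x - r x)).
    apply: Int_le (Ldiff _).2; first exact: measurable_sq (Ldiff _).1.
    by move=> x; rewrite ger0_norm ?sq_ge0.
  by split => //; apply: le_lt_trans hq; apply: RI_le => //; exact: (Ldiff _).2.
have IRer : Int (fun x => Re (r x)).
  apply: Int_of_sqr; first exact: measurable_RE.
  apply: Int_le Isr; first by apply: measurable_funX; exact: measurable_RE.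
  by move=> x; rewrite ger0_norm ?sqr_ge0// /sq lerDl sqr_ge0.
have Rer : \int[m]_x Re (r x) = 1.
  apply/eqP; rewrite -subr_eq0 -sqrf_eq0; apply/eqP.
  apply: (@le_eps_eq0 _ 1); [exact: sqr_ge0|by []|].
  move=> e /approx'[q /= [Iq hq]]; rewrite mul1r.
  have IRv := Int_Re_pz (1 - q * 'X).
  have Ev : \int[m]_x Re (pz (1 - q * 'X) x) = 1.
    have IqX := Int_Re_pz (q * 'X).
    have -> : \int[m]_x Re (pz (1 - q * 'X) x) =
        \int[m]_x (1 - Re (pz (q * 'X) x)).
      by apply: eq_Rintegral => x _; rewrite /pz !hornerE !reim.
    rewrite RIB//; last exact: Int_cst.
    by rewrite RI_cst (mean_pzMX q (ltn0Sn 0)).1 subr0.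
  rewrite -Ev -RIB// ltW//; apply: le_lt_trans hq.
  have Ir2 : Int (fun x => (Re (r x) - Re (pz (1 - q * 'X) x)) ^+ 2).
    apply: Int_le Iq.
      apply: measurable_funX; apply: measurable_funB.
        exact: measurable_RE.
      exact: measurable_RE (measurable_pz _).
    by move=> x; rewrite ger0_norm ?sqr_ge0// /sq !reim lerDl sqr_ge0.
  apply: le_trans (sqr_RI_le (IntB IRer IRv) Ir2) _.
  by apply: RI_le => // x; rewrite /sq !reim lerDl sqr_ge0.
exists r, N; split => //.
- by rewrite N0 -RIw.
- have Ipsi : Int (fun x => sq (r x) * w x - N)
  by apply: IntB Lr.2 (Int_cst m N).
  suff hz p : \int[m]_x ((sq (r x) * w x - N) * Re (pz p x)) = 0.
    by apply: filterS (fourier_uniqueness Ipsi hz) => x /eqP;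
      rewrite subr_eq0 => /eqP.
  elim/poly_ind: p => [|q c _].
    rewrite /pz; under eq_Rintegral do rewrite horner0 mulr0.
    by rewrite RI_cst.
  have IqX := Int_Re_pz (q * 'X); have I1 := IntZ N IqX.
  have I2 := IntZ (Re c) Ipsi.
  have [b b0 hb] := L2M (q * 'X).
  have I3 := Int_dot mw w1 Lr (hb _ Lr).1.
  have I4 := IntB I3 I1.
  transitivity (\int[m]_x (dot (r x) (pz (q * 'X) x * r x) * w x -
    N * Re (pz (q * 'X) x) + Re c * (sq (r x) * w x - N))).
    by apply: eq_Rintegral => x _; rewrite /pz !hornerE /dot /sq !reim; ring.
  rewrite RID// RIB// !RIZ// -/(ip m w r (fun x => pz (q * 'X) x * r x)) orthM.
  rewrite (mean_pzMX q (ltn0Sn 0)).1 mulr0 subrr add0r RIB; last 2 first.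
  - exact: Lr.2.
  - exact: Int_cst.
  by rewrite RI_cst -/(nsq m w r) -/N subrr mulr0.
- split => //.
  have I1 := IntZ (-2) IRer; have I2 := Int_cst m (1 : R).
  have I3 := IntD Isr I1.
  have -> : \int[m]_x sq (r x - 1) = \int[m]_x (sq (r x) + -2 * Re (r x) + 1).
    by apply: eq_Rintegral => x _; rewrite /sq !reim; ring.
  have srN : \int[m]_x sq (r x) <= N.
    apply: RI_le => //; first exact: Lr.2.
    by move=> x; rewrite -[leLHS]mulr1 ler_wpM2l ?sq_ge0.
  rewrite RID// RID// RIZ// Rer RI_cst mulr1 -addrA (_ : - 2 + 1 = - 1);
    last by ring.
  by rewrite lerBlDl -RIw (le_trans srN).
- move=> e /approx'[q /= [Iq hq]]; by exists (1 - q * 'X).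
Qed.

(** The outer function u of modulus (c / (1 + h))^(1/2), set to 0 where this
    modulus is exceeded, so that the bound holds at every point. *)
Lemma szego : exists (u : T -> R[i]) (c : R), [/\ measurable_fun setT u,
  0 <= c <= 1 + \int[m]_x h x,
  forall x, sq (u x) * (1 + h x) <= c,
  \int[m]_x sq (u x - 1) <= \int[m]_x h x &
  forall e, 0 < e -> exists p, \int[m]_x sq (u x - pz p x) < e].
Proof.
have [r [c [mr cb rc [Isr sr1] ra]]] := szego_projection.
have /andP[c0 _] := cb.
have mrw : measurable_fun setT (fun x => sq (r x) * (1 + h x)).
  by apply: measurable_funM => //; exact: measurable_sq.
pose A := [set x | sq (r x) * (1 + h x) <= c].
have mA : measurable A.
  by rewrite -[A]setTI; apply: measurable_fun_le => //; exact: measurable_cst.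
pose u x := (\1_A x)%:C * r x.
have mu : measurable_fun setT u.
  by apply: measurable_cM => //; apply: measurable_real_complex.
have ur : {ae m, forall x, u x = r x}.
  apply: filterS rc => x hx; rewrite /u indicE mem_set ?mul1r//.
  by rewrite /A/= hx.
exists u, c; split => //.
- move=> x; rewrite /u indicE; have [Ax|Ax] := pselect (A x).
    by rewrite mem_set// mul1r.
  by rewrite memNset// mul0r /sq/= expr0n addr0 mul0r.
- rewrite (@RI_eq_ae _ _ _ m _ (fun x => sq (r x - 1)))//.
  + by apply: measurable_sq; apply: measurable_cB.
  + by apply: measurable_sq; apply: measurable_cB.
  + by apply: filterS ur => x ->.
- move=> e /ra[p _ hp]; exists p.
  rewrite (@RI_eq_ae _ _ _ m _ (fun x => sq (r x - pz p x)))//.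
  + by apply: measurable_sq; apply: measurable_cB => //; exact: measurable_pz.
  + by apply: measurable_sq; apply: measurable_cB => //; exact: measurable_pz.
  + by apply: filterS ur => x ->.
Qed.

End szego.

(** * Fejer means *)

Section complex_integrals.
Variable R : realType.
Local Notation T := (circle R).
Local Notation m := (haar R).
Local Notation Int f := (m.-integrable [set: T] (EFin \o f)).
Implicit Types f g : T -> R[i].

Definition bounded_cfun f := measurable_fun setT f /\ exists c, forall x,
  normc (f x) <= c.

Lemma bounded_cfun_cst a : bounded_cfun (cst a).
Proof. by split => //; exists (normc a). Qed.

Lemma bounded_cfunD f g : bounded_cfun f -> bounded_cfun g ->
  bounded_cfun (fun x => f x + g x).
Proof.
move=> [mf [c hc]] [mg [e he]]; split; first exact: measurable_cD.
by exists (c + e) => x; rewrite (le_trans (normcD _ _))// lerD.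
Qed.

Lemma bounded_cfunM f g : bounded_cfun f -> bounded_cfun g ->
  bounded_cfun (fun x => f x * g x).
Proof.
move=> [mf [c hc]] [mg [e he]]; split; first exact: measurable_cM.
by exists (c * e) => x; rewrite normcM ler_pM ?normc_ge0.
Qed.

Lemma bounded_cfunB f g : bounded_cfun f -> bounded_cfun g ->
  bounded_cfun (fun x => f x - g x).
Proof.
move=> bf bg; have := bounded_cfunD bf (bounded_cfunM (bounded_cfun_cst (-1)) bg).
by under eq_fun do rewrite /= mulN1r.
Qed.

Lemma bounded_cfun_conj f : bounded_cfun f ->
  bounded_cfun (fun x => conjc (f x)).
Proof.
move=> [mf [c hc]]; split; first exact: measurable_conj.
by exists c => x; rewrite normc_conj.
Qed.

Lemma bounded_cfun_pz p : bounded_cfun (pz p).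
Proof.
by split; [exact: measurable_pz|have [b _ hb] := pz_bounded p; exists b].
Qed.

Lemma bounded_cfunX f n : bounded_cfun f -> bounded_cfun (fun x => f x ^+ n).
Proof.
move=> bf; elim: n => [|n ih]; first exact: (bounded_cfun_cst 1).
by under eq_fun do rewrite exprS; exact: bounded_cfunM.
Qed.

Lemma bounded_cfun_coord : bounded_cfun (@coord R).
Proof.
by split; [exact: measurable_coord|exists 1 => x; rewrite normc_coord].
Qed.

Lemma bounded_cfun_sum (n : nat) (F : nat -> T -> R[i]) : (forall i,
  bounded_cfun (F i)) ->
  bounded_cfun (fun x => \sum_(0 <= i < n) F i x).
Proof.
move=> bF; elim: n => [|n ih].
  by under eq_fun do rewrite big_nil; exact: (bounded_cfun_cst 0).
by under eq_fun do rewrite big_nat_recr//=; exact: bounded_cfunD.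
Qed.

Lemma bounded_cfun_IntRe f : bounded_cfun f -> Int (fun x => Re (f x)).
Proof.
move=> [mf [c hc]]; apply: (@Int_bounded _ _ _ m _ c);
  first exact: measurable_RE.
by move=> x; rewrite (le_trans (Re_le_normc _)).
Qed.

Lemma bounded_cfun_IntIm f : bounded_cfun f -> Int (fun x => Im (f x)).
Proof.
move=> [mf [c hc]]; apply: (@Int_bounded _ _ _ m _ c);
  first exact: measurable_IM.
by move=> x; rewrite (le_trans (Im_le_normc _)).
Qed.

Lemma bounded_cfun_Int_normc f : bounded_cfun f -> Int (fun x => normc (f x)).
Proof.
move=> [mf [c hc]]; apply: (@Int_bounded _ _ _ m _ c);
  first exact: measurable_normc.
by move=> x; rewrite ger0_norm ?normc_ge0.
Qed.

Lemma bounded_cfun_Int_sq f : bounded_cfun f -> Int (fun x => sq (f x)).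
Proof.
move=> [mf [c hc]]; apply: (@Int_bounded _ _ _ m _ (c ^+ 2)).
  exact: measurable_sq.
move=> x; rewrite ger0_norm ?sq_ge0// -sqr_normc.
by rewrite ler_pXn2r ?nnegrE ?normc_ge0// (le_trans _ (hc x)) ?normc_ge0.
Qed.

Local Notation CI := (@complex_integral R).

Lemma Re_CI f : Re (CI f) = \int[m]_x Re (f x). Proof. by []. Qed.
Lemma Im_CI f : Im (CI f) = \int[m]_x Im (f x). Proof. by []. Qed.

Lemma complex_ext (z1 z2 : R[i]) : Re z1 = Re z2 -> Im z1 = Im z2 -> z1 = z2.
Proof. by case: z1 z2 => [a b] [c e] /= -> ->. Qed.

Lemma eq_CI f g : f =1 g -> CI f = CI g.
Proof. by move=> fg; congr CI; apply/funext. Qed.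

Lemma CID f g : bounded_cfun f -> bounded_cfun g -> CI (fun x => f x + g x) =
  CI f + CI g.
Proof.
move=> bf bg; have h1 := bounded_cfun_IntRe bf; have h2 :=
  bounded_cfun_IntRe bg.
have h3 := bounded_cfun_IntIm bf; have h4 := bounded_cfun_IntIm bg.
apply: complex_ext; rewrite reim !(Re_CI, Im_CI) -RID//.
- by apply: eq_Rintegral => x _; rewrite ReD.
- by apply: eq_Rintegral => x _; rewrite ImD.
Qed.

Lemma CIZ a f : bounded_cfun f -> CI (fun x => a * f x) = a * CI f.
Proof.
move=> bf; have h1 := bounded_cfun_IntRe bf; have h2 := bounded_cfun_IntIm bf.
have I1 := IntZ (Re a) h1; have I2 := IntZ (Im a) h1.
have I3 := IntZ (Re a) h2; have I4 := IntZ (Im a) h2.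
apply: complex_ext; rewrite reim !(Re_CI, Im_CI) -!RIZ// -?RIB// -?RID//.
- by apply: eq_Rintegral => x _; rewrite ReM.
- by apply: eq_Rintegral => x _; rewrite ImM.
Qed.

Lemma CI_conj f : bounded_cfun f -> CI (fun x => conjc (f x)) = conjc (CI f).
Proof.
move=> bf; apply: complex_ext; rewrite reim !(Re_CI, Im_CI).
- by apply: eq_Rintegral => x _; rewrite ReJ.
have h := bounded_cfun_IntIm bf; rewrite -mulN1r -RIZ//.
by apply: eq_Rintegral => x _; rewrite ImJ mulN1r.
Qed.

Lemma CIB f g : bounded_cfun f -> bounded_cfun g -> CI (fun x => f x - g x) =
  CI f - CI g.
Proof.
move=> bf bg; rewrite -[- CI g]mulN1r -CIZ// -CID//; last first.
  by have := bounded_cfunM (bounded_cfun_cst (-1)) bg.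
by apply: eq_CI => x; rewrite mulN1r.
Qed.

Lemma CI_sum (n : nat) (F : nat -> T -> R[i]) : (forall i,
  bounded_cfun (F i)) ->
  CI (fun x => \sum_(0 <= i < n) F i x) = \sum_(0 <= i < n) CI (F i).
Proof.
move=> bF; elim: n => [|n ih].
  rewrite big_nil; apply: complex_ext; rewrite !(Re_CI, Im_CI) /=;
    by under eq_Rintegral do rewrite big_nil; rewrite RI_cst.
rewrite big_nat_recr//= -ih -CID//; last exact: bounded_cfun_sum.
by apply: eq_CI => x; rewrite big_nat_recr.
Qed.

(** |I|^2 is the mean of Re (conj I f), I being the integral of f. *)
Lemma normc_CI_le f : bounded_cfun f -> normc (CI f) <= \int[m]_x normc (f x).
Proof.
move=> bf; have J0 : 0 <= \int[m]_x normc (f x).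
  by apply: RI_ge0 => x; exact: normc_ge0.
have [->//|I0] := eqVneq (normc (CI f)) 0.
have Ip : 0 < normc (CI f) by rewrite lt_neqAle eq_sym I0 normc_ge0.
rewrite -(ler_pM2l Ip) -expr2 sqr_normc.
have bIf := bounded_cfunM (bounded_cfun_cst (conjc (CI f))) bf.
have -> : sq (CI f) = Re (conjc (CI f) * CI f) by rewrite /sq !reim; ring.
rewrite -CIZ// Re_CI -RIZ; last exact: bounded_cfun_Int_normc.
apply: RI_le; [exact: bounded_cfun_IntRe|by apply: IntZ;
  exact: bounded_cfun_Int_normc|].
move=> x; rewrite -(normc_conj (CI f)) -normcM.
exact: le_trans (ler_norm _) (Re_le_normc _).
Qed.

Lemma conj_coordK (x : T) : conjc (coord x) * coord x = 1.
Proof.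
have := normc_coord x; move/(congr1 (fun y => y ^+ 2));
  rewrite sqr_normc expr1n /sq => h.
by apply: complex_ext; rewrite !reim; [rewrite -h|]; ring.
Qed.

Lemma CI_coordX n : CI (fun x => coord x ^+ n) = (n == 0%N)%:R.
Proof.
case: n => [|n].
  by apply: complex_ext; rewrite !(Re_CI, Im_CI);
    under eq_Rintegral do rewrite expr0;
    rewrite RI_cst.
have [h1 h2] := @haar_moments R n.+1 isT.
by apply: complex_ext; rewrite !(Re_CI, Im_CI).
Qed.

Lemma coordJX (x : T) j k : conjc (coord x) ^+ j * coord x ^+ k =
  if (j <= k)%N then coord x ^+ (k - j) else conjc (coord x) ^+ (j - k).
Proof.
case: leqP => jk.
  by rewrite -{1}(subnKC jk) exprD mulrA -exprMn conj_coordK expr1n mul1r.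
by rewrite -{1}(subnK (ltnW jk)) exprD -mulrA -exprMn conj_coordK expr1n mulr1.
Qed.

Lemma CI_orthonormal j k :
  CI (fun x => conjc (coord x) ^+ j * coord x ^+ k) = (j == k)%:R.
Proof.
rewrite (@eq_CI _ (fun x => if (j <= k)%N then coord x ^+ (k - j)
  else conjc (coord x) ^+ (j - k))); last by move=> x; rewrite coordJX.
case: leqP => jk; first by rewrite CI_coordX subn_eq0 eqn_leq jk.
rewrite (@eq_CI _ (fun x => conjc (coord x ^+ (j - k)))); last first.
  by move=> x; rewrite rmorphXn.
rewrite CI_conj; last exact/bounded_cfunX/bounded_cfun_coord.
rewrite CI_coordX subn_eq0 leqNgt jk gtn_eqF//.
by apply: complex_ext; rewrite !reim/= ?oppr0.
Qed.

End complex_integrals.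

Lemma sqr_sum_le (R : realType) n (F : nat -> R) :
  (\sum_(0 <= j < n) F j) ^+ 2 <= n%:R * \sum_(0 <= j < n) F j ^+ 2.
Proof.
rewrite mulrC; apply: quad_ge0 => // t.
have -> : \sum_(0 <= j < n) F j ^+ 2 + 2 * t * \sum_(0 <= j < n) F j +
    t ^+ 2 * n%:R = \sum_(0 <= j < n) (F j + t) ^+ 2.
  rewrite [t ^+ 2 * _]mulr_natr -{3}(subn0 n) -sumr_const_nat mulr_sumr.
  by rewrite -!big_split/=; apply: eq_bigr => j _; ring.
by apply: sumr_ge0 => j _; exact: sqr_ge0.
Qed.

Lemma Re_sum (R : realType) n (F : nat -> R[i]) :
  Re (\sum_(0 <= j < n) F j) = \sum_(0 <= j < n) Re (F j).
Proof. by elim: n => [|n ih]; rewrite ?big_nil// !big_nat_recr//= ReD ih. Qed.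

Lemma Im_sum (R : realType) n (F : nat -> R[i]) :
  Im (\sum_(0 <= j < n) F j) = \sum_(0 <= j < n) Im (F j).
Proof. by elim: n => [|n ih]; rewrite ?big_nil// !big_nat_recr//= ImD ih. Qed.

Lemma sq_sum_le (R : realType) n (F : nat -> R[i]) :
  sq (\sum_(0 <= j < n) F j) <= n%:R * \sum_(0 <= j < n) sq (F j).
Proof.
rewrite /sq big_split mulrDr Re_sum Im_sum.
by apply: lerD; exact: sqr_sum_le.
Qed.

Section fejer.
Variable R : realType.
Local Notation T := (circle R).
Local Notation m := (haar R).
Local Notation CI := (@complex_integral R).
Local Notation Int f := (m.-integrable [set: T] (EFin \o f)).
Local Notation N2 f := (\int[m]_x sq (f x)).
Variables (u : T -> R[i]) (c : R).
Hypotheses (mu : measurable_fun setT u) (uc : forall x, sq (u x) <= c).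
Hypothesis ucl : forall e, 0 < e -> exists p, N2 (fun x => u x - pz p x) < e.

Let c0 : 0 <= c. Proof. exact: le_trans (sq_ge0 _) (uc (expi 0)). Qed.

Let uN x : normc (u x) <= Num.sqrt c.
Proof. by rewrite normcE ler_sqrt. Qed.

Let bu : bounded_cfun u. Proof. by split => //; exists (Num.sqrt c). Qed.

Let a n := CI (fun x => u x * conjc (coord x) ^+ n).

Let bJX n : bounded_cfun (fun x : T => conjc (coord x) ^+ n).
Proof. by apply: bounded_cfunX; apply: bounded_cfun_conj;
  exact: bounded_cfun_coord. Qed.

Let bX n : bounded_cfun (fun x : T => coord x ^+ n).
Proof. by apply: bounded_cfunX; exact: bounded_cfun_coord. Qed.

(** The coefficients of negative index vanish for polynomials, hence for u. *)
Let CI_uX n : (0 < n)%N -> CI (fun x => u x * coord x ^+ n) = 0.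
Proof.
move=> n0; apply: eq0_normc; apply/eqP; rewrite -sqrf_eq0; apply/eqP.
apply: (@le_eps_eq0 _ _ 1); [exact: sqr_ge0|by []|].
move=> e /ucl[p hp]; rewrite mul1r.
have bp := bounded_cfun_pz p; have bd := bounded_cfunB bu bp.
have -> : CI (fun x => u x * coord x ^+ n) =
    CI (fun x => (u x - pz p x) * coord x ^+ n).
  transitivity (CI (fun x => u x * coord x ^+ n) - CI (pz (p * 'X^n))).
    have [h1 h2] := mean_pzMX p n0.
    suff -> : CI (pz (p * 'X^n)) = 0 by rewrite subr0.
    by apply: complex_ext; rewrite !(Re_CI, Im_CI).
  rewrite -CIB; [|exact: bounded_cfunM|exact: bounded_cfun_pz].
  by apply: eq_CI => x; rewrite /pz hornerM hornerXn mulrBl.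
rewrite (le_trans _ (ltW hp))//.
apply: le_trans (RI_normc_le bd.1 (bounded_cfun_Int_sq bd)).
rewrite ler_pXn2r ?nnegrE ?normc_ge0//; last first.
  by apply: RI_ge0 => x; exact: normc_ge0.
rewrite (le_trans (normc_CI_le (bounded_cfunM bd (bX n))))// le_eqVlt;
  apply/orP; left.
apply/eqP; apply: eq_Rintegral => x _; rewrite normcM.
suff -> : normc (coord x ^+ n) = 1 by rewrite mulr1.
elim: (n) => [|k ih]; first by rewrite expr0 normc1.
by rewrite exprS normcM normc_coord mul1r.
Qed.

Let CI_uJXX j k : CI (fun x => u x * (conjc (coord x) ^+ j * coord x ^+ k)) =
  if (k <= j)%N then a (j - k) else 0.
Proof.
rewrite (@eq_CI _ _ (fun x => u x * (if (j <= k)%N then coord x ^+ (k - j)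
  else conjc (coord x) ^+ (j - k)))); last by move=> x; rewrite coordJX.
case: (ltngtP j k) => jk.
- by apply: CI_uX; rewrite subn_gt0.
- by [].
- by rewrite jk subnn /a; apply: eq_CI => x; rewrite !expr0.
Qed.

Definition partial_sum n : {poly R[i]} := \poly_(i < n) a i.
(** n times the Fejer mean of order n. *)
Definition fejer_sum n : {poly R[i]} := \sum_(0 <= j < n) partial_sum j.+1.

Let D n (y x : T) := \sum_(0 <= j < n) coord y ^+ j * conjc (coord x) ^+ j.

Let bD n y : bounded_cfun (D n y).
Proof. by apply: bounded_cfun_sum => i; apply: bounded_cfunM;
  [exact: bounded_cfun_cst|exact: bJX]. Qed.

(** The squared modulus of the Dirichlet kernel is n times the Fejer kernel. *)
Let CI_kernel f n y : bounded_cfun f ->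
  CI (fun x => f x * (D n y x * conjc (D n y x))) =
  \sum_(0 <= j < n) \sum_(0 <= k < n) coord y ^+ j * conjc (coord y) ^+ k *
    CI (fun x => f x * (conjc (coord x) ^+ j * coord x ^+ k)).
Proof.
move=> bf.
have bjk j k : bounded_cfun (fun x => f x * (conjc (coord x) ^+ j * coord x ^+ k)).
  by apply: bounded_cfunM => //; apply: bounded_cfunM; [exact: bJX|exact: bX].
have bcjk j k : bounded_cfun (fun x => coord y ^+ j * conjc (coord y) ^+ k *
    (f x * (conjc (coord x) ^+ j * coord x ^+ k))).
  by apply: bounded_cfunM => //; exact: bounded_cfun_cst.
under [RHS]eq_bigr do under eq_bigr do rewrite -CIZ//.
under [RHS]eq_bigr do rewrite -CI_sum//.
rewrite -CI_sum; last by move=> i; exact: bounded_cfun_sum.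
apply: eq_CI => x; rewrite /D rmorph_sum/= mulr_suml mulr_sumr.
apply: eq_bigr => j _; rewrite !mulr_sumr; apply: eq_bigr => k _.
by rewrite rmorphM !rmorphXn/= conjcK; ring.
Qed.

Let fejer_kernel n y : pz (fejer_sum n) y =
  CI (fun x => u x * (D n y x * conjc (D n y x))).
Proof.
rewrite CI_kernel// /pz /fejer_sum horner_sum.
apply: eq_big_nat => j /andP[_ jn].
rewrite [RHS](big_cat_nat (n := j.+1))//= [X in _ + X]big_nat_cond [X in _ +
  X]big1 ?addr0; last first.
  by move=> k /andP[/andP[jk _] _]; rewrite CI_uJXX leqNgt jk mulr0.
rewrite horner_poly -(big_mkord xpredT (fun i => a i * coord y ^+ i)).
rewrite big_nat_rev/=; apply: eq_big_nat => k /andP[_ kj].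
rewrite CI_uJXX -ltnS kj add0n subSS mulrC; congr (_ * _).
by rewrite mulrC coordJX -ltnS kj.
Qed.

Lemma fejer_bounded n y : normc (pz (fejer_sum n) y) <= n%:R * Num.sqrt c.
Proof.
have bDD : bounded_cfun (fun x => D n y x * conjc (D n y x)).
  by apply: bounded_cfunM => //; exact: bounded_cfun_conj.
have DDE x : D n y x * conjc (D n y x) = (sq (D n y x))%:C.
  by apply: complex_ext; rewrite /sq !reim/=; ring.
rewrite fejer_kernel (le_trans (normc_CI_le (bounded_cfunM bu bDD)))//.
apply: (@le_trans _ _ (\int[m]_x (Num.sqrt c * sq (D n y x)))).
  apply: RI_le.
  - exact: bounded_cfun_Int_normc (bounded_cfunM bu bDD).
  - by apply: IntZ; exact: bounded_cfun_Int_sq.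
  - move=> x; rewrite normcM DDE normc_real ger0_norm ?sq_ge0//.
    by rewrite ler_wpM2r ?sq_ge0.
rewrite RIZ; last exact: bounded_cfun_Int_sq.
rewrite mulrC ler_wpM2r ?sqrtr_ge0//.
have -> : \int[m]_x sq (D n y x) =
  Re (CI (fun x => cst 1 x * (D n y x * conjc (D n y x)))).
  by rewrite Re_CI; apply: eq_Rintegral => x _; rewrite /= mul1r DDE.
rewrite CI_kernel; last exact: bounded_cfun_cst.
rewrite (eq_big_nat _ _ (F2 := fun=> 1)); last first.
  move=> j /andP[_ jn]; rewrite (bigD1_seq j) ?mem_index_iota ?iota_uniq//=.
  rewrite big1 ?addr0; last first.
    move=> k kj; rewrite (@eq_CI _ _ (fun x => conjc (coord x) ^+ j * coord x ^+ k)); last first.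
      by move=> x; rewrite /= mul1r.
    by rewrite CI_orthonormal eq_sym (negbTE kj) mulr0.
  rewrite (@eq_CI _ _ (fun x => conjc (coord x) ^+ j * coord x ^+ j));
    last first.
    by move=> x; rewrite /= mul1r.
  by rewrite CI_orthonormal eqxx mulr1 mulrC coordJX leqnn subnn expr0.
by rewrite sumr_const_nat subn0 -(rmorph_nat (real_complex R)).
Qed.

(** The partial sum minimizes the distance to u among polynomials of its
    degree: the error u - S is orthogonal to these. *)
Lemma best_approximation M (p : {poly R[i]}) : (size p <= M)%N ->
  N2 (fun x => u x - pz (partial_sum M) x) <= N2 (fun x => u x - pz p x).
Proof.
move=> pM; set S := partial_sum M.
have L f : bounded_cfun f -> L2w m (cst 1) f.
  move=> bf; split; first exact: bf.1.
  by under [EFin \o _]eq_fun do rewrite /= mulr1; exact: bounded_cfun_Int_sq.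
have N2E f : N2 f = nsq m (cst 1) f.
  by rewrite /nsq; apply: eq_Rintegral => x _; rewrite mulr1.
have bS := bounded_cfun_pz S; have bp := bounded_cfun_pz p.
have b1 := bounded_cfunB bu bS; have b2 := bounded_cfunB bS bp.
have w1 (x : T) : 1 <= (cst 1 x : R) by [].
have := @nsqD _ _ _ m (cst 1) (@measurable_cst _ _ _ _ _ _) w1 1 _ _ (L _ b1) (L _ b2).
have -> : (fun x => (1 : R)%:C * (pz S x - pz p x) + (u x - pz S x)) =
    (fun x => u x - pz p x) by apply/funext => x; rewrite rmorph1; ring.
rewrite !N2E => ->.
suff -> : ip m (cst 1) (fun x => u x - pz S x) (fun x => pz S x - pz p x) = 0.
  by rewrite mulr0 addr0 lerDl expr1n mul1r nsq_ge0.
pose d := S - p.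
have sd : (size d <= M)%N.
  by rewrite (leq_trans (size_polyD _ _))// geq_max size_polyN pM size_poly.
transitivity (Re (CI (fun x => (u x - pz S x) * conjc (pz d x)))).
  rewrite Re_CI; apply: eq_Rintegral => x _.
  by rewrite /dot /pz /d !hornerE !reim; ring.
have h (f : T -> R[i]) : bounded_cfun f -> CI (fun x => f x * conjc (pz d x)) =
   \sum_(0 <= k < M) conjc d`_k * CI (fun x => f x * conjc (coord x) ^+ k).
  move=> bf.
  have bfk k : bounded_cfun (fun x => f x * conjc (coord x) ^+ k)
    by apply: bounded_cfunM.
  under [RHS]eq_bigr do rewrite -CIZ//.
  rewrite -CI_sum; last by move=> i; apply: bounded_cfunM => //;
    exact: bounded_cfun_cst.
  apply: eq_CI => x; rewrite /pz (horner_coef_wide _ sd).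
  rewrite -(big_mkord xpredT (fun i => d`_i * coord x ^+ i)) rmorph_sum/= mulr_sumr.
  by apply: eq_bigr => k _; rewrite rmorphM rmorphXn; ring.
rewrite h//= big_nat_cond big1// => k /andP[/andP[_ kM] _].
suff -> : CI (fun x => (u x - pz S x) * conjc (coord x) ^+ k) = 0
  by rewrite mulr0.
transitivity (a k - CI (fun x => pz S x * conjc (coord x) ^+ k)).
  rewrite /a -CIB; [|exact: bounded_cfunM|exact: bounded_cfunM].
  by apply: eq_CI => x; rewrite mulrBl.
apply/eqP; rewrite subr_eq0 eq_sym; apply/eqP.
have bik i : bounded_cfun (fun x : T => conjc (coord x) ^+ k * coord x ^+ i) by exact: bounded_cfunM.
transitivity (\sum_(0 <= i < M) a i * CI (fun x => conjc (coord x) ^+ k * coord x ^+ i)).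
  under [RHS]eq_bigr do rewrite -CIZ//.
  rewrite -CI_sum; last by move=> i; apply: bounded_cfunM => //;
    exact: bounded_cfun_cst.
  apply: eq_CI => x; rewrite /pz horner_poly mulr_suml big_mkord.
  by apply: eq_bigr => i _; ring.
rewrite (bigD1_seq k) ?mem_index_iota ?iota_uniq//=.
rewrite CI_orthonormal eqxx mulr1 big1 ?addr0// => i ik.
by rewrite CI_orthonormal eq_sym (negbTE ik) mulr0.
Qed.

(** If q is a polynomial close to u, then the partial sums of u of degree at
    least that of q are at least as close to u; the other ones have a
    negligible weight in the Fejer means of large order. *)
Lemma fejer_approximation e : 0 < e -> exists2 p,
  forall x, normc (pz p x) <= Num.sqrt c & N2 (fun x => u x - pz p x) < e.
Proof.
move=> e0; have e20 : 0 < e / 2 by rewrite divr_gt0.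
have [q hq] := ucl e20.
pose E j := N2 (fun x => u x - pz (partial_sum j.+1) x).
pose K := N2 u; have K0 : 0 <= K by apply: RI_ge0 => x; exact: sq_ge0.
have EK j : E j <= K.
  have := @best_approximation j.+1 0; rewrite size_poly0 => /(_ isT).
  rewrite /K; under [X in _ <= X]eq_Rintegral do rewrite /pz horner0 subr0.
  by [].
have Ee j : (size q <= j)%N -> E j <= e / 2.
  by move=> qj; rewrite (le_trans (best_approximation (leqW qj)))// ltW.
pose n := (Num.truncn ((size q)%:R * K / (e / 2))).+1.
have nK : (size q)%:R * K < n%:R * (e / 2) by rewrite -ltr_pdivrMr// truncnS_gt.
have n0 : (0 : R) < n%:R by rewrite ltr0n.
pose i : R[i] := (n%:R^-1 : R)%:C.
have iN : normc i = n%:R^-1 by rewrite normc_real ger0_norm// invr_ge0.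
exists (i%:P * fejer_sum n).
  move=> x; rewrite /pz hornerCM normcM iN.
  by rewrite ler_pdivrMl//; exact: fejer_bounded.
have bS j : bounded_cfun (fun x => u x - pz (partial_sum j.+1) x).
  by apply: bounded_cfunB => //; exact: bounded_cfun_pz.
have bI j := bounded_cfun_Int_sq (bS j).
have IS k : Int (fun x => \sum_(0 <= j < k) sq (u x - pz (partial_sum j.+1) x)).
  elim: k => [|k ih].
    by under [EFin \o _]eq_fun do rewrite /= big_nil; exact: (Int_cst m 0).
  by under [EFin \o _]eq_fun do rewrite /= big_nat_recr//=; exact: IntD.
have RS k : \int[m]_x (\sum_(0 <= j < k) sq (u x - pz (partial_sum j.+1) x)) =
    \sum_(0 <= j < k) E j.
  elim: k => [|k ih].
    by under eq_Rintegral do rewrite big_nil; rewrite RI_cst big_nil.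
  under eq_Rintegral do rewrite big_nat_recr//=.
  by rewrite RID// ih big_nat_recr.
have pE x : u x - pz (i%:P * fejer_sum n) x =
    i * \sum_(0 <= j < n) (u x - pz (partial_sum j.+1) x).
  rewrite big_split/= sumr_const_nat subn0 sumrN mulrBr /pz hornerCM.
  rewrite /fejer_sum horner_sum; congr (_ - _).
  rewrite -mulr_natl mulrA -[LHS]mul1r; congr (_ * _).
  by rewrite -(rmorph_nat (real_complex R)) -rmorphM mulVf ?rmorph1// gt_eqF.
apply: (@le_lt_trans _ _ (n%:R^-1 * \sum_(0 <= j < n) E j)).
  rewrite -RS -RIZ//; apply: RI_le.
  - exact: bounded_cfun_Int_sq (bounded_cfunB bu (bounded_cfun_pz _)).
  - exact: IntZ.
  move=> x; rewrite pE sqM (_ : sq i = n%:R^-1 * n%:R^-1); last first.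
    by rewrite /sq /= expr0n addr0 expr2.
  rewrite -mulrA ler_wpM2l// ?invr_ge0//  ler_pdivrMl//.
  exact: sq_sum_le.
have : \sum_(0 <= j < n) E j <= (size q)%:R * K + n%:R * (e / 2).
  apply: (@le_trans _ _ (\sum_(0 <= j < n) ((j < size q)%:R * K + e / 2))).
    apply: ler_sum => j _; case: ltnP => jq.
      by rewrite mul1r (le_trans (EK j))// lerDl ltW.
    by rewrite mul0r add0r Ee.
  rewrite big_split/= sumr_const_nat subn0 -[_ *+ n]mulr_natl lerD2r -mulr_suml.
  rewrite ler_wpM2r//; elim: (n) => [|k ih]; first by rewrite big_nil.
  rewrite big_nat_recr//=; have [kq|kq] := ltnP k (size q).
    suff -> : \sum_(0 <= j < k) ((j < size q)%:R : R) = k%:R.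
      by rewrite natr1 ler_nat.
    rewrite (eq_big_nat _ _ (F2 := fun=> 1)) ?sumr_const_nat ?subn0//.
    by move=> j /andP[_ jk]; rewrite (ltn_trans jk kq).
  by rewrite addr0.
rewrite ltr_pdivrMl// => /le_lt_trans; apply.
by rewrite [X in _ < X](_ : _ = n%:R * (e / 2) + n%:R * (e / 2)) ?ltrD2r//;
  field.
Qed.

End fejer.

(** * Outer multipliers *)

Section outer_multiplier.
Variable R : realType.
Local Notation T := (circle R).
Local Notation m := (haar R).
Local Notation Int f := (m.-integrable [set: T] (EFin \o f)).

(** The functions of H^oo bounded by c, described by the convergence in mean of
    their Fejer means. *)
Definition bounded_poly_limit (phi : T -> R[i]) (c : R) :=
  [/\ measurable_fun setT phi, forall x, normc (phi x) <= c &
   forall e, 0 < e -> exists2 p, forall x, normc (pz p x) <= c &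
     \int[m]_x normc (phi x - pz p x) < e].

Lemma bounded_poly_limit_sqr u c : 0 <= c -> bounded_poly_limit u c ->
  bounded_poly_limit (fun x => u x ^+ 2) (c ^+ 2).
Proof.
move=> c0 [mu uc ua].
have mu2 : measurable_fun setT (fun x => u x ^+ 2).
  by under eq_fun do rewrite expr2; exact: measurable_cM.
split=> //.
  by move=> x; rewrite expr2 normcM -expr2 ler_pXn2r// ?nnegrE ?normc_ge0.
move=> e e0; have c1 : 0 < 2 * c + 1 by rewrite ltr_wpDl// mulr_ge0.
have [p pc hp] := ua _ (divr_gt0 e0 c1).
exists (p ^+ 2).
  move=> x; rewrite /pz horner_exp expr2 normcM -expr2.
  by rewrite ler_pXn2r ?nnegrE ?normc_ge0//; exact: pc.
have bu : bounded_cfun u by split => //; exists c.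
have bp := bounded_cfun_pz p; have bd :=
  bounded_cfun_Int_normc (bounded_cfunB bu bp).
rewrite ltr_pdivlMr// mulrC -RIZ// in hp; apply: le_lt_trans hp.
apply: RI_le.
- by apply: bounded_cfun_Int_normc; apply: bounded_cfunB;
  [exact: bounded_cfunX|exact: bounded_cfun_pz].
- exact: IntZ.
move=> x; rewrite /pz horner_exp subr_sqr normcM mulrC ler_wpM2r ?normc_ge0//.
rewrite (le_trans (normcD _ _))// (le_trans (lerD (uc x) (pc x)))//.
by rewrite mulrDl mul1r lerDl.
Qed.

(** phi is the square of the outer function u of szego: in this way the bound on
    |u|^2 (1 + h) becomes one on phi, and |u^2 - 1| <= |u - 1|^2 + 2 |u - 1|. *)
Lemma outer_multiplier (h : T -> R) : measurable_fun setT h ->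
  (forall x, 0 <= h x) -> Int h -> exists phi c,
  [/\ 0 <= c <= 1 + \int[m]_x h x, bounded_poly_limit phi c,
   forall x, normc (phi x) * h x <= c &
   \int[m]_x normc (phi x - 1) <=
     \int[m]_x h x + 2 * Num.sqrt (\int[m]_x h x)].
Proof.
move=> mh h0 Ih; have [u [c [mu cb uc u1 ua]]] := szego mh h0 Ih.
have /andP[c0 _] := cb.
have usq x : sq (u x) <= c.
  by apply: le_trans (uc x); rewrite -[leLHS]mulr1 ler_wpM2l ?sq_ge0// lerDl.
have bu : bounded_cfun u.
  split => //; exists (Num.sqrt c) => x.
  by rewrite normcE ler_sqrt.
exists (fun x => u x ^+ 2), c; split => //.
- rewrite -(sqr_sqrtr c0); apply: bounded_poly_limit_sqr;
  first exact: sqrtr_ge0.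
  split => //; first by move=> x; rewrite normcE ler_sqrt.
  move=> e e0; have e20 : 0 < e ^+ 2 by rewrite exprn_gt0.
  have [p pc hp] := fejer_approximation mu usq ua e20; exists p => //.
  have bd := bounded_cfunB bu (bounded_cfun_pz p).
  rewrite -(ltr_pXn2r (n := 2)) ?nnegrE//; last 2 first.
  - by apply: RI_ge0 => x; exact: normc_ge0.
  - exact: ltW.
  exact: le_lt_trans (RI_normc_le bd.1 (bounded_cfun_Int_sq bd)) hp.
- move=> x; apply: le_trans (uc x).
  by rewrite expr2 normcM -expr2 sqr_normc ler_wpM2l ?sq_ge0// lerDr.
have b1 := bounded_cfunB bu (bounded_cfun_cst 1).
have I1 := bounded_cfun_Int_sq b1; have I2 := bounded_cfun_Int_normc b1.
apply: (@le_trans _ _ (\int[m]_x (sq (u x - 1) + 2 * normc (u x - 1)))).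
  apply: RI_le.
  - by apply: bounded_cfun_Int_normc; apply: bounded_cfunB;
    [exact: bounded_cfunX|exact: bounded_cfun_cst].
  - by apply: IntD => //; exact: IntZ.
  move=> x; have -> : u x ^+ 2 - 1 = (u x - 1) * (u x - 1) + 2 * (u x - 1)
    by ring.
  rewrite (le_trans (normcD _ _))// !normcM -expr2 sqr_normc lerD2l.
  rewrite ler_wpM2r ?normc_ge0// (_ : 2 = (2 : R)%:C) ?normc_real ?ger0_norm//.
  by rewrite rmorph_nat.
have I3 := IntZ 2 I2.
rewrite RID// RIZ// lerD// ler_wpM2l//.
rewrite -(ler_pXn2r (n := 2)) ?nnegrE ?sqrtr_ge0//; last first.
  by apply: RI_ge0 => x; exact: normc_ge0.
rewrite sqr_sqrtr; last by apply: RI_ge0.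
exact: le_trans (RI_normc_le b1.1 I1) u1.
Qed.

End outer_multiplier.

(** * Gauge norms *)

Section Lebesgue_spaces.
Variable R : realType.
Local Notation T := (circle R).
Local Notation m := (haar R).
Local Notation Int f := (m.-integrable [set: T] (EFin \o f)).
Implicit Types f g : T -> R[i].

Lemma LinftyP f : Lp +oo f <->
  measurable_fun setT f /\ exists2 c, 0 <= c & {ae m, forall x,
    normc (f x) <= c}.
Proof.
have mT : (0 < m [set: T])%E by rewrite [X in (_ < X)%E]probability_setT.
split=> [[mf]|[mf [c c0 fc]]]; last first.
  split => //; rewrite /finite_norm Lnorm.unlock mT.
  apply: (@le_lt_trans _ _ c%:E); last exact: ltry.
  apply/ess_supP; apply: filterS fc => x fx /=.
  by rewrite lee_fin ger0_norm ?normc_ge0.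
rewrite /finite_norm Lnorm.unlock mT => h; split => //.
have g0 : (0 <= ess_sup m (abse \o (EFin \o ((@normc R) \o f))))%E.
  by apply: ess_sup_gee => //; apply: nearW => x /=; rewrite lee_fin.
have := ess_sup_ge m (abse \o (EFin \o ((@normc R) \o f))).
move: g0 h; case: (ess_sup _ _) => // c; rewrite lee_fin => c0 _ hc.
exists c => //; apply: filterS hc => x /=.
by rewrite lee_fin ger0_norm ?normc_ge0.
Qed.

Lemma bounded_cfun_Linfty f : bounded_cfun f -> Lp +oo f.
Proof.
move=> [mf [c fc]]; apply/LinftyP; split => //; exists c; last exact: nearW.
exact: le_trans (normc_ge0 _) (fc (expi 0)).
Qed.

Lemma Linfty_lin a f g : Lp +oo f -> Lp +oo g -> Lp +oo (fun x => a * f x +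
  g x).
Proof.
move=> /LinftyP[mf [c c0 fc]] /LinftyP[mg [e e0 ge]]; apply/LinftyP; split.
  by apply: measurable_cD => //; exact: measurable_cM.
exists (normc a * c + e); first by rewrite addr_ge0// mulr_ge0 ?normc_ge0.
apply: filterS2 fc ge => x fx gx.
by rewrite (le_trans (normcD _ _))// lerD// normcM ler_wpM2l ?normc_ge0.
Qed.

Lemma Linfty_sub f g : Lp +oo f -> Lp +oo g -> Lp +oo (fun x => f x - g x).
Proof.
move=> Lf Lg; have := Linfty_lin (-1) Lg Lf.
by under eq_fun do rewrite mulN1r addrC.
Qed.

Lemma Linfty_mul f g : bounded_cfun f -> Lp +oo g ->
  Lp +oo (fun x => f x * g x).
Proof.
move=> [mf [c fc]] /LinftyP[mg [e e0 ge]]; apply/LinftyP; split.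
  exact: measurable_cM.
have c0 : 0 <= c := le_trans (normc_ge0 _) (fc (expi 0)).
exists (c * e); first by rewrite mulr_ge0.
by apply: filterS ge => x gx; rewrite normcM ler_pM ?normc_ge0.
Qed.

Lemma Linfty_Int f : Lp +oo f -> Int (fun x => normc (f x)).
Proof.
move=> /LinftyP[mf [c c0 fc]]; apply: Int_le_ae (Int_cst m c) _.
  exact: measurable_normc.
by apply: filterS fc => x; rewrite ger0_norm ?normc_ge0.
Qed.

Lemma L1P f : Lp 1 f <->
  measurable_fun setT f /\ Int (fun x => normc (f x)).
Proof.
rewrite /Lp /= /finite_norm Lnorm1.
split=> [[mf h]|[mf /integrableP[_ h]]]; split => //.
by apply/integrableP; split => //; apply/measurable_EFinP;
  exact: measurable_normc.
Qed.

End Lebesgue_spaces.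

Section gauge.
Variable R : realType.
Local Notation T := (circle R).
Local Notation m := (haar R).
Local Notation Int f := (m.-integrable [set: T] (EFin \o f)).
Variable alpha : (T -> R[i]) -> R.
Hypothesis halpha : dominating_normalized_gauge_norm alpha.
Implicit Types f g : T -> R[i].
Local Notation ext := (gauge_ext alpha).

Lemma bounded_rfun_Linfty (s : T -> R) : bounded_rfun s ->
  Lp +oo (fun x => (s x)%:C).
Proof.
move=> [ms [c sc]]; apply: bounded_cfun_Linfty; split.
  exact: measurable_real_complex.
by exists c => x; rewrite normc_real.
Qed.

(** It is enough to know alpha on nonnegative functions, as alpha f = alpha |f|. *)
Definition ralpha (s : T -> R) := alpha (fun x => (s x)%:C).

Lemma alpha_ge0 f : Lp +oo f -> 0 <= alpha f.
Proof.
move=> Lf; rewrite -lee_fin (le_trans _ (gauge_dominating halpha Lf))//.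
exact: Lnorm_ge0.
Qed.

Lemma ralphaZ k (s : T -> R) : bounded_rfun s -> 0 <= k ->
  ralpha (fun x => k * s x) = k * ralpha s.
Proof.
move=> bs k0; rewrite /ralpha.
under [X in alpha X]eq_fun do rewrite rmorphM.
by rewrite (gauge_scale halpha _ (bounded_rfun_Linfty bs)) normc_real ger0_norm.
Qed.

Lemma ralphaD (s t : T -> R) : bounded_rfun s -> bounded_rfun t ->
  ralpha (fun x => s x + t x) <= ralpha s + ralpha t.
Proof.
move=> bs bt; rewrite /ralpha.
under [X in alpha X]eq_fun do rewrite rmorphD.
exact: gauge_triangle halpha _ _ (bounded_rfun_Linfty bs) (bounded_rfun_Linfty bt).
Qed.

(** s is the mean of the two functions s +- i (t^2 - s^2)^(1/2), whose modulus
    is t. *)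
Lemma ralpha_le (s t : T -> R) : bounded_rfun s -> bounded_rfun t ->
  (forall x, 0 <= s x <= t x) ->
  ralpha s <= ralpha t.
Proof.
move=> bs bt st; have [ms _] := bs; have [mt [c tc]] := bt.
have t0 x : 0 <= t x by have /andP[/le_trans h /h] := st x.
pose v x := Num.sqrt (t x ^+ 2 - s x ^+ 2).
have mv : measurable_fun setT v.
  have msq : measurable_fun [set: R] (@Num.sqrt R).
    by apply: continuous_measurable_fun; exact: sqrt_continuous.
  apply: (measurableT_comp msq).
  by apply: measurable_funB; exact: measurable_funX.
have v2 x : v x ^+ 2 = t x ^+ 2 - s x ^+ 2.
  have /andP[s0 sx] := st x.
  by rewrite sqr_sqrtr// subr_ge0 ler_pXn2r// nnegrE.
pose g (e : R) x := (s x +i* (e * v x)) : R[i].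
have gN e x : e ^+ 2 = 1 -> normc (g e x) = t x.
  move=> e1; rewrite normcE /sq /= exprMn e1 mul1r v2 addrC subrK.
  by rewrite sqrtr_sqr ger0_norm.
have Lg e : e ^+ 2 = 1 -> Lp +oo (g e).
  move=> e1; apply: bounded_cfun_Linfty; split.
    by apply: measurable_ReIm => //=; exact: measurable_funM.
  by exists c => x; rewrite gN// (le_trans (ler_norm _)).
have ag e : e ^+ 2 = 1 -> alpha (g e) = ralpha t.
  move=> e1; rewrite -(gauge_abs halpha (Lg e e1)) /ralpha.
  by congr alpha; apply/funext => x; rewrite gN.
have h1 : (1 : R) ^+ 2 = 1 by rewrite expr1n.
have hN1 : (-1 : R) ^+ 2 = 1 by rewrite sqrrN expr1n.
have half f : Lp +oo f -> Lp +oo (fun x => (2^-1 : R)%:C * f x).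
  by move=> Lf; apply: Linfty_mul => //; exact: bounded_cfun_cst.
have -> : ralpha s =
    alpha (fun x => (2^-1 : R)%:C * g 1 x + (2^-1 : R)%:C * g (-1) x).
  by congr alpha; apply/funext => x; apply: complex_ext; rewrite !reim/=; field.
apply: (le_trans (gauge_triangle halpha (half _ (Lg _ h1)) (half _ (Lg _ hN1)))).
rewrite !(gauge_scale halpha)//; [|exact: Lg|exact: Lg].
have h2 : 2^-1 + 2^-1 = 1 :> R by field.
by rewrite !ag// normc_real ger0_norm// -mulrDl h2 mul1r.
Qed.

Lemma ralpha_le_ae (s t : T -> R) : bounded_rfun s -> bounded_rfun t ->
  (forall x, 0 <= s x) ->
  (forall x, 0 <= t x) -> {ae m, forall x, s x <= t x} -> ralpha s <= ralpha t.
Proof.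
move=> bs bt s0 t0 st; have [ms [c sc]] := bs; have [mt [e te]] := bt.
pose p x := Num.min (s x) (t x).
have bp : bounded_rfun p.
  split; first exact: measurable_minr.
  by exists c => x; rewrite /p /Num.min; case: ifP => // /negbT;
    rewrite -leNgt => h; rewrite ger0_norm// (le_trans h)// (le_trans (ler_norm _)).
have -> : ralpha s = ralpha p.
  apply: (gauge_ae halpha (bounded_rfun_Linfty bs) (bounded_rfun_Linfty bp)).
  by apply: filterS st => x sx _; rewrite /p min_l.
by apply: ralpha_le => // x; rewrite /p le_min s0 t0 ge_min lexx orbT.
Qed.

Lemma ralpha_cst c : 0 <= c -> ralpha (cst c) = c.
Proof.
move=> c0; have b1 : bounded_rfun (cst 1) by split => //; exists 1 => x;
  rewrite normr1.
rewrite -[RHS]mulr1 -(gauge_one halpha) -[X in alpha X]/(fun=> (1 : R)%:C).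
rewrite -[alpha _]/(ralpha (cst 1)) -ralphaZ//.
by congr alpha; apply/funext => x /=; rewrite mulr1.
Qed.

Lemma bounded_nnsfun (s : {nnsfun T >-> R}) : bounded_rfun s.
Proof.
split => //; have [M [_ /= bM]] := simple_bounded s; exists (`|M| + 1) => x.
by apply: bM => //; rewrite (le_lt_trans (ler_norm M))// ltrDl.
Qed.

Lemma ext_ge0 f : (0 <= ext f)%E.
Proof.
apply: ereal_sup_ubound; exists (nnsfun0 : {nnsfun T >-> R}).
  by apply: nearW => x /=; exact: normc_ge0.
congr EFin; rewrite -[LHS]/(ralpha (cst 0)) ralpha_cst//.
Qed.

Lemma ext_scale k f g : 0 < k ->
  {ae m, forall x, normc (f x) <= k * normc (g x)} ->
  (ext f <= k%:E * ext g)%E.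
Proof.
move=> k0 fg; apply: ge_ereal_sup => _ [s sf <-].
have ki0 : 0 <= k^-1 by rewrite invr_ge0 ltW.
pose s' : {nnsfun T >-> R} := scale_nnsfun s ki0.
have -> : alpha (fun w => (s w)%:C) = k * ralpha s'.
  rewrite -(ralphaZ (bounded_nnsfun _) (ltW k0)).
  congr alpha; apply/funext => x; congr (_%:C) => /=.
  by rewrite mulrA mulfV ?mul1r// gt_eqF.
rewrite EFinM lee_wpmul2l ?lee_fin ?(ltW k0)//.
apply: ereal_sup_ubound; exists s' => //.
apply: filterS2 sf fg => x sx fx /=.
by rewrite ler_pdivrMl// (le_trans sx).
Qed.

(** alpha dominates the mean of every simple function below |f|. *)
Lemma ext_ge_RI f : measurable_fun setT f ->
  (\int[m]_x (normc (f x))%:E <= ext f)%E.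
Proof.
move=> mf; rewrite ge0_integralTE; last by move=> x; rewrite lee_fin normc_ge0.
apply: ge_ereal_sup => _ [s /= sf <-].
apply: (@le_trans _ _ (alpha (fun w => (s w)%:C))%:E); last first.
  apply: ereal_sup_ubound; exists s => //.
  by apply: nearW => x; have := sf x; rewrite lee_fin.
apply: le_trans (gauge_dominating halpha (bounded_rfun_Linfty (bounded_nnsfun s))).
have mns : measurable_fun setT (fun x => `|normc (s x)%:C|).
  apply: measurableT_comp => //; apply: measurable_normc.
  exact: measurable_real_complex.
rewrite Lnorm1 -integralT_nnsfun; apply: ge0_le_integral => //=.
- by move=> x _; rewrite lee_fin.
- by apply/measurable_EFinP.
- by apply/measurable_EFinP; exact: mns.
- by move=> x _; rewrite lee_fin expr0n addr0 sqrtr_sqr normr_id ler_norm.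
Qed.

(** A simple function below |f| + |g| is at most 2|f| on one set and at most
    2|g| on the complement. *)
Lemma ext_add_le f g : measurable_fun setT f -> measurable_fun setT g ->
  (ext (fun x => f x + g x)%R <= 2%:E * (ext f + ext g))%E.
Proof.
move=> mf mg; apply: ge_ereal_sup => _ [s /= sfg <-].
have mnf := measurable_normc mf; have mng := measurable_normc mg.
pose F := [set x | normc (g x) <= normc (f x)].
have mF : measurable F.
  by rewrite -[F]setTI; apply: measurable_fun_le.
have mFC : measurable (~` F) by exact: measurableC.
have h0 : (0 : R) <= 2^-1 by rewrite invr_ge0.
pose s1 : {nnsfun T >-> R} := scale_nnsfun (proj_nnsfun s mF) h0.
pose s2 : {nnsfun T >-> R} := scale_nnsfun (proj_nnsfun s mFC) h0.
have sE x : s x = 2 * s1 x + 2 * s2 x.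
  rewrite /= !mindicE in_setC !mulrA mulfV// !mul1r -mulrDr.
  by case: (_ \in _) => /=; rewrite ?addr0 ?add0r mulr1.
have -> : alpha (fun w => (s w)%:C) = ralpha (fun x => 2 * s1 x + 2 * s2 x).
  by congr alpha; apply/funext => x; rewrite -sE.
have b2 (t : {nnsfun T >-> R}) : bounded_rfun (fun x => 2 * t x).
  have [mt [c tc]] := bounded_nnsfun t; split; first exact: measurable_funM.
  by exists (2 * c) => x; rewrite normrM ger0_norm// ler_wpM2l.
apply: (@le_trans _ _ (2 * ralpha s1 + 2 * ralpha s2)%:E).
  rewrite lee_fin -!ralphaZ//; [|exact: bounded_nnsfun|exact: bounded_nnsfun].
  exact: ralphaD.
rewrite -mulrDr EFinM lee_wpmul2l// EFinD leeD//.
- apply: ereal_sup_ubound; exists s1 => //.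
  apply: filterS sfg => x sx /=; rewrite mindicE.
  have [Fx|Fx] := pselect (F x); last first.
    by rewrite memNset//= !mulr0 normc_ge0.
  rewrite mem_set//= mulr1 ler_pdivrMl// (le_trans sx)//.
  by rewrite (le_trans (normcD _ _))// mulrDl mul1r lerD2l.
- apply: ereal_sup_ubound; exists s2 => //.
  apply: filterS sfg => x sx /=; rewrite mindicE.
  have [Fx|Fx] := pselect (F x).
    by rewrite in_setC mem_set//= !mulr0 normc_ge0.
  rewrite in_setC memNset//= mulr1 ler_pdivrMl// (le_trans sx)//.
  rewrite (le_trans (normcD _ _))// mulrDl mul1r lerD2r.
  by move/negP : Fx; rewrite -ltNge => /ltW.
Qed.

Lemma ext_bounded f c : 0 <= c -> {ae m, forall x, normc (f x) <= c} ->
  (ext f <= c%:E)%E.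
Proof.
move=> c0 fc; apply: ge_ereal_sup => _ [s /= sf <-].
rewrite lee_fin -[leRHS]ralpha_cst//; apply: ralpha_le_ae => //.
- exact: bounded_nnsfun.
- by split => //; exists c => x; rewrite ger0_norm.
- by apply: filterS2 sf fc => x; exact: le_trans.
Qed.

Hypothesis calpha : continuous_gauge alpha.

(** Null sets, which the continuity of alpha leaves out, have gauge 0. *)
Lemma ralpha_indic_small e : 0 < e -> exists2 d, 0 < d & forall E,
  measurable E -> (m E < d%:E)%E -> ralpha \1_E < e.
Proof.
move=> e0; have [d d0 hd] := calpha e0; exists d => // E mE Ed.
have [E0|E0] := eqVneq (m E) 0%E; last by apply: hd => //;
  rewrite lt0e E0 measure_ge0.
have bE : bounded_rfun (\1_E).
  split => //; exists 1 => x; rewrite indicE normr_nat.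
  by case: (_ \in _).
have -> : ralpha \1_E = ralpha (cst 0).
  apply: (gauge_ae halpha (bounded_rfun_Linfty bE)).
    by apply: bounded_rfun_Linfty; split => //; exists 0 => x; rewrite normr0.
  exists E; split => // x /= h; apply: contrapT => Ex; apply: h => _.
  by rewrite indicE memNset.
by rewrite ralpha_cst.
Qed.

(** |f| is at most e / 3 off a set where it is at most c, and whose measure is
    controlled by the Markov inequality. *)
Lemma ext_small_of_mean c e : 0 <= c -> 0 < e -> exists2 d, 0 < d &
  forall f, measurable_fun setT f -> {ae m, forall x, normc (f x) <= c} ->
    \int[m]_x normc (f x) < d -> (ext f < e%:E)%E.
Proof.
move=> c0 e0; have c1 : 0 < c + 1 by rewrite ltr_wpDl.
have e3 : 0 < e / 3 by rewrite divr_gt0.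
have [d0 d00 hd] := ralpha_indic_small (divr_gt0 e3 c1).
exists (e / 3 * d0); first by rewrite mulr_gt0.
move=> f mf fc fd; have mn := measurable_normc mf.
have If : Int (fun x => normc (f x)).
  apply: Int_le_ae (Int_cst m c) _ => //.
  by apply: filterS fc => x; rewrite ger0_norm ?normc_ge0.
pose E := [set x | e / 3 <= normc (f x)].
have mE : measurable E.
  by rewrite -[E]setTI; apply: measurable_fun_le => //; exact: measurable_cst.
have IE : Int (\1_E) by exact: integrable_indic.
have mEd : (m E < d0%:E)%E.
  have -> : m E = (\int[m]_x \1_E x)%:E.
    by rewrite -EFin_RI// integral_indic// setIT.
  rewrite lte_fin -(ltr_pM2l e3); apply: le_lt_trans fd.
  rewrite -RIZ//; apply: RI_le => //; first exact: IntZ.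
  move=> x; rewrite indicE; have [Ex|Ex] := pselect (E x).
    by rewrite mem_set// mulr1.
  by rewrite memNset// mulr0 normc_ge0.
have {}hd := hd E mE mEd.
have bE : bounded_rfun (\1_E).
  by split => //; exists 1 => x; rewrite indicE normr_nat; case: (_ \in _).
have bcE : bounded_rfun (fun x => c * \1_E x).
  split; first exact: measurable_funM.
  by exists c => x; rewrite ger0_norm ?mulr_ge0// -[leRHS]mulr1 ler_wpM2l// indicE; case: (_ \in _).
have be : bounded_rfun (cst (e / 3)).
  by split => //; exists (e / 3) => x; rewrite ger0_norm// ltW.
apply: (@le_lt_trans _ _ (e / 3 + c * ralpha \1_E)%:E); last first.
  rewrite lte_fin; apply: (@le_lt_trans _ _ (e / 3 + e / 3)).
    rewrite lerD2l; apply: (@le_trans _ _ ((c + 1) * (e / 3 / (c + 1)))).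
      apply: ler_pM => //; [exact/alpha_ge0/bounded_rfun_Linfty|by rewrite lerDl|exact: ltW].
    by rewrite mulrC divfK// gt_eqF.
  by rewrite -subr_gt0 (_ : _ - _ = e / 3)//; field.
apply: ge_ereal_sup => _ [s /= sf <-]; rewrite lee_fin.
rewrite -(ralphaZ bE c0) -[X in _ <= X + _](ralpha_cst (ltW e3)).
apply: le_trans (ralphaD be bcE).
apply: ralpha_le_ae => //.
- exact: bounded_nnsfun.
- split; first by apply: measurable_funD => //; exact: bcE.1.
  have [_ [a ha]] := be; have [_ [b hb]] := bcE.
  by exists (a + b) => x; rewrite (le_trans (ler_normD _ _))// lerD.
- by move=> x; rewrite addr_ge0 ?mulr_ge0// ltW.
apply: filterS2 sf fc => x sx fx; rewrite indicE /=.
have [Ex|Ex] := pselect (E x).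
  by rewrite mem_set// mulr1 (le_trans sx)// (le_trans fx)// lerDr ltW.
rewrite memNset// mulr0 addr0 (le_trans sx)//.
by move/negP : Ex; rewrite -ltNge => /ltW.
Qed.

End gauge.

(** * The weak* topology *)

Section weakstar.
Variable R : realType.
Local Notation T := (circle R).
Local Notation m := (haar R).
Local Notation Int f := (m.-integrable [set: T] (EFin \o f)).
Local Notation CI := (@complex_integral R).
Implicit Types f g : T -> R[i].

Lemma Int_Re f : measurable_fun setT f -> Int (fun x => normc (f x)) ->
  Int (fun x => Re (f x)).
Proof.
move=> mf; apply: Int_le; first exact: measurable_RE.
by move=> x; exact: Re_le_normc.
Qed.

Lemma Int_Im f : measurable_fun setT f -> Int (fun x => normc (f x)) ->
  Int (fun x => Im (f x)).
Proof.
move=> mf; apply: Int_le; first exact: measurable_IM.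
by move=> x; exact: Im_le_normc.
Qed.

Lemma CI_dist f g : measurable_fun setT f -> measurable_fun setT g ->
  Int (fun x => normc (f x)) -> Int (fun x => normc (g x)) ->
  normc (CI f - CI g) <= 2 * \int[m]_x normc (f x - g x).
Proof.
move=> mf mg If Ig.
have mfg := measurable_cB mf mg.
have Ifg : Int (fun x => normc (f x - g x)).
  apply: Int_le (IntD If Ig); first exact: measurable_normc.
  move=> x; rewrite ger0_norm ?normc_ge0// (le_trans (normcD _ _))//.
  by rewrite normcN.
have I1 := Int_Re mf If; have I2 := Int_Re mg Ig.
have I3 := Int_Im mf If; have I4 := Int_Im mg Ig.
rewrite (le_trans (normc_le_ReIm _))// !reim !(Re_CI, Im_CI) -!RIB//.
rewrite mulr_natl mulr2n; apply: lerD.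
- rewrite (le_trans (le_normr_Rintegral _ _))//; first exact: IntB.
  apply: RI_le => //; first exact/Int_abs/IntB.
  by move=> x; have := Re_le_normc (f x - g x); rewrite !reim.
- rewrite (le_trans (le_normr_Rintegral _ _))//; first exact: IntB.
  apply: RI_le => //; first exact/Int_abs/IntB.
  by move=> x; have := Im_le_normc (f x - g x); rewrite !reim.
Qed.

(** By dominated convergence. *)
Lemma L1_tail (g : T -> R) e : Int g -> (forall x, 0 <= g x) -> 0 < e ->
  exists n : nat, \int[m]_x (g x * \1_[set x | n%:R <= g x] x) < e.
Proof.
move=> Ig g0 e0; have mg := Int_meas Ig.
have mE n : measurable [set x : T | (n%:R : R) <= g x].
  by rewrite -[X in measurable X]setTI; apply: measurable_fun_le => //;
    exact: measurable_cst.
have : \int[m]_x (g x * \1_[set x | n%:R <= g x] x) @[n --> \oo] -->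
    \int[m]_(x in setT) (0 : R).
  apply: RI_dominated Ig _.
  - by move=> n; apply: measurable_funM => //; exact: measurable_indic.
  - move=> x; apply: cvg_near_cst; exists (Num.truncn (g x)).+1 => // n /= xn.
    rewrite indicE memNset ?mulr0//= => h.
    have := truncnS_gt (g x); rewrite ltNge => /negP; apply.
    by rewrite (le_trans _ h)// ler_nat.
  - move=> n x; rewrite indicE; case: (_ \in _) => /=.
      by rewrite mulr1 ger0_norm.
    by rewrite mulr0 normr0.
rewrite RI_cst => /cvgrPdist_lt/(_ e e0)[n _ /(_ n (leqnn n))].
by rewrite sub0r normrN ltr_norml => /andP[_ h]; exists n.
Qed.

(** |f g| <= n |f| + c |g| 1_(|g| >= n), and the tail of g is small in mean. *)
Lemma mul_small_mean g c e : measurable_fun setT g ->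
  Int (fun x => normc (g x)) -> 0 <= c -> 0 < e -> exists2 d, 0 < d &
  forall f, measurable_fun setT f -> {ae m, forall x, normc (f x) <= c} ->
    \int[m]_x normc (f x) < d -> \int[m]_x normc (f x * g x) < e.
Proof.
move=> mg Ig c0 e0.
have c1 : 0 < 2 * (c + 1) by rewrite mulr_gt0// ltr_wpDl.
have [n hn] := L1_tail Ig (fun x => normc_ge0 _) (divr_gt0 e0 c1).
have n1 : (0 : R) < 2 * (n%:R + 1) by rewrite mulr_gt0// ltr_wpDl.
exists (e / (2 * (n%:R + 1))); first by rewrite divr_gt0.
move=> f mf fc fd.
pose E := [set x : T | n%:R <= normc (g x)].
have mE : measurable E.
  rewrite -[E]setTI; apply: measurable_fun_le => //.
  exact: measurable_normc.
have mnf := measurable_normc mf; have mng := measurable_normc mg.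
have If : Int (fun x => normc (f x)).
  apply: Int_le_ae (Int_cst m c) _ => //.
  by apply: filterS fc => x; rewrite ger0_norm ?normc_ge0.
have IgE : Int (fun x => normc (g x) * \1_E x).
  apply: Int_le Ig; first by apply: measurable_funM => //;
    exact: measurable_indic.
  move=> x; rewrite indicE; case: (_ \in _) => /=.
    by rewrite mulr1 ger0_norm ?normc_ge0.
  by rewrite mulr0 normr0 normc_ge0.
have I1 := IntZ n%:R If; have I2 := IntZ c IgE.
have Ifg : Int (fun x => normc (f x * g x)).
  apply: Int_le_ae (IntZ c Ig) _; first by apply: measurable_normc;
    exact: measurable_cM.
  apply: filterS fc => x fx; rewrite ger0_norm ?normc_ge0// normcM.
  by rewrite ler_wpM2r ?normc_ge0.
apply: (@le_lt_trans _ _ (\int[m]_x (n%:R * normc (f x) +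
  c * (normc (g x) * \1_E x)))).
  apply: RI_le_ae => //; first exact: IntD.
  apply: filterS fc => x fx; rewrite normcM indicE.
  have [Ex|Ex] := pselect (E x).
    rewrite mem_set// mulr1 ler_wpDl ?mulr_ge0 ?normc_ge0//.
    by rewrite ler_wpM2r ?normc_ge0.
  rewrite memNset// !mulr0 addr0 mulrC ler_wpM2r ?normc_ge0//.
  by move/negP : Ex; rewrite -ltNge => /ltW.
rewrite RID// !RIZ//.
have J0 : 0 <= \int[m]_x normc (f x) by apply: RI_ge0 => x; exact: normc_ge0.
have K0 : 0 <= \int[m]_x (normc (g x) * \1_E x).
  by apply: RI_ge0 => x; rewrite mulr_ge0 ?normc_ge0.
move: fd hn J0 K0; rewrite -/E !ltr_pdivlMr//.
move: (\int[m]_x normc (f x)) (\int[m]_x (normc (g x) * \1_E x)) => J K.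
have : (0 : R) <= n%:R by [].
by move: (n%:R) => N N0 h1 h2 J0 K0; clear -N0 h1 h2 J0 K0 c0; lra.
Qed.

Lemma Int_pairing f g : Lp +oo f -> Lp 1 g ->
  measurable_fun setT (fun x => f x * g x) /\ Int (fun x => normc (f x * g x)).
Proof.
move=> /LinftyP[mf [c c0 fc]] /L1P[mg Ig].
have mfg := measurable_cM mf mg; split => //.
apply: Int_le_ae (IntZ c Ig) _; first exact: measurable_normc.
apply: filterS fc => x fx; rewrite ger0_norm ?normc_ge0// normcM.
by rewrite ler_wpM2r ?normc_ge0.
Qed.

Lemma cvg_complex (v : nat -> R[i]) (l : R[i]) :
  (forall e : R, 0 < e -> \forall n \near \oo, normc (v n - l) < e) ->
  (v : nat -> R[i]^o) @ \oo --> (l : R[i]^o).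
Proof.
move=> h; apply/cvgrPdist_lt => e; rewrite ltcE /= => /andP[/eqP ei er].
have := h _ er; apply: filterS => n hn; rewrite ltcE/= ei eqxx/=.
by rewrite normcB in hn; exact: hn.
Qed.

Lemma weakstar_cvg (v : nat -> Lp +oo) (f : Lp +oo) :
  (forall g : Lp 1, (fun n => pairing (v n) g) @ \oo --> pairing f g) ->
  (v : nat -> @weakstar_Linfty R) @ \oo --> (f : @weakstar_Linfty R).
Proof.
move=> h U /=; rewrite nbhsE => -[B [[A oA <-] Af] BU].
have : (fun n => pairing (v n)) @ \oo --> pairing f.
  apply/cvg_sup => g V [W] [[D] oD <-] Dfg DV.
  apply: (filterS DV); apply: (h g).
  by rewrite nbhsE; exists D.
move=> /(_ A); rewrite nbhsE => /(_ _)/wrap[|hA]; first by exists A.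
apply: (@filterS _ \oo _ (fun n => A (pairing (v n)))) => [n An|].
  exact: BU.
exact: hA.
Qed.

Lemma pairing_continuous (g : Lp 1) :
  continuous ((fun f : Lp +oo => pairing f g) : @weakstar_Linfty R -> R[i]^o).
Proof.
move=> f; have pf := @initial_continuous _ _ (@pairing R) f.
have /cvg_sup/(_ g) : nbhs (pairing f) --> pairing f by apply: cvg_id.
move=> h A /= Ag; pose ev (k : prod_topology (fun _ : Lp 1 => R[i]^o)) := k g.
apply: (pf (ev @^-1` A)); apply: h.
exact: (@initial_continuous _ _ (fun f : forall i, _ => f g) (pairing f) A Ag).
Qed.

(** By mul_small_mean, bounded convergence in mean implies weak* convergence. *)
Lemma weakstar_bounded_limit (S : set (T -> R[i])) f c : weakstar_closed S ->
  Lp +oo f -> 0 <= c ->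
  (forall e, 0 < e -> exists v, [/\ S v,
    {ae m, forall x, normc (v x - f x) <= c} &
    \int[m]_x normc (v x - f x) < e]) -> S f.
Proof.
move=> [SL cS] Lf c0 fa.
have /choice[v vP] : forall n : nat, exists v, [/\ S v,
    {ae m, forall x, normc (v x - f x) <= c} &
    \int[m]_x normc (v x - f x) < n.+1%:R^-1].
  by move=> n; apply: fa; rewrite invr_gt0.
have Sv n : S (v n) by case: (vP n).
pose F : Lp +oo := SigSub (mem_set Lf).
pose V n : Lp +oo := SigSub (mem_set (SL _ (Sv n))).
suff : (V : nat -> @weakstar_Linfty R) @ \oo --> (F : @weakstar_Linfty R).
  move=> cV; apply: (@closed_cvg _ _ _ _ (V : nat -> @weakstar_Linfty R)
    ((@set_val _ (Lp +oo)) @^-1` S) cS _ F cV).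
  by apply: nearW => n /=; exact: Sv.
apply: weakstar_cvg => g; apply: cvg_complex => e e0.
have Lg : Lp 1 (set_val g) by exact: set_valP.
have [mg Ig] := (L1P _).1 Lg.
have e20 : 0 < e / 2 by rewrite divr_gt0.
have [d d0 hd] := mul_small_mean mg Ig c0 e20.
near=> n; have [_ vc vd] := vP n.
have [m1 I1] := Int_pairing (SL _ (Sv n)) Lg.
have [m2 I2] := Int_pairing Lf Lg.
rewrite /pairing; apply: le_lt_trans (CI_dist m1 m2 I1 I2) _.
rewrite mulrC -ltr_pdivlMr//.
under eq_Rintegral do rewrite -mulrBl.
apply: hd => //.
  by apply: measurable_cB; [exact: (SL _ (Sv n)).1|exact: Lf.1].
apply: lt_trans vd _; near: n.
exists (Num.truncn d^-1) => // n /= dn.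
rewrite invf_plt ?posrE// (lt_le_trans (truncnS_gt _))// ler_nat.
by rewrite ltnS.
Unshelve. all: by end_near. Qed.

(** The kernel of the pairing with g is weak*-closed. *)
Lemma weakstar_closure_annihilator (S : set (T -> R[i])) (f : Lp +oo) g :
  Lp 1 g -> S `<=` Lp +oo ->
  closure ((@set_val _ (Lp +oo)) @^-1` S : set (@weakstar_Linfty R)) f ->
  (forall v, S v -> CI (fun x => v x * g x) = 0) ->
  CI (fun x => set_val f x * g x) = 0.
Proof.
move=> Lg SL fS gS; pose G : Lp 1 := SigSub (mem_set Lg).
have : (closure ((@set_val _ (Lp +oo)) @^-1` S : set (@weakstar_Linfty R)) `<=`
    ((fun f : Lp +oo => pairing f G) : @weakstar_Linfty R ->
      R[i]^o) @^-1` [set 0]).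
  rewrite closureE; apply: smallest_sub.
    apply: preimage_closed; last by apply: accessible_closed_set1;
      apply: hausdorff_accessible; exact: norm_hausdorff.
    by move=> h _; exact: pairing_continuous.
  by move=> h /= Sh; exact: gS.
by move=> /(_ f fS).
Qed.

End weakstar.

(** * Closed invariant subspaces *)

Section invariant_subspaces.
Variable R : realType.
Local Notation T := (circle R).
Local Notation m := (haar R).
Local Notation Int f := (m.-integrable [set: T] (EFin \o f)).
Local Notation CI := (@complex_integral R).
Implicit Types (f g v phi : T -> R[i]) (S : set (T -> R[i])).

(** The common feature of weak*-closed subspaces and of the bounded parts of
    alpha-closed ones: closure under limits in mean with a uniform bound. *)
Definition bounded_closed S := S `<=` Lp +oo /\
  forall f c, Lp +oo f -> 0 <= c ->
    (forall e, 0 < e -> exists v, [/\ S v,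
      {ae m, forall x, normc (v x - f x) <= c} &
      \int[m]_x normc (v x - f x) < e]) -> S f.

Lemma pz_mul_invariant S p f : linear_subspace S -> z_invariant S -> S f ->
  S (fun x => pz p x * f x).
Proof.
move=> [S0 Sl] zS Sf; elim/poly_ind: p => [|p c ih].
  rewrite (_ : (fun x => _) = cst 0)//.
  by apply/funext => x; rewrite /pz horner0 mul0r.
rewrite (_ : (fun x => _) = fun x => c * f x + mulz (fun y => pz p y * f y) x).
  by apply: Sl => //; exact: zS.
by apply/funext => x; rewrite /mulz /pz !hornerE /=; ring.
Qed.

Lemma bounded_poly_limit_bounded_cfun phi c : bounded_poly_limit phi c ->
  bounded_cfun phi.
Proof. by move=> [mp pc _]; split => //; exists c. Qed.

Lemma bounded_poly_limit_ge0 (phi : T -> R[i]) c : bounded_poly_limit phi c ->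
  0 <= c.
Proof. by move=> [_ /(_ (expi 0)) h _]; exact: le_trans (normc_ge0 _) h. Qed.

Lemma bounded_poly_limit_mul_invariant S phi c f : linear_subspace S ->
  z_invariant S -> bounded_closed S -> bounded_poly_limit phi c -> S f ->
  S (fun x => phi x * f x).
Proof.
move=> lS zS [SL cS] hphi Sf; have [mphi phic phia] := hphi.
have c0 := bounded_poly_limit_ge0 hphi; have bphi :=
  bounded_poly_limit_bounded_cfun hphi.
have Lf := SL _ Sf; have /LinftyP[mf [b b0 fb]] := Lf.
apply: (cS _ (2 * c * b)); first exact: Linfty_mul.
  by rewrite !mulr_ge0.
move=> e e0; have b1 : 0 < b + 1 by rewrite ltr_wpDl.
have [p pc hp] := phia _ (divr_gt0 e0 b1).
exists (fun x => pz p x * f x); split.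
- exact: pz_mul_invariant.
- apply: filterS fb => x fx; rewrite -mulrBl normcM.
  apply: ler_pM; rewrite ?normc_ge0// (le_trans (normcD _ _))// normcN.
  by rewrite mulr_natl mulr2n lerD.
have bd := bounded_cfunB bphi (bounded_cfun_pz p); have Id :=
  bounded_cfun_Int_normc bd.
rewrite ltr_pdivlMr// mulrC -RIZ// in hp; apply: le_lt_trans hp.
apply: RI_le_ae.
- under [EFin \o _]eq_fun do rewrite /= -mulrBl.
  by apply/Linfty_Int/Linfty_mul => //;
    exact: bounded_cfunB (bounded_cfun_pz p) bphi.
- exact: IntZ.
apply: filterS fb => x fx; rewrite -mulrBl normcM mulrC normcB.
by rewrite ler_wpM2r ?normc_ge0// (le_trans fx)// lerDl.
Qed.

(** For v in S close to f in mean, the multiplier phi attached to |v - f| makes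
    v - f bounded and hardly changes f, and phi v remains in S. *)
Lemma mean_closure S f : linear_subspace S -> z_invariant S ->
  bounded_closed S -> Lp +oo f ->
  (forall e, 0 < e -> exists2 v, S v & \int[m]_x normc (v x - f x) < e) -> S f.
Proof.
move=> lS zS bS Lf fa; have [SL cS] := bS.
have /LinftyP[mf [b b0 fb]] := Lf.
apply: (cS _ (2 + 3 * b)) => //; first by rewrite addr_ge0 ?mulr_ge0.
move=> e e0; pose t := e / (e + 2 + 3 * b).
have den0 : 0 < e + 2 + 3 * b by rewrite ltr_wpDr ?mulr_ge0// addr_gt0.
have t0 : 0 < t by rewrite divr_gt0.
have t1 : t <= 1.
  by rewrite ler_pdivrMr// mul1r -addrA lerDl addr_ge0 ?mulr_ge0.
have te : (2 + 3 * b) * t < e.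
  rewrite /t mulrA ltr_pdivrMr// [ltLHS]mulrC ltr_pM2l//.
  by lra.
have t20 : 0 < t ^+ 2 by rewrite exprn_gt0.
have [v Sv hv] := fa _ t20.
have Ld := Linfty_sub (SL _ Sv) Lf.
have Ih := Linfty_Int Ld; have mh := measurable_normc Ld.1.
have [phi [c [/andP[c0 c1] hphi phih phi1]]] :=
  outer_multiplier mh (fun x => normc_ge0 _) Ih.
set J := \int[m]_x normc (v x - f x) in hv c1 phi1.
have J0 : 0 <= J by apply: RI_ge0 => x; exact: normc_ge0.
have J1 : J <= 1 by rewrite (le_trans (ltW hv))// expr_le1// ltW.
have c2 : c <= 2 by rewrite (le_trans c1)// -[leRHS]/(1 + 1) lerD2l.
have sJ : Num.sqrt J <= t.
  rewrite -(ger0_norm (ltW t0)) -sqrtr_sqr ler_sqrt ?ltW//.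
have [mphi phic _] := hphi; have bphi := bounded_poly_limit_bounded_cfun hphi.
have bphi1 := bounded_cfunB bphi (bounded_cfun_cst 1).
have E x : phi x * v x - f x = phi x * (v x - f x) + (phi x - 1) * f x by ring.
exists (fun x => phi x * v x); split.
- exact: bounded_poly_limit_mul_invariant hphi Sv.
- apply: filterS fb => x fx; rewrite E (le_trans (normcD _ _))// !normcM.
  apply: lerD; first by rewrite (le_trans (phih x)).
  apply: ler_pM; rewrite ?normc_ge0// (le_trans (normcD _ _))// normcN normc1.
  by rewrite (le_trans (lerD (phic x) (lexx 1)))//; clear -c2; lra.
have I1 := IntZ 2 Ih; have I2 := IntZ b (bounded_cfun_Int_normc bphi1).
apply: (@le_lt_trans _ _ (\int[m]_x (2 * normc (v x - f x) +
  b * normc (phi x - 1)))).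
  apply: RI_le_ae.
  - by apply/Linfty_Int/Linfty_sub => //; apply: Linfty_mul => //; exact: SL.
  - exact: IntD.
  apply: filterS fb => x fx; rewrite E (le_trans (normcD _ _))// !normcM.
  apply: lerD.
    by rewrite ler_wpM2r ?normc_ge0// (le_trans (phic x)).
  by rewrite mulrC ler_wpM2r ?normc_ge0.
rewrite RID// !RIZ//; last exact: bounded_cfun_Int_normc.
apply: le_lt_trans te.
have JJ : J <= t by rewrite (le_trans (ltW hv))// expr2 ler_piMl// ltW.
have := le_trans phi1 (lerD JJ (ler_wpM2l (ler0n _ 2) sJ)).
rewrite -/J; move: (\int[m]_x _) => K hK.
have : b * K <= b * (t + 2 * t) by rewrite ler_wpM2l.
by clear -JJ; lra.
Qed.

Section gauge_spaces.
Variable alpha : (T -> R[i]) -> R.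
Hypothesis halpha : dominating_normalized_gauge_norm alpha.
Hypothesis calpha : continuous_gauge alpha.
Local Notation ext := (gauge_ext alpha).

(** The quasi-triangle inequality ext_add_le costs a factor 2, hence the
    quarters. *)
Lemma ext_lt_add f g (e : R) : measurable_fun setT f -> measurable_fun setT g ->
  (ext f < (e / 4)%:E)%E -> (ext g < (e / 4)%:E)%E ->
  (ext (fun x => f x + g x)%R < e%:E)%E.
Proof.
move=> mf mg fe ge; apply: le_lt_trans (ext_add_le halpha mf mg) _.
have := lteD fe ge; rewrite -EFinD => h.
have -> : (e%:E = 2%:E * (e / 4 + e / 4)%:E)%E.
  by rewrite -EFinM; congr EFin; field.
by rewrite lte_pmul2l.
Qed.

Lemma ext0 : ext (cst 0) = 0%E.
Proof.
apply/eqP; rewrite eq_le (ext_ge0 halpha) andbT.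
by apply: (ext_bounded halpha) => //; apply: nearW => x; rewrite normc0.
Qed.

Lemma Linfty_L_gauge f : Lp +oo f -> L_gauge alpha f.
Proof.
move=> Lf; have /LinftyP[mf [c c0 fc]] := Lf; split.
  by split => //; rewrite (le_lt_trans (ext_bounded halpha c0 fc))// ltry.
move=> e e0; exists f => //; under eq_fun do rewrite subrr.
by rewrite ext0.
Qed.

Lemma L_gauge_Int f : L_gauge alpha f -> Int (fun x => normc (f x)).
Proof.
move=> [[mf fy] _]; apply/integrableP; split.
  by apply/measurable_EFinP; exact: measurable_normc.
apply: le_lt_trans fy; apply: le_trans (ext_ge_RI halpha mf).
by apply: ge0_le_integral => //=;
  [apply/measurable_EFinP; apply: measurableT_comp => //;
    exact: measurable_normc
  |apply/measurable_EFinP; exact: measurable_normc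
  |move=> x _; rewrite lee_fin ger0_norm ?normc_ge0].
Qed.

Lemma ext_mul_le phi f c : 0 < c -> (forall x, normc (phi x) <= c) ->
  (ext (fun x => phi x * f x)%R <= c%:E * ext f)%E.
Proof.
move=> c0 pc; apply: (ext_scale halpha) => //; apply: nearW => x.
by rewrite normcM ler_wpM2r ?normc_ge0.
Qed.

(** Dominated convergence in gauge. *)
Lemma ext_mul_small f c e : L_gauge alpha f -> 0 <= c -> 0 < e ->
  exists2 d, 0 < d & forall psi, measurable_fun setT psi ->
    (forall x, normc (psi x) <= c) -> \int[m]_x normc (psi x) < d ->
    (ext (fun x => psi x * f x)%R < e%:E)%E.
Proof.
move=> [[mf _] fa] c0 e0; have c1 : 0 < c + 1 by rewrite ltr_wpDl.
have e4 : 0 < e / 4 by rewrite divr_gt0.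
have [g Lg fg] := fa _ (divr_gt0 e4 c1).
have /LinftyP[mg [b b0 gb]] := Lg.
have [d d0 hd] := ext_small_of_mean halpha calpha (mulr_ge0 c0 b0) e4.
have b1 : 0 < b + 1 by rewrite ltr_wpDl.
exists (d / (b + 1)); first by rewrite divr_gt0.
move=> psi mpsi psic psid.
have -> : (fun x => psi x * f x) = (fun x => psi x * g x + psi x * (f x - g x)).
  by apply/funext => x; ring.
have mpg := measurable_cM mpsi mg; have mfg := measurable_cB mf mg.
have bpsi : bounded_cfun psi by split => //; exists c.
apply: ext_lt_add => //; first exact: measurable_cM.
  apply: hd => //.
    by apply: filterS gb => x gx; rewrite normcM ler_pM ?normc_ge0.
  have Ip := bounded_cfun_Int_normc bpsi.
  rewrite ltr_pdivlMr// mulrC -RIZ// in psid; apply: le_lt_trans psid.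
  apply: RI_le_ae; [exact/Linfty_Int/Linfty_mul|exact: IntZ|].
  apply: filterS gb => x gx; rewrite normcM mulrC ler_wpM2r ?normc_ge0//.
  by rewrite (le_trans gx)// lerDl.
have pc1 x : normc (psi x) <= c + 1 by rewrite (le_trans (psic x))// lerDl.
apply: le_lt_trans (ext_mul_le _ c1 pc1) _.
have -> : ((e / 4)%:E = (c + 1)%:E * (e / 4 / (c + 1))%:E)%E.
  by rewrite -EFinM [in RHS]mulrC divfK// gt_eqF.
by rewrite lte_pmul2l.
Qed.

Lemma L_gauge_mul phi f : bounded_cfun phi -> L_gauge alpha f ->
  L_gauge alpha (fun x => phi x * f x).
Proof.
move=> [mphi [c0 phic0]] [[mf fy] fa]; pose c := `|c0| + 1.
have c1 : 0 < c by rewrite ltr_wpDl.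
have phic x : normc (phi x) <= c.
  by rewrite (le_trans (phic0 x))// (le_trans (ler_norm _))// lerDl.
split.
  split; first exact: measurable_cM.
  apply: le_lt_trans (ext_mul_le _ c1 phic) _.
  have := ext_ge0 halpha f; move: fy; case: (ext f) => // r _ _.
  by rewrite -EFinM ltry.
move=> e e0; have [g Lg fg] := fa _ (divr_gt0 e0 c1).
exists (fun x => phi x * g x).
  by apply: Linfty_mul => //; split => //; exists c.
under [fun w => _]eq_fun do rewrite -mulrBr.
apply: le_lt_trans (ext_mul_le _ c1 phic) _.
have -> : (e%:E = c%:E * (e / c)%:E)%E.
  by rewrite -EFinM [in RHS]mulrC divfK// gt_eqF.
by rewrite lte_pmul2l.
Qed.

(** The elements of W may be unbounded: dominated convergence in gauge replaces
    the uniform bound of bounded_poly_limit_mul_invariant. *)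
Lemma gauge_closed_mul W phi c f : linear_subspace W -> z_invariant W ->
  gauge_closed alpha W -> bounded_poly_limit phi c -> W f ->
    W (fun x => phi x * f x).
Proof.
move=> lW zW [WL cW] hphi Wf; have Lf := WL _ Wf.
have [mphi phic phia] := hphi; have bphi :=
  bounded_poly_limit_bounded_cfun hphi.
apply: cW; split; first exact: L_gauge_mul.
move=> e e0; have c0 := bounded_poly_limit_ge0 hphi.
have c20 : 0 <= c + c by rewrite addr_ge0.
have [d d0 hd] := ext_mul_small Lf c20 e0.
have [p pc hp] := phia _ d0; exists (fun x => pz p x * f x).
  exact: pz_mul_invariant.
under [fun w => _]eq_fun do rewrite -mulrBl.
apply: hd => //; first by apply: measurable_cB => //; exact: measurable_pz.
by move=> x; rewrite (le_trans (normcD _ _))// normcN lerD.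
Qed.

Lemma gauge_closed_bounded_limit W f c : gauge_closed alpha W ->
  Lp +oo f -> 0 <= c ->
  (forall e, 0 < e -> exists v, [/\ W v,
    {ae m, forall x, normc (v x - f x) <= c} &
    \int[m]_x normc (v x - f x) < e]) -> W f.
Proof.
move=> [WL cW] Lf c0 fa; apply: cW; split; first exact: Linfty_L_gauge.
move=> e e0; have [d d0 hd] := ext_small_of_mean halpha calpha c0 e0.
have [v [Wv vc vd]] := fa _ d0; exists v => //; apply: hd.
- by apply: measurable_cB; [exact: Lf.1|exact: (WL _ Wv).1.1].
- by apply: filterS vc => x; rewrite normcB.
- by under eq_Rintegral do rewrite normcB.
Qed.

End gauge_spaces.

Lemma weakstar_bounded_closed S : weakstar_closed S -> bounded_closed S.
Proof.
by move=> cS; split; [exact: cS.1|move=> f c; exact: weakstar_bounded_limit].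
Qed.

(** By orthogonal projection in L^2, the weak* closure of a subspace of
    L^oo is contained in its closure in mean. *)
Lemma weakstar_closure_mean S (F : Lp +oo) : linear_subspace S ->
  S `<=` Lp +oo ->
  closure ((@set_val _ (Lp +oo)) @^-1` S : set (@weakstar_Linfty R)) F ->
  forall e, 0 < e -> exists2 v, S v & \int[m]_x normc (v x - set_val F x) < e.
Proof.
move=> [S0 Sl] SL FS e e0; pose f : T -> R[i] := set_val F.
have Lf : Lp +oo f by exact: set_valP.
have w1 (x : T) : 1 <= (cst 1 x : R) by [].
have mw : measurable_fun [set: T] (cst (1 : R)) by [].
have L2 g : Lp +oo g -> L2w m (cst 1) g.
  move=> /LinftyP[mg [c c0 gc]]; split => //.
  apply: Int_le_ae (Int_cst m (c ^+ 2)) _.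
    by apply: measurable_funM => //; exact: measurable_sq.
  apply: filterS gc => x gx; rewrite mulr1 ger0_norm ?sq_ge0// -sqr_normc.
  by rewrite ler_pXn2r ?nnegrE ?normc_ge0.
have SL2 : S `<=` L2w m (cst 1) by move=> v /SL/L2.
have [r [Lr ro ra]] := orthogonal_projection mw w1 SL2 S0 (L2 _ Lf) Sl.
have [mr Isr'] := Lr.
have Isr : Int (fun x => sq (r x)).
  by move: Isr'; under [EFin \o _]eq_fun do rewrite /= mulr1.
have Lrc : Lp 1 (fun x => conjc (r x)).
  apply/L1P; split; first exact: measurable_conj.
  under [EFin \o _]eq_fun do rewrite /= normc_conj.
  apply: Int_of_sqr; first exact: measurable_normc.
  by under [EFin \o _]eq_fun do rewrite /= sqr_normc.
have ReE g : ip m (cst 1) r g = Re (CI (fun x => g x * conjc (r x))).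
  rewrite Re_CI; apply: eq_Rintegral => x _.
  by rewrite /dot !reim /=; ring.
have ImE g : ip m (cst 1) r (fun x => (0 -i* 1) * g x + cst 0 x) =
    Im (CI (fun x => g x * conjc (r x))).
  rewrite Im_CI; apply: eq_Rintegral => x _.
  by rewrite /dot !reim /=; ring.
have rf : ip m (cst 1) r f = 0.
  rewrite ReE (weakstar_closure_annihilator Lrc SL FS)// => v Sv.
  by apply: complex_ext; rewrite -?ReE -?ImE ro//; exact: Sl.
have e20 : 0 < (e / 2) ^+ 2 by rewrite exprn_gt0// divr_gt0.
(* f is orthogonal to r = f - proj f, hence r = 0 *)
have r0 : nsq m (cst 1) r = 0.
  have N0 : 0 <= nsq m (cst 1) r by apply: nsq_ge0.
  apply: (@le_eps_eq0 _ _ 1) => // d d0; rewrite mul1r.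
  have [v Sv hv] := ra _ d0.
  have Lv := SL2 _ Sv; have Lfv := L2w_sub mw w1 (L2 _ Lf) Lv.
  have Ld := L2w_sub mw w1 Lfv Lr.
  have E : ip m (cst 1) r (fun x => f x - v x - r x) = - nsq m (cst 1) r.
    have I1 := Int_dot mw w1 Lr (L2 _ Lf); have I2 := Int_dot mw w1 Lr Lv.
    have I3 := IntB I1 I2; have I4 := Lr.2.
    transitivity (\int[m]_x (dot (r x) (f x) * cst 1 x -
        dot (r x) (v x) * cst 1 x - sq (r x) * cst 1 x)).
      by apply: eq_Rintegral => x _; rewrite /dot /sq !reim /=; ring.
    rewrite RIB// RIB//.
    by rewrite -/(ip m (cst 1) r f) -/(ip m (cst 1) r v) rf ro// subrr sub0r.
  have := cauchy_schwarz mw w1 Lr Ld; rewrite E sqrrN expr2.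
  move: hv; move: (nsq _ _ _) N0 => N N0; set M := nsq _ _ _ => hv hN.
  have [->|Nn0] := eqVneq N 0; first exact: ltW.
  have Np : 0 < N by rewrite lt_neqAle eq_sym Nn0.
  by rewrite (ler_pM2l Np) in hN; exact: le_trans (ltW hv).
have [v Sv hv] := ra _ e20; exists v => //.
have Lfv := Linfty_sub (SL _ Sv) Lf.
have Id : Int (fun x => sq (v x - f x)).
  have := (L2 _ Lfv).2; by under [EFin \o _]eq_fun do rewrite /= mulr1.
have J0 : 0 <= \int[m]_x normc (v x - f x) by apply: RI_ge0 => x;
  exact: normc_ge0.
rewrite -(ltr_pXn2r (n := 2)) ?nnegrE ?(ltW e0)//.
apply: le_lt_trans (RI_normc_le Lfv.1 Id) _.
have Lfv2 := L2w_sub mw w1 (L2 _ Lf) (SL2 _ Sv).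
have Ld := L2w_sub mw w1 Lfv2 Lr.
have I1 := IntZ 2 Ld.2; have I2 := IntZ 2 Lr.2.
apply: (@le_lt_trans _ _ (2 * nsq m (cst 1) (fun x => f x - v x - r x) +
  2 * nsq m (cst 1) r)).
  have IA := Ld.2; have IB := Lr.2; rewrite /nsq -!RIZ// -RID//;
    apply: RI_le => //; first exact: IntD.
  move=> x; rewrite /= !mulr1 /sq !reim -subr_ge0.
  set a := Re (v x); set b := Im (v x).
  set p := Re (f x); set q := Im (f x); set s := Re (r x); set t := Im (r x).
  have -> : 2 * ((p - a - s) ^+ 2 + (q - b - t) ^+ 2) + 2 * (s ^+ 2 + t ^+ 2) -
    ((a - p) ^+ 2 + (b - q) ^+ 2) = (p - a - 2 * s) ^+ 2 + (q - b - 2 * t) ^+ 2.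
    by ring.
  by rewrite addr_ge0// sqr_ge0.
rewrite r0 mulr0 addr0 -[e ^+ 2](_ : 4 * (e / 2) ^+ 2 = _); last by field.
by move: hv e20; move: (nsq _ _ _) (_ ^+ 2) => A B; clear; lra.
Qed.

End invariant_subspaces.

Theorem theorem3p4 (R : realType) (alpha : (circle R -> R[i]) -> R)
    (halpha : dominating_normalized_gauge_norm alpha)
    (calpha : continuous_gauge alpha)
    (W M : set (circle R -> R[i]))
    (linW : linear_subspace W) (closedW : gauge_closed alpha W)
    (linM : linear_subspace M) (closedM : weakstar_closed M)
    (zM : z_invariant M) (zW : z_invariant W) :
  [/\ M = gauge_closure alpha M `&` Lp +oo,
      weakstar_closed (W `&` M) &
      W = gauge_closure alpha (W `&` Lp +oo)].
Proof.
have bM := weakstar_bounded_closed closedM.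
have ML := closedM.1; have [WL cW] := closedW.
split.
- apply/seteqP; split=> [f Mf|f [[Lf fa] bf]].
    have Lf := ML _ Mf; split => //; split; first exact: Linfty_L_gauge.
    move=> e e0; exists f => //; under eq_fun do rewrite subrr.
    by rewrite (ext0 halpha).
  apply: (mean_closure linM zM bM bf) => e e0; have [v Mv hv] := fa _ e0.
  exists v => //; have Lvf := Linfty_sub (ML _ Mv) bf.
  rewrite -lte_fin -EFin_RI; last exact: Linfty_Int.
  apply: le_lt_trans hv.
  under eq_integral do rewrite normcB.
  apply: (ext_ge_RI halpha); exact: (Linfty_sub bf (ML _ Mv)).1.
- have SL : W `&` M `<=` Lp +oo by move=> f [_ /ML].
  have lS : linear_subspace (W `&` M).
    by split; [split; [exact: linW.1|exact: linM.1]|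
      move=> a f g [Wf Mf] [Wg Mg]; split; [exact: linW.2|exact: linM.2]].
  have zS : z_invariant (W `&` M) by move=> f [Wf Mf]; split;
    [exact: zW|exact: zM].
  split => // F FS; suff : (W `&` M) (set_val F) by [].
  apply: (mean_closure lS zS); [|exact: set_valP|exact: weakstar_closure_mean FS].
  split => // f c Lf c0 fa; split.
    apply: (gauge_closed_bounded_limit halpha calpha closedW Lf c0) => e e0.
    by have [v [[Wv _] h1 h2]] := fa _ e0; exists v.
  apply: (bM.2 _ _ Lf c0) => e e0.
  by have [v [[_ Mv] h1 h2]] := fa _ e0; exists v.
- apply/seteqP; split=> [f Wf|f [Lf fa]]; last first.
    by apply: cW; split => // e e0; have [v [Wv _] hv] := fa _ e0; exists v.
  have Lf := WL _ Wf; split => // e e0.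
  have If := L_gauge_Int halpha Lf; have mf := Lf.1.1.
  set J := \int[haar R]_x normc (f x).
  have J0 : 0 <= J by apply: RI_ge0 => x; exact: normc_ge0.
  have [d d0 hd] := ext_mul_small halpha calpha Lf (ler0n R 3) e0.
  (* the multiplier of size 1 / (1 + t |f|), for a small t *)
  pose q := Num.min 1 (d / 4).
  have q0 : 0 < q by rewrite lt_min ltr01 divr_gt0.
  have q1 : q <= 1 by rewrite ge_min lexx.
  have q4 : q <= d / 4 by rewrite ge_min lexx orbT.
  pose t := q ^+ 2 / (J + 1).
  have J1 : 0 < J + 1 by rewrite ltr_wpDl.
  have t0 : 0 < t by rewrite divr_gt0// exprn_gt0.
  have tJ : t * J < q ^+ 2.
    rewrite /t -mulrA -[ltRHS]mulr1 ltr_pM2l ?exprn_gt0// mulrC ltr_pdivrMr// mul1r.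
    by rewrite ltrDl.
  have It := IntZ t If.
  have mt : measurable_fun setT (fun x => t * normc (f x)) := Int_meas It.
  have [|phi [c [/andP[c0 c1] hphi phih phi1]]] := outer_multiplier mt _ It.
    by move=> x; rewrite mulr_ge0 ?normc_ge0// ltW.
  rewrite RIZ// -/J in c1 phi1.
  have tJ0 : 0 <= t * J by rewrite mulr_ge0// ltW.
  have qq : q ^+ 2 <= q by rewrite expr2 ler_piMl// ltW.
  have c2 : c <= 2.
    by move: c1 tJ qq q1; move: (t * J) (q ^+ 2) => A B; clear; lra.
  have bphi := bounded_poly_limit_bounded_cfun hphi; have [mphi phic _] := hphi.
  exists (fun x => phi x * f x).
    split; first exact: (gauge_closed_mul halpha calpha linW zW closedW hphi Wf).
    apply: bounded_cfun_Linfty; split; first exact: measurable_cM.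
    exists (c / t) => x; rewrite normcM ler_pdivlMr//.
    by rewrite -mulrA [normc (f x) * _]mulrC.
  have -> : (fun w => f w - phi w * f w) = (fun w => (1 - phi w) * f w).
    by apply/funext => x; ring.
  apply: hd; first by apply: measurable_cB.
    move=> x; rewrite (le_trans (normcD _ _))// normcN normc1.
    by have := phic x; clear -c2; lra.
  under eq_Rintegral do rewrite normcB.
  have sq_le : Num.sqrt (t * J) <= q.
    rewrite -(ger0_norm (ltW q0)) -sqrtr_sqr ler_sqrt ?sqr_ge0//.
    exact: ltW.
  apply: le_lt_trans phi1 _.
  by clear -sq_le tJ qq q4 q0; lra.
Qed.
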